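(* Let $(x_0,u_0)$ be a Pareto optimal solution of the multiobjective Mayer problem $(\mathcal M)$. Assume: (a) $f$ is continuous on $[0,T]\times\Omega\times U$; $D_{G,2}f(t,\xi,\zeta)$ exists for all $(t,\xi,\zeta)\in[0,T]\times\Omega\times U$; $D_{F,2}f(t,x_0(t),\zeta)$ exists for all $(t,\zeta)\in[0,T]\times U$; and $(t,\zeta)\mapsto D_{F,2}f(t,x_0(t),\zeta)$ is continuous from $[0,T]\times U$ to $\mathcal L(E,E)$; (b) for all non-empty compact $K\subset\Omega$, $M\subset U$, $\sup_{(t,\xi,\zeta)\in[0,T]\times K\times M}\|D_{G,2}f(t,\xi,\zeta)\|_{\mathcal L}<+\infty$; (c) all $g_i^0$ and all $g^\alpha$ are Hadamard differentiable at $x_0(T)$; (d) each $h^\beta$ is continuous on a neighborhood of $x_0(T)$ and Hadamard differentiable at $x_0(T)$; (e) $U$ is a subset of a real normed vector space $Y$ such that $U$ is a neighborhood of $u_0(T)$ in $Y$, $D_{G,3}f(T,x_0(T),u_0(T))$ exists, and the $m+q$ functionals $D_Hg^\alpha(x_0(T))\circ D_{G,3}f(T,x_0(T),u_0(T))$ ($1\le\alpha\le m$), $D_Hh^\beta(x_0(T))\circ D_{G,3}f(T,x_0(T),u_0(T))$ ($1\le\beta\le q$) form a linearly independent family in $Y^*$. Then there exist $((\theta_i)_{1\le i\le l},(\lambda_\alpha)_{1\le\alpha\le m},(\mu_\beta)_{1\le\beta\le q},p)\in\mathbb R^l\times\mathbb R^m\times\mathbb R^q\times PC^1([0,T],E^*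 )$ satisfying the Pontryagin conditions (NN), (Si), (S$\ell$), (TC), (AE.M), (MP.M), (CH.M) listed in the context, and for every such tuple, $(\theta_i)_{1\le i\le l}\ne0$.
   Context: Function spaces. Fix $T\in(0,+\infty)$. Let $Y$ be a Hausdorff space. A function $u:[0,T]\to Y$ is piecewise continuous if there is a subdivision $0=\tau_0<\tau_1<\dots<\tau_{k+1}=T$ such that $u$ is continuous on each $(\tau_i,\tau_{i+1})$, the right limits $u(\tau_i+)$ exist in $Y$ for $0\le i\le k$ and the left limits $u(\tau_i-)$ exist in $Y$ for $1\le i\le k+1$. $NPC^0([0,T],Y)$ is the set of piecewise continuous $u$ that are right continuous on $[0,T)$ and satisfy $u(T-)=u(T)$. If $Y$ is a real Banach space, $PC^1([0,T],Y)$ is the set of continuous $x:[0,T]\to Y$ for which there is a subdivision as before such that $x$ is continuously differentiable on each $(\tau_i,\tau_{i+1})$ and the one-sided limits $x'(\tau_i+)$ ($0\le i\le k$), $x'(\tau_i-)$ ($1\le i\le k+1$) exist in $Y$; for open $G\subset Y$, $PC^1([0,T],G)=\{x\in PC^1([0,T],Y): x([0,T])\subset G\}$. The extended derivative $\underline{d}x:[0,T]\to Y$ of such $x$ is $\underline{d}x(t)=x'(t)$ if $t\notin\{\tau_0,\dots,\tau_{k+1}\}$, $\underline{d}x(\tau_i)=x'(\tau_i+)$ for $0\le i\le k$, $\underline{d}x(T)=x'(T-)$. Differentials. For real normed spaces $X,Y$, $\mathcal L(X,Y)$ is the space of bounded linear maps with operator norm $\|\cdot\|_{\mathcal L}$ and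 $X^*=\mathcal L(X,\mathbb R)$. Let $G\subset X$ be non-empty open (or a neighborhood of the point considered), $\mathfrak f:G\to Y$, $x\in G$. $\mathfrak f$ is Gâteaux differentiable at $x$ if there is $D_G\mathfrak f(x)\in\mathcal L(X,Y)$ with $\lim_{t\to0+}\frac{\mathfrak f(x+th)-\mathfrak f(x)}{t}=D_G\mathfrak f(x)\cdot h$ for all $h\in X$; it is Hadamard differentiable at $x$ if there is $D_H\mathfrak f(x)\in\mathcal L(X,Y)$ such that for each compact $K\subset X$, $\lim_{t\to0+}\sup_{h\in K}\|\frac{\mathfrak f(x+th)-\mathfrak f(x)}{t}-D_H\mathfrak f(x)\cdot h\|=0$. $D_F\mathfrak f(x)$ is the Fréchet differential. $D_{G,k}$, $D_{F,k}$ denote partial Gâteaux/Fréchet differentials with respect to the $k$-th variable ($D_{G,3}f(t,\xi,\zeta)$ is the Gâteaux differential at $\zeta$ of $f(t,\xi,\cdot)$). Problem. $E$ is a real Banach space, $\Omega\subset E$ a non-empty open subset, $U$ a Hausdorff topological space, $\xi_0\in\Omega$, $l,m,q$ positive integers, $f:[0,T]\times\Omega\times U\to E$, and $g_i^0,g^\alpha,h^\beta:\Omega\to\mathbb R$ ($1\le i\le l$, $1\le\alpha\le m$, $1\le\beta\le q$). The multiobjective Mayer problem $(\mathcal M)$ is: maximize $(J_1(x,u),\dots,J_l(x,u))$, $J_i(x,u)=g_i^0(x(T))$, over $x\in PC^1([0,T],\Omega)$, $u\in NPC^0([0,T],U)$ subject to $\underline{d}x(t)=f(t,x(t),u(t))$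 for all $t\in[0,T]$, $x(0)=\xi_0$, $g^\alpha(x(T))\ge0$ for all $\alpha$, $h^\beta(x(T))=0$ for all $\beta$. Pairs $(x,u)$ satisfying these constraints are admissible. An admissible $(\overline x,\overline u)$ is a Pareto optimal solution if there is no admissible $(x,u)$ with $J_i(x,u)\ge J_i(\overline x,\overline u)$ for all $i$ and $J_{i_0}(x,u)>J_{i_0}(\overline x,\overline u)$ for some $i_0$. Hamiltonian: $H_M:[0,T]\times\Omega\times U\times E^*\to\mathbb R$, $H_M(t,x,u,p)=p\cdot f(t,x,u)$. Pontryagin conditions for $((\theta_i),(\lambda_\alpha),(\mu_\beta),p)$ at $(x_0,u_0)$: (NN) $((\theta_i)_i,(\lambda_\alpha)_\alpha,(\mu_\beta)_\beta)\ne 0$; (Si) $\theta_i\ge0$ for all $i$ and $\lambda_\alpha\ge 0$ for all $\alpha$; (S$\ell$) $\lambda_\alpha g^\alpha(x_0(T))=0$ for all $\alpha$; (TC) $\sum_{i=1}^l\theta_iD_Hg_i^0(x_0(T))+\sum_{\alpha=1}^m\lambda_\alpha D_Hg^\alpha(x_0(T))+\sum_{\beta=1}^q\mu_\beta D_Hh^\beta(x_0(T))=p(T)$; (AE.M) $\underline{d}p(t)=-D_{F,2}H_M(t,x_0(t),u_0(t),p(t))$ for all $t\in[0,T]$; (MP.M) $H_M(t,x_0(t),u_0(t),p(t))\ge H_M(t,x_0(t),\zeta,p(t))$ for all $t\in[0,T]$, $\zeta\in U$; (CH.M) $t\mapsto H_M(t,x_0(t),u_0(t),p(t))$ is continuous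 on $[0,T]$. *)

(* Defs.v *)
From HB Require Import structures.
From mathcomp Require Import all_boot all_order all_algebra.
From mathcomp Require Import all_classical all_reals all_analysis.

Set Implicit Arguments.
Unset Strict Implicit.
Unset Printing Implicit Defensive.

Import Order.TTheory GRing.Theory Num.Theory.
Import numFieldNormedType.Exports.

Local Open Scope classical_set_scope.
Local Open Scope ring_scope.

(* Bounded linear maps X -> Y, as a normed module for the operator norm
   sup {|f x| : |x| <= 1}. *)
Section BoundedLinearMaps.
Context {R : realType} {X Y : normedModType R}.

Definition bounded_linear : {pred X -> Y} := fun f =>
  `[< linear f /\ exists C : R, forall x, `|f x| <= C * `|x| >].

Lemma bounded_linearP (f : X -> Y) : reflect
  (linear f /\ exists C : R, forall x, `|f x| <= C * `|x|)
  (f \in bounded_linear).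
Proof. exact: asboolP. Qed.

Lemma bounded_linear_submod : submod_closed bounded_linear.
Proof.
split.
  apply/bounded_linearP; split=> [a x y|]; first by rewrite scaler0 addr0.
  by exists 0 => x; rewrite normr0 mul0r.
move=> a f g /bounded_linearP[lf [C fC]] /bounded_linearP[lg [D gD]].
apply/bounded_linearP; split=> [b x y|].
  change (a *: f (b *: x + y) + g (b *: x + y)
    = b *: (a *: f x + g x) + (a *: f y + g y)).
  by rewrite lf lg !scalerDr !scalerA (mulrC a b) addrACA -!addrA.
exists (`|a| * C + D) => x.
change (`|a *: f x + g x| <= (`|a| * C + D) * `|x|).
rewrite (le_trans (ler_normD _ _))// mulrDl lerD// normrZ -mulrA.
by rewrite ler_wpM2l.
Qed.

HB.instance Definition _ :=
  GRing.isSubmodClosed.Build R (X -> Y) bounded_linear bounded_linear_submod.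

Record blin := BLin {
  blin_fun :> X -> Y ;
  blin_subproof : blin_fun \in bounded_linear }.

HB.instance Definition _ := [isSub for blin_fun].
HB.instance Definition _ := [Choice of blin by <:].
HB.instance Definition _ := [SubChoice_isSubLmodule of blin by <:].

Lemma blin_linear (f : blin) : linear f.
Proof. by have /bounded_linearP[] := blin_subproof f. Qed.

HB.instance Definition _ (f : blin) :=
  GRing.isLinear.Build R X Y *:%R (blin_fun f) (blin_linear f).

Lemma blin_bounded (f : blin) : exists C : R, forall x, `|f x| <= C * `|x|.
Proof. by have /bounded_linearP[] := blin_subproof f. Qed.

Definition opnorm (f : blin) : R := sup [set `|f x| | x in [set x | `|x| <= 1]].

Lemma opnorm_has_sup (f : blin) :
  has_sup [set `|f x| | x in [set x | `|x| <= 1]].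
Proof.
split; first by exists `|f 0|, 0 => //=; rewrite normr0.
have [C fC] := blin_bounded f; exists `|C| => _ [x /= x1 <-].
rewrite (le_trans (fC x))// (le_trans (ler_wpM2r _ (ler_norm C)))//.
by rewrite ler_piMr.
Qed.

Lemma opnorm_ge (f : blin) x : `|x| <= 1 -> `|f x| <= opnorm f.
Proof. by move=> x1; apply: ub_le_sup; [exact: (opnorm_has_sup f).2|exists x]. Qed.

Lemma opnorm_le (f : blin) (C : R) :
  (forall x, `|x| <= 1 -> `|f x| <= C) -> opnorm f <= C.
Proof.
move=> fC; apply: ge_sup; first exact: (opnorm_has_sup f).1.
by move=> _ [x /= x1 <-]; exact: fC.
Qed.

Lemma opnorm_ge0 (f : blin) : 0 <= opnorm f.
Proof. by rewrite (le_trans _ (@opnorm_ge f 0 _))// normr0. Qed.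

Lemma opnormP (f : blin) x : `|f x| <= opnorm f * `|x|.
Proof.
have [->|x0] := eqVneq x 0; first by rewrite linear0 !normr0 mulr0.
have nx0 : 0 < `|x| by rewrite normr_gt0.
rewrite -ler_pdivrMr//.
have <- : `|f (`|x|^-1 *: x)| = `|f x| / `|x|.
  by rewrite linearZ normrZ ger0_norm ?invr_ge0// mulrC.
by apply: opnorm_ge; rewrite normrZ ger0_norm ?invr_ge0// mulVf// gt_eqF.
Qed.

Lemma opnormD (f g : blin) : opnorm (f + g) <= opnorm f + opnorm g.
Proof.
apply: opnorm_le => x x1.
by rewrite (le_trans (ler_normD _ _))// lerD// opnorm_ge.
Qed.

Lemma opnormZ (a : R) (f : blin) : opnorm (a *: f) = `|a| * opnorm f.
Proof.
have le (b : R) (g : blin) : opnorm (b *: g) <= `|b| * opnorm g.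
  apply: opnorm_le => x x1.
  change (`|b *: g x| <= `|b| * opnorm g).
  by rewrite normrZ ler_wpM2l// opnorm_ge.
have [->|a0] := eqVneq a 0.
  by apply/le_anti; rewrite le //= normr0 mul0r opnorm_ge0.
apply/le_anti; rewrite le/=.
have := le a^-1 (a *: f).
rewrite scalerA mulVf// scale1r normfV mulrC ler_pdivlMr ?normr_gt0//.
by rewrite mulrC.
Qed.

Lemma opnorm_eq0 (f : blin) : opnorm f = 0 -> f = 0.
Proof.
move=> f0; apply/val_inj/funext => x; apply/eqP.
by rewrite -normr_le0 (le_trans (opnormP f x))// f0 mul0r.
Qed.

HB.instance Definition _ :=
  @Lmodule_isNormed.Build R blin opnorm opnormD opnormZ opnorm_eq0.

End BoundedLinearMaps.

Arguments blin {R} X Y.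

Section BoundedLinearComposition.
Context {R : realType} {X Y Z : normedModType R}.

Lemma blin_comp_subproof (g : blin Y Z) (f : blin X Y) :
  (g : Y -> Z) \o f \in @bounded_linear R X Z.
Proof.
apply/bounded_linearP; split=> [a x y|/=]; first by rewrite /= !linearP.
exists (opnorm g * opnorm f) => x.
by rewrite (le_trans (opnormP g _))// -mulrA ler_wpM2l ?opnorm_ge0 ?opnormP.
Qed.

Definition blin_comp (g : blin Y Z) (f : blin X Y) : blin X Z :=
  BLin (blin_comp_subproof g f).

End BoundedLinearComposition.

(* The maps to be differentiated are total functions, of which only the values
   near the point considered are used. The differentials Dgateaux, Dhadamard
   and Dfrechet are 0 where the map is not differentiable. *)
Section Differentials.
Context {R : realType} {X Y : normedModType R}.
Implicit Types (f : X -> Y) (x : X) (D : blin X Y).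

Definition is_gateaux f x D := forall h : X,
  t^-1 *: (f (x + t *: h) - f x) @[t --> (0 : R)^'+] --> D h.

Definition gateaux_differentiable f x := exists D, is_gateaux f x D.

Definition Dgateaux f x : blin X Y := xget 0 [set D | is_gateaux f x D].

(* The supremum is an extended real one since the difference quotient may be
   unbounded on K; K is non-empty since ereal_sup set0 = -oo. *)
Definition is_hadamard f x D := forall K : set X, compact K -> K !=set0 ->
  ereal_sup [set (`|t^-1 *: (f (x + t *: h) - f x) - D h|)%:E | h in K]
    @[t --> (0 : R)^'+] --> 0%E.

Definition hadamard_differentiable f x := exists D, is_hadamard f x D.

Definition Dhadamard f x : blin X Y := xget 0 [set D | is_hadamard f x D].

Definition Dfrechet f x : blin X Y :=
  xget 0 [set D : blin X Y | is_diff x f (D : X -> Y)].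

Lemma DfrechetP f x : differentiable f x -> 'd f x = Dfrechet f x :> (X -> Y).
Proof.
move=> df; rewrite /Dfrechet; case: xgetP => [D _ []//|noD].
have bd : ('d f x : X -> Y) \in @bounded_linear R X Y.
  apply/bounded_linearP; split; first exact: linearP.
  have dc : continuous ('d f x) by exact: diff_continuous.
  have /linear_bounded_continuous/linear_boundedP/pinfty_ex_gt0[C _ dC] := dc.
  by exists C.
by case: (noD (BLin bd)); split.
Qed.

End Differentials.

Section PiecewiseFunctions.
Context {R : realType}.

(* A subdivision 0 = tau_0 < ... < tau_(k+1) = T is the list
   s = [:: tau_1; ...; tau_(k+1)], so that tau_i = nth T (0 :: s) i and
   k + 1 = size s. *)

Definition piecewise_continuous_along (Y : topologicalType) (T : R) (A : set Y)
    (u : R -> Y) (s : seq R) :=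
  itv_partition 0 T s /\
  forall i, (i < size s)%N ->
    let a := nth T (0 :: s) i in let b := nth T (0 :: s) i.+1 in
    [/\ {in `]a, b[, continuous u},
        exists2 y, A y & u t @[t --> a^'+] --> y &
        exists2 y, A y & u t @[t --> b^'-] --> y].

(* Piecewise continuity of u : [0, T] -> A, with A a subspace of Y: the
   one-sided limits belong to A. *)
Definition piecewise_continuous (Y : topologicalType) (T : R) (A : set Y)
    (u : R -> Y) :=
  (forall t, t \in `[0, T] -> A (u t)) /\
  exists s, piecewise_continuous_along T A u s.

Definition NPC0 (Y : topologicalType) (T : R) (A : set Y) : set (R -> Y) :=
  [set u | [/\ piecewise_continuous T A u,
               forall t, t \in `[0, T[ -> u s @[s --> t^'+] --> u t &
               u s @[s --> T^'-] --> u T]].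

Definition piecewise_C1_along (Y : normedModType R) (T : R) (x : R -> Y)
    (s : seq R) :=
  piecewise_continuous_along T setT (derive1 x) s /\
  forall i, (i < size s)%N ->
    {in `]nth T (0 :: s) i, nth T (0 :: s) i.+1[,
      forall t, derivable x t 1}.

Definition PC1 (Y : normedModType R) (T : R) (G : set Y) : set (R -> Y) :=
  [set x | [/\ {within `[0, T], continuous x},
               exists s, piecewise_C1_along T x s &
               forall t, t \in `[0, T] -> G (x t)]].

(* The value does not depend on the choice of the subdivision s. *)
Definition ext_deriv (Y : normedModType R) (T : R) (x : R -> Y) (t : R) : Y :=
  let s := xget [::] [set s | piecewise_C1_along T x s] in
  if t == T then lim (derive1 x r @[r --> T^'-])
  else if t \in 0 :: s then lim (derive1 x r @[r --> t^'+])
  else derive1 x t.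

End PiecewiseFunctions.

Definition linearly_independent (R : realType) (V : lmodType R) (I : finType)
    (v : I -> V) :=
  forall c : I -> R, \sum_(i : I) c i *: v i = 0 -> forall i, c i = 0.

Section MayerProblem.
Context {R : realType} {E : completeNormedModType R} {W : topologicalType}.

(* The control space U is a subspace of W. The maps f, g0, g, h are total
   functions of which only the values on [0, T] * Omega * U, resp. Omega, are
   used. *)

Definition admissible (T : R) (Omega : set E) (U : set W) (xi0 : E)
    (f : R -> E -> W -> E) (m q : nat) (g : 'I_m -> E -> R^o)
    (h : 'I_q -> E -> R^o) (x : R -> E) (u : R -> W) :=
  [/\ PC1 T Omega x /\ NPC0 T U u,
      forall t, t \in `[0, T] -> ext_deriv T x t = f t (x t) (u t),
      x 0 = xi0,
      forall a, 0 <= g a (x T) &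
      forall b, h b (x T) = 0].

Definition pareto_optimal (T : R) (Omega : set E) (U : set W) (xi0 : E)
    (f : R -> E -> W -> E) (l m q : nat) (g0 : 'I_l -> E -> R^o)
    (g : 'I_m -> E -> R^o) (h : 'I_q -> E -> R^o) (x0 : R -> E) (u0 : R -> W) :=
  admissible T Omega U xi0 f g h x0 u0 /\
  ~ exists x u, [/\ admissible T Omega U xi0 f g h x u,
      forall i, g0 i (x0 T) <= g0 i (x T) &
      exists i0, g0 i0 (x0 T) < g0 i0 (x T)].

Definition hamiltonian (f : R -> E -> W -> E) (t : R) (x : E) (u : W)
    (p : blin E R^o) : R^o := p (f t x u).

Definition pontryagin (T : R) (U : set W)
    (f : R -> E -> W -> E) (l m q : nat) (g0 : 'I_l -> E -> R^o)
    (g : 'I_m -> E -> R^o) (h : 'I_q -> E -> R^o) (x0 : R -> E) (u0 : R -> W)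
    (theta : 'rV[R]_l) (lambda : 'rV[R]_m) (mu : 'rV[R]_q)
    (p : R -> blin E R^o) :=
  let NN := (theta, lambda, mu) <> (0, 0, 0) in
  let Si := (forall i, 0 <= theta 0 i) /\ (forall a, 0 <= lambda 0 a) in
  let Sl := forall a, lambda 0 a * g a (x0 T) = 0 in
  let TC := \sum_i theta 0 i *: Dhadamard (g0 i) (x0 T)
      + \sum_a lambda 0 a *: Dhadamard (g a) (x0 T)
      + \sum_b mu 0 b *: Dhadamard (h b) (x0 T) = p T in
  let AE := forall t, t \in `[0, T] ->
      let Ht := fun xi => hamiltonian f t xi (u0 t) (p t) in
      differentiable Ht (x0 t) /\ ext_deriv T p t = - Dfrechet Ht (x0 t) in
  let MP := forall t zeta, t \in `[0, T] -> U zeta ->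
      hamiltonian f t (x0 t) zeta (p t)
        <= hamiltonian f t (x0 t) (u0 t) (p t) in
  let CH := {within `[0, T], continuous
      (fun t => hamiltonian f t (x0 t) (u0 t) (p t))} in
  [/\ NN, Si, Sl & [/\ TC, AE, MP & CH]].

End MayerProblem.

(* Main.v *)
Require Import Defs.
From HB Require Import structures.
From mathcomp Require Import all_boot all_order all_algebra.
From mathcomp Require Import boolp.
From mathcomp Require Import zify ring lra.

Set Implicit Arguments.
Unset Strict Implicit.
Unset Printing Implicit Defensive.

(* Replacing u0 by constants v_i on finitely many intervals of length eps * al_i
   following the instants t_i yields a trajectory ending at
   x0(T) + eps * sum_i al_i y_i(T) + o(eps), uniformly in al, where y_i solves
   the linearised equation from t_i with initial value the jump
   f(t_i, x0(t_i), v_i) - f(t_i, x0(t_i), u0(t_i)); moreover the end point is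
   continuous in al. The first-order variations of the objectives and
   constraints obtained in this way form a convex cone. If it were dense,
   Brouwer's theorem applied to al in a simplex would give, for small eps, a
   trajectory satisfying the equality constraints exactly and improving all
   objectives. Hence the cone is annihilated by non-zero multipliers, and the
   adjoint equation transports their inequalities from T to t_i, which is the
   maximum principle. If theta = 0, the maximum principle at T and the
   independence of the functionals force lambda = mu = 0.

   The linearisation of f along x0 is only a pointwise limit in time. A Fréchet
   remainder not yet small at some instant is absorbed by the measure of the
   open set of bad instants, which tends to 0 with the size of the variation. *)

(** * Scarf's lemma on grids *)

(** The end point is only known to depend continuously on the needle lengths, and the endpoint data
    are only Hadamard differentiable, so no inverse function theorem applies: a fixed point on a
    simplex replaces it, and Hadamard differentiability suffices because the directions that occur
    form a compact set. Brouwer's theorem comes from Scarf's lemma, a parity count on finite linear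
    orders that needs no triangulation. Trajectories are compared by one Gronwall inequality with
    right increments and finitely many exceptional times; its forcing term is the increment of a
    monotone [G], which charges alike the lengths of needles and the measure of bad instants. As
    hypothesis (b) concerns compact sets only, bounds near the reference trajectory are obtained by
    contradiction: counterexamples approaching it form, together with it, a compact set. The
    dynamics is then retracted onto a tube, which makes it globally Lipschitz, and Gronwall shows
    that solutions stay in the tube. Controls may jump, yet the Hamiltonian is continuous, because
    both one-sided values of the control maximise it. *)

Section Scarf.
(** Each [r i] ranks [W] linearly. The points [e i] are ideal ones standing for the faces of a
    simplex: [e i] is least in the order [i] and above all ordinary points in the other orders. [c]
    is a colouring. *)
Variables (W I : finType) (r : I -> W -> nat) (e : I -> W) (c : W -> I).
Hypothesis r_inj : forall i, injective (r i).
Hypothesis e_min : forall i w, w != e i -> r i (e i) < r i w.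
Hypothesis e_max : forall i j w, j != i -> w \notin codom e -> r i w < r i (e j).
Hypothesis c_e : forall i, c (e i) = i.
Hypothesis I_gt1 : 1 < #|I|.

(** These are Scarf's primitive sets: no point of [W] lies strictly above the minimum of [Z] in all
    orders at once. *)
Definition dominant (Z : {set W}) :=
  [forall y, exists i, [forall z in Z, r i y <= r i z]].

Lemma dominantP (Z : {set W}) : reflect
  (forall y, exists i, forall z, z \in Z -> r i y <= r i z) (dominant Z).
Proof.
apply: (iffP forallP) => H y; have := H y.
  by move=> /existsP[i /forall_inP]; exists i.
by move=> [i Hi]; apply/existsP; exists i; apply/forall_inP.
Qed.

Let e_inj : injective e.
Proof. by move=> i j eij; rewrite -(c_e i) eij c_e. Qed.

Lemma argmin_fun (Z : {set W}) : Z != set0 -> exists a : I -> W,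
  forall i, a i \in Z /\ forall z, z \in Z -> r i (a i) <= r i z.
Proof.
move=> /set0Pn[z0 z0Z]; exists (fun i => [arg min_(z < z0 in Z) r i z]) => i.
by case: arg_minnP => // z zZ zmin; split.
Qed.

Lemma argmin_uniq (Z : {set W}) (a : I -> W) i z :
  (forall i, a i \in Z /\ forall z, z \in Z -> r i (a i) <= r i z) ->
  z \in Z -> (forall w, w \in Z -> r i z <= r i w) -> a i = z.
Proof.
move=> aP zZ zmin; apply: (r_inj (i := i)); have [aZ amin] := aP i.
by apply/eqP; rewrite eqn_leq amin// zmin.
Qed.

(** Dominance tested at an element of [Z] itself makes this element the minimum of some order. Hence
    a dominant set has at most [#|I|] elements. *)
Lemma argmin_surj (Z : {set W}) (a : I -> W) : dominant Z ->
  (forall i, a i \in Z /\ forall z, z \in Z -> r i (a i) <= r i z) ->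
  a @: setT = Z.
Proof.
move=> /dominantP dZ aP; apply/setP => z; apply/imsetP/idP => [[i _ ->]|zZ].
  by have [] := aP i.
by have [i imin] := dZ z; exists i => //; apply/esym/(argmin_uniq aP).
Qed.

(* A surjection from n + 1 elements onto n identifies exactly one pair. *)
Lemma surj_one_collision (a : I -> W) (Z : {set W}) :
  a @: setT = Z -> #|Z|.+1 = #|I| ->
  exists i j, [/\ i != j, a i = a j &
    forall k, {in [set~ k] &, injective a} -> (k == i) || (k == j)].
Proof.
move=> aZ cZ.
have /injectivePn[i [j ij aij]] : ~~ injectiveb a.
  apply/injectiveP => /card_imset => /(_ [set: I]).
  by rewrite aZ cardsT => E; move: cZ; rewrite E; lia.
exists i, j; split=> // k kinj; apply/negPn/negP; rewrite negb_or => /andP[ki kj].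
by move: ij; rewrite (kinj i j) ?eqxx// !inE eq_sym.
Qed.

(** Candidates for enlarging [Z] by a new minimum of the order [k]: in all the other orders they do
    not displace the minimum of [Z]. *)
Definition above (Z : {set W}) k :=
  [set y | [forall h, (h != k) ==> [exists z in Z, r h z < r h y]]].

Lemma aboveP (Z : {set W}) k y : reflect
  (forall h, h != k -> exists2 z, z \in Z & r h z < r h y) (y \in above Z k).
Proof.
rewrite inE; apply: (iffP forallP) => H h; have := H h.
  by move=> /implyP Hh hk; have /exists_inP := Hh hk.
by move=> Hh; apply/implyP => hk; apply/exists_inP/Hh.
Qed.

Definition rooms (Z : {set W}) := [set y | (y \notin Z) && dominant (y |: Z)].

Definition top_above (Z : {set W}) k :=
  [set y in above Z k | [forall w in above Z k, r k w <= r k y]].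

Lemma card_top_above (Z : {set W}) k : #|top_above Z k| = (above Z k != set0).
Proof.
rewrite /top_above; have [->|/set0Pn[y0 y0P]] := eqVneq (above Z k) set0.
  apply/eqP; rewrite cards_eq0; apply/eqP/setP => y.
  by rewrite !inE.
apply/eqP/cards1P; exists [arg max_(y > y0 in above Z k) r k y].
case: arg_maxnP => // y yP ymax; apply/setP => w; rewrite in_set1 inE.
apply/andP/eqP => [[wP /forall_inP wmax]|->].
  by apply: (r_inj (i := k)); apply/eqP; rewrite eqn_leq wmax// andbT; exact: ymax.
by split=> //; apply/forall_inP => v; exact: ymax.
Qed.

(** A set with one element fewer than there are orders has exactly one element serving as minimum
    twice, for [i] and [j]. A point added to [Z] must take over one of these two orders, and
    dominance survives only for the highest candidate. *)
Lemma rooms_top_above (Z : {set W}) (a : I -> W) i j : dominant Z -> #|Z|.+1 = #|I| ->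
  (forall i, a i \in Z /\ forall z, z \in Z -> r i (a i) <= r i z) ->
  i != j -> a i = a j ->
  (forall k, {in [set~ k] &, injective a} -> (k == i) || (k == j)) ->
  rooms Z = top_above Z i :|: top_above Z j.
Proof.
move=> dZ cZ aP ij aij ijP.
have aZ := argmin_surj dZ aP.
have topR k h : k != h -> a k = a h -> top_above Z k \subset rooms Z.
  move=> kh akh; apply/fintype.subsetP => y; rewrite inE => /andP[yk /forall_inP ymax].
  have yZ : y \notin Z.
    apply/negP => yZ; have [g ymin] := (dominantP Z dZ) y.
    have [g' g'k ag'] : exists2 g', g' != k & a g' = y.
      have ag := argmin_uniq aP yZ ymin.
      have [gk|gk] := eqVneq g k; last by exists g.
      by exists h; rewrite 1?eq_sym// -akh -gk.
    have /aboveP/(_ _ g'k)[z zZ] := yk.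
    by rewrite -ag' ltnNge (aP g').2.
  rewrite inE yZ; apply/dominantP => w.
  have [g wmin] := (dominantP Z dZ) w.
  have [wy|yw] := leqP (r g w) (r g y).
    by exists g => z /setU1P[->//|]; exact: wmin.
  have gk : g = k.
    apply/eqP/negP => /negP gk; have /aboveP/(_ _ gk)[z zZ] := yk.
    by have := wmin _ zZ; lia.
  (* Since [w] beats the highest candidate [y] in the order [k], it is no candidate; an order [g']
     in which it fails to be one puts [w] below [Z], and also below [y]. *)
  have : w \notin above Z k by apply/negP => /ymax; rewrite -gk; lia.
  rewrite inE => /forallPn[g']; rewrite negb_imply => /andP[g'k].
  move=> /exists_inPn wlow; exists g' => z /setU1P[->|/wlow]; last by lia.
  have /aboveP/(_ _ g'k)[z' z'Z] := yk.
  by have := wlow _ z'Z; lia.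
apply/eqP; rewrite eqEsubset; apply/andP; split; last first.
  by rewrite subUset (topR _ _ ij)// (topR j i)// eq_sym.
apply/fintype.subsetP => y; rewrite inE => /andP[yZ dyZ].
have yZ0 : y |: Z != set0 by apply/set0Pn; exists y; rewrite setU11.
have [a' a'P] := argmin_fun yZ0.
have a'Z := argmin_surj dyZ a'P.
(* The enlarged set has as many elements as there are orders, so each of them, in particular [y], is
   the minimum of exactly one order. *)
have a'inj : injective a'.
  have /imset_injP H : #|a' @: setT| == #|[set: I]|.
    by rewrite a'Z cardsU1 yZ cardsT -cZ add1n.
  by move=> u v; apply: H; rewrite inE.
have /imsetP[k _ yk] : y \in a' @: setT by rewrite a'Z setU11.
have a'Zk h : h != k -> a' h \in Z.
  move=> hk; have [+ _] := a'P h; rewrite in_setU1 => /orP[/eqP|//].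
  by rewrite {1}yk => /a'inj; move/eqP: hk.
have aa' h : h != k -> a h = a' h.
  move=> hk; apply: (argmin_uniq aP); first exact: a'Zk.
  by move=> w wZ; apply: (a'P h).2; rewrite in_setU1 wZ orbT.
have kij : (k == i) || (k == j).
  apply: ijP => u v; rewrite !inE => uk vk; rewrite !aa'//; exact: a'inj.
have ytop : y \in top_above Z k.
  rewrite inE; apply/andP; split.
    apply/aboveP => h hk; exists (a' h); first exact: a'Zk.
    rewrite ltn_neqAle (a'P h).2 ?setU11// andbT.
    by apply/eqP => /r_inj; rewrite {1}yk => /a'inj; move/eqP: hk.
  apply/forall_inP => w wk.
  have [g wmin] := (dominantP _ dyZ) w.
  have [gk|gk] := eqVneq g k; first by rewrite -gk; apply: wmin; rewrite setU11.
  have /aboveP/(_ _ gk)[z zZ] := wk.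
  by have := wmin z; rewrite in_setU1 zZ orbT => /(_ isT); lia.
by rewrite inE; case/orP: kij => /eqP <-; rewrite ytop ?orbT.
Qed.

(** Each of the two orders sharing a minimum contributes at most one room. Both do when [Z] has an
    ordinary point, and exactly one does when all points of [Z] are ideal: doors on the outer
    boundary have a single side. *)
Lemma odd_rooms (Z : {set W}) : dominant Z -> #|Z|.+1 = #|I| ->
  odd #|rooms Z| = (Z \subset codom e).
Proof.
move=> dZ cZ.
have Z0 : Z != set0 by rewrite -cards_eq0; lia.
have [a aP] := argmin_fun Z0.
have aZ := argmin_surj dZ aP.
have [i [j [ij aij ijP]]] := surj_one_collision aZ cZ.
rewrite (rooms_top_above dZ cZ aP ij aij ijP) cardsU.
have -> : top_above Z i :&: top_above Z j = set0.
  apply/setP => y; rewrite in_set0; apply/negP => /setIP[].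
  rewrite [_ \in top_above Z i]inE [_ \in top_above Z j]inE.
  move=> /andP[/aboveP yi _] /andP[/aboveP yj _].
  have [g ymin] := (dominantP Z dZ) y.
  have [gi|/yi[z /ymin]] := eqVneq g i; last by lia.
  have gj : g != j by rewrite gi.
  by have [z /ymin] := yj _ gj; lia.
rewrite cards0 subn0 !card_top_above oddD !oddb.
have [Ze|/subsetPn[x xZ xe]] := boolP (Z \subset codom e); last first.
  (* In every order but [k], the ideal point [e k] is above the ordinary point [x], so it is a
     candidate for [k]. *)
  suff H k h : k != h -> above Z k != set0.
    by rewrite (H i j)// (H j i)// eq_sym.
  move=> kh; apply/set0Pn; exists (e k); apply/aboveP => g gk; exists x => //.
  by apply: e_max => //; rewrite eq_sym.
have [h hZ] : exists h, e h \notin Z.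
  apply/existsP; rewrite -negb_forall; apply/negP => /forallP eZ.
  have : #|codom e| <= #|Z| by apply/subset_leq_card/fintype.subsetP => _ /codomP[g ->].
  by rewrite card_codom//; lia.
have Zh : Z = e @: [set~ h].
  apply/eqP; rewrite eqEcard card_imset// cardsC1 -cZ leqnn andbT.
  apply/fintype.subsetP => w wZ; have /codomP[g wg] := fintype.subsetP Ze _ wZ.
  by apply/imsetP; exists g; rewrite // !inE; apply: contraNneq hZ => <-; rewrite -wg.
have eZ g : g != h -> e g \in Z.
  by move=> gh; rewrite Zh; apply/imsetP; exists g; rewrite ?inE.
have ae g : g != h -> a g = e g.
  move=> gh; apply: (argmin_uniq aP); first exact: eZ.
  by move=> w _; have [->//|/e_min/ltnW] := eqVneq w (e g).
have hne : above Z h != set0.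
  apply/set0Pn; exists (e h); apply/aboveP => g gh; exists (e g); first exact: eZ.
  by apply: e_min; apply: contra_neq gh => /e_inj.
(* Here the minimum of [Z] in the order [h] is [e k], so a candidate must be ideal to exceed it
   there; but an ideal [e g] with [g != k] exceeds nothing in the order [g], and [e k] itself is the
   minimum to be exceeded. *)
have other k : k != h -> a h = a k -> above Z k == set0.
  move=> kh; rewrite (ae k)// => ahk; apply/eqP/setP => y; rewrite in_set0.
  apply/negP => /aboveP yk.
  have [|z zZ zy] := yk h; first by rewrite eq_sym.
  have yz := (aP h).2 _ zZ.
  have /codomP[g yg] : y \in codom e.
    apply/negPn/negP => ye; have := e_max kh ye.
    by rewrite -ahk; lia.
  have [gk|/yk[z' _]] := eqVneq g k.
    by move: zy yz; rewrite ahk yg gk; lia.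
  by have [->|/e_min] := eqVneq z' (e g); rewrite yg; lia.
have [hi|hi] := eqVneq h i.
  have /other : j != h by rewrite hi eq_sym.
  by rewrite hi => /(_ aij) ->; rewrite -hi hne.
have [hj|hj] := eqVneq h j.
  have /other : i != h by rewrite hj.
  by rewrite hj => /(_ (esym aij)) ->; rewrite -hj hne.
by move: ij; rewrite -(inj_eq e_inj) -!ae 1?eq_sym// aij eqxx.
Qed.

(** In a fully coloured set only the point of colour [i0] can be removed. Otherwise a removable
    point [z] shares its colour with exactly one other point [z'], which is removable as well, so
    the facets come in pairs. *)
Lemma odd_color_facets (i0 : I) (Z : {set W}) : #|Z| = #|I| ->
  odd #|[set z in Z | c @: (Z :\ z) == [set~ i0]]| = (c @: Z == setT).
Proof.
move=> cZ; set F := [set z in Z | _].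
have facet_inj z : z \in F -> z \in Z /\ {in Z :\ z &, injective c}.
  rewrite inE => /andP[zZ /eqP Ez]; split=> //; apply/imset_injP.
  by rewrite Ez cardsC1 -cZ (cardsD1 z) zZ.
have [/eqP cZT|cZT] := boolP (_ == _).
  have cinj : {in Z &, injective c} by apply/imset_injP; rewrite cZT cardsT cZ.
  have /imsetP[z0 z0Z i0z] : i0 \in c @: Z by rewrite cZT inE.
  suff -> : F = [set z0] by rewrite cards1.
  apply/setP => z; rewrite in_set1 inE; apply/andP/eqP => [[zZ /eqP Ez]|->].
    apply/eqP/negPn/negP => zz0; have : i0 \in c @: (Z :\ z).
      by rewrite i0z imset_f// !inE z0Z eq_sym zz0.
    by rewrite Ez !inE eqxx.
  split=> //; apply/eqP/setP => i; rewrite !inE; apply/imsetP/idP => [[w + ->]|ii0].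
    by rewrite !inE i0z => /andP[ww0 wZ]; apply: contra_neq ww0; exact: cinj.
  have /imsetP[w wZ iw] : i \in c @: Z by rewrite cZT inE.
  exists w => //; rewrite !inE wZ andbT; apply: contra_neq ii0 => ww0.
  by rewrite iw ww0.
have [->|/set0Pn[z zF]] := eqVneq F set0; first by rewrite cards0.
have [zZ zinj] := facet_inj _ zF.
have Ez : c @: (Z :\ z) = [set~ i0] by move: zF; rewrite inE => /andP[_ /eqP].
have cz : c z != i0.
  apply: contra cZT => /eqP cz; apply/eqP/setP => i; rewrite [RHS]inE.
  have [->|ii0] := eqVneq i i0; first by rewrite -cz imset_f.
  have : i \in c @: (Z :\ z) by rewrite Ez !inE.
  by case/imsetP => w; rewrite !inE => /andP[_ wZ] ->; rewrite imset_f.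
have /imsetP[z' z'Z czz'] : c z \in c @: (Z :\ z) by rewrite Ez !inE.
have /andP[z'z z'Z'] : (z' != z) && (z' \in Z) by move: z'Z; rewrite !inE.
suff -> : F = [set z; z'] by rewrite cards2 eq_sym z'z.
apply/setP => w; rewrite in_set2; apply/idP/orP => [wF|[/eqP->//|/eqP->]].
  have [wZ winj] := facet_inj _ wF.
  have [|wz] := eqVneq w z; [by left|right]; apply/eqP/esym.
  apply/eqP/negPn/negP => z'w; move: z'z; rewrite (winj z' z) ?eqxx//.
    by rewrite !inE z'w.
  by rewrite !inE eq_sym wz.
rewrite inE z'Z' -Ez; apply/eqP/setP => i.
apply/imsetP/imsetP => -[v]; rewrite !inE => /andP[v1 vZ] ->.
  have [->|vz] := eqVneq v z; first by exists z'; rewrite ?inE ?z'z.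
  by exists v; rewrite ?inE ?vz.
have [->|vz] := eqVneq v z'; first by exists z; rewrite ?inE 1?eq_sym ?z'z.
by exists v; rewrite ?inE ?vz.
Qed.

Lemma subset_dominant (Z Z' : {set W}) : Z \subset Z' -> dominant Z' -> dominant Z.
Proof.
move=> /fintype.subsetP ZZ' /dominantP dZ'; apply/dominantP => y.
by have [i Hi] := dZ' y; exists i => z /ZZ'; exact: Hi.
Qed.

(* Following an ideal door between rooms shows that the number
   of fully coloured rooms has the parity of the number of outer doors missing
   the colour [i0], and there is exactly one of the latter. *)
Lemma scarf : exists Z : {set W}, [/\ dominant Z, #|Z| = #|I| & c @: Z = setT].
Proof.
have /card_gt0P[i0 _] : 0 < #|I| by lia.
pose door (Z : {set W}) := [&& dominant Z, #|Z|.+1 == #|I| & c @: Z == [set~ i0]].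
pose room (Z : {set W}) := dominant Z && (#|Z| == #|I|).
pose facets (Z : {set W}) := [set z in Z | c @: (Z :\ z) == [set~ i0]].
(* Both sums count the incidences between doors and rooms: a room with a marked element [y]
   corresponds to the door left by removing [y]. *)
have count : \sum_(Z | door Z) #|rooms Z| = \sum_(Z | room Z) #|facets Z|.
  under eq_bigr do rewrite -sum1_card; rewrite pair_big_dep.
  under [RHS]eq_bigr do rewrite -sum1_card; rewrite pair_big_dep.
  rewrite (reindex_onto (fun p : {set W} * W => (p.1 :\ p.2, p.2))
    (fun p => (p.2 |: p.1, p.2))) => [|[Z z]/=]; last first.
    by rewrite inE => /andP[_ /andP[zZ _]]; rewrite setU1K.
  apply: eq_bigl => -[Z y] /=; rewrite /rooms /facets !inE eqxx /door /room /=.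
  have [yZ|yZ] := boolP (y \in Z); last first.
    rewrite /= andbF; apply/negbTE/negP => /andP[_ /eqP[/setP/(_ y)]].
    by rewrite !inE (negbTE yZ) eqxx.
  rewrite setD1K// eqxx andbT (cardsD1 y Z) yZ add1n.
  apply/idP/idP; first by case/andP => /and3P[_ -> ->] ->.
  case/andP => /andP[dyZ ->] ->; rewrite dyZ (subset_dominant _ dyZ)//.
  exact: subD1set.
have out_door : door (e @: [set~ i0]).
  apply/and3P; split.
  - apply/dominantP => y; have [/codomP[j ->]|ye] := boolP (y \in codom e).
      exists j => z _.
      by have [->//|/e_min/ltnW] := eqVneq z (e j).
    exists i0 => _ /imsetP[j + ->]; rewrite !inE => ji0.
    by apply/ltnW/e_max.
  - by rewrite card_imset// cardsC1; apply/eqP; lia.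
  - rewrite -imset_comp; apply/eqP/setP => i.
    apply/imsetP/idP => [[j j0 ->]|ii0]; first by rewrite /= c_e.
    by exists i => //=; rewrite c_e.
have out_uniq Z : door Z -> (Z \subset codom e) = (Z == e @: [set~ i0]).
  case/and3P => _ _ /eqP cZ; apply/idP/eqP => [/fintype.subsetP Ze|->]; last first.
    by apply/fintype.subsetP => _ /imsetP[j _ ->]; exact: codom_f.
  apply/setP => z; apply/idP/imsetP => [zZ|[j + ->]].
    have /codomP[j zj] := Ze _ zZ; exists j => //.
    by rewrite -cZ; apply/imsetP; exists z => //; rewrite zj c_e.
  rewrite -cZ => /imsetP[w wZ ->]; have /codomP[k wk] := Ze _ wZ.
  by move: wZ; rewrite wk c_e.
have : odd (\sum_(Z | room Z) #|facets Z|).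
  rewrite -count (big_morph odd oddD (erefl _)).
  rewrite (bigD1 (e @: [set~ i0]))//= big1 ?addbF.
    case/and3P: (out_door) => d1 /eqP d2 d3.
    by rewrite odd_rooms// out_uniq ?eqxx.
  move=> Z /andP[dZ Zne]; case/and3P: (dZ) => d1 /eqP d2 d3.
  by rewrite odd_rooms// out_uniq// (negbTE Zne).
have [/existsP[Z /andP[/andP[dZ /eqP cZ] /eqP cT]]|] :=
  boolP [exists Z, room Z && (c @: Z == setT)]; first by exists Z.
rewrite negb_exists => /forallP none.
rewrite (big_morph odd oddD (erefl _)) big1// => Z /[dup] rZ /andP[_ /eqP cZ].
by rewrite odd_color_facets//; have := none Z; rewrite rZ => /negbTE.
Qed.

End Scarf.

Section Grid.
Variables (N k : nat).
Hypothesis N_gt1 : 1 < N.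

Definition grid := {x : {ffun 'I_N -> 'I_k.+1} | \sum_i x i == k}.

Definition gcoord (x : grid) (i : 'I_N) : nat := val x i.

Lemma sum_gcoord x : \sum_i gcoord x i = k.
Proof. exact/eqP/(valP x). Qed.

Lemma grid_of (y : 'I_N -> nat) : \sum_i y i = k ->
  exists x, forall i, gcoord x i = y i.
Proof.
move=> sy; have yk i : y i < k.+1.
  by rewrite ltnS -sy (bigD1 i)//= leq_addr.
have sx : \sum_i [ffun i => Ordinal (yk i)] i == k.
  by apply/eqP; rewrite -[RHS]sy; apply: eq_bigr => i _; rewrite ffunE.
exists (exist (fun x : {ffun 'I_N -> 'I_k.+1} => \sum_i x i == k) _ sx) => i.
by rewrite /gcoord /= ffunE.
Qed.

Let M := #|{: grid}|.

Let rk (x : grid) : nat := enum_rank x.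

Let rk_lt x : rk x < M.
Proof. exact: ltn_ord. Qed.

Let rk_inj : injective rk.
Proof. by move=> x y /val_inj/enum_rank_inj. Qed.

(* A grid point is ranked by its [i]-th coordinate, ties being broken by an
   arbitrary enumeration; the points [inr j] are the ideal ones. *)
Definition grid_rank (i : 'I_N) (w : grid + 'I_N) : nat :=
  match w with
  | inl x => (gcoord x i * M + rk x).+1
  | inr j => if j == i then 0 else (k.+1 * M + j).+1
  end.

Lemma grid_rank_lt (i : 'I_N) (x : grid) : gcoord x i * M + rk x < k.+1 * M.
Proof.
have rx := rk_lt x.
have : gcoord x i <= k by rewrite -(sum_gcoord x) (bigD1 i)//= leq_addr.
by move=> gk; rewrite mulSn; have := leq_mul gk (leqnn M); lia.
Qed.

Lemma grid_rank_inj i : injective (grid_rank i).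
Proof.
move=> [x|j] [y|h] /=.
- move=> [E]; congr inl; apply: rk_inj.
  have : (gcoord x i * M + rk x) %% M = (gcoord y i * M + rk y) %% M.
    by rewrite E.
  by rewrite !modnMDl !modn_small ?rk_lt.
- by case: ifP => // _ [E]; have := grid_rank_lt i x; rewrite E ltnNge leq_addr.
- by case: ifP => // _ [E]; have := grid_rank_lt i y; rewrite -E ltnNge leq_addr.
- case: eqP => [->|_]; case: eqP => [->|_] // [] /addnI E.
  by congr inr; apply/val_inj.
Qed.

(** The set given by Scarf's lemma consists of grid points and of the ideal points with index
    outside [C]. Dominance prevents a grid point from exceeding all the minima over [C], so these
    minima sum to more than [k - #|C|]. As coordinates sum to [k], all of them are within [N] of the
    minima on [C], and at most [N] outside. *)
Lemma grid_sperner (c : grid -> 'I_N) : exists (C : {set 'I_N}) (p : 'I_N -> grid),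
  [/\ C != set0, forall i, i \in C -> c (p i) = i,
      forall i j h, i \in C -> j \in C -> gcoord (p i) h <= gcoord (p j) h + N &
      forall i h, i \in C -> h \notin C -> gcoord (p i) h <= N].
Proof.
pose col (w : grid + 'I_N) := match w with inl x => c x | inr i => i end.
have [||||Z [/dominantP dZ cZ colZ]] := @scarf _ _ grid_rank inr col grid_rank_inj.
- by move=> i [x|j] /=; rewrite eqxx//; case: ifP => // /eqP ->; rewrite eqxx.
- move=> i j [x|h] ji; last by rewrite codom_f.
  by move=> _ /=; rewrite (negbTE ji) ltnS (leq_trans (grid_rank_lt i x))// leq_addr.
- by [].
- by rewrite card_ord.
pose C := [set i | inr i \notin Z].
(* An ideal [inr i] in [Z] is least in the order [i], so a grid point can be below [Z] only in an
   order of [C]. *)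
have pos i : (exists x, forall z, z \in Z -> grid_rank i (inl x) <= grid_rank i z) -> i \in C.
  by move=> [x H]; rewrite inE; apply/negP => /H /=; rewrite eqxx.
have [i0 i0C] : exists i0, i0 \in C.
  pose i1 := Ordinal (ltnW N_gt1).
  have [|x _] := @grid_of (fun i => if i == i1 then k else 0).
    by rewrite -big_mkcond big_pred1_eq.
  by have [i iP] := dZ (inl x); exists i; apply: pos; exists x.
have colC i : i \in C -> exists2 x, inl x \in Z & c x = i.
  rewrite inE => iC; have /imsetP[[x|j] zZ iz] : i \in col @: Z by rewrite colZ inE.
    by exists x.
  by move: iC zZ => /=; rewrite iz /= => /negbTE ->.
have [x0 x0Z _] := colC i0 i0C.
pose mn i := [arg min_(x < x0 | inl x \in Z) gcoord x i].
have mnZ i : inl (mn i) \in Z by rewrite /mn; case: arg_minnP.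
have mn_le i x : inl x \in Z -> gcoord (mn i) i <= gcoord x i.
  by rewrite /mn; case: arg_minnP => // ? _; apply.
have mnk : k < \sum_(i in C) (gcoord (mn i) i).+1.
  rewrite ltnNge; apply/negP => Hk.
  (* One more than the minimum on [C], zero elsewhere, the rest of the sum [k] being stored at [i0]:
     the grid point that would violate dominance. *)
  pose y i := if i \in C then (gcoord (mn i) i).+1 +
    (if i == i0 then k - \sum_(i in C) (gcoord (mn i) i).+1 else 0) else 0.
  have [|x xy] := @grid_of y.
    rewrite /y -big_mkcond big_split /= [X in _ + X](bigD1 i0)//= eqxx.
    rewrite [X in _ + (_ + X)]big1 ?addn0 ?subnKC// => i /andP[_ /negbTE ->].
    by [].
  have [i iP] := dZ (inl x).
  have iC : i \in C by apply: pos; exists x.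
  have := iP _ (mnZ i); rewrite /= xy /y iC.
  have := rk_lt (mn i); rewrite mulnDl mulSn.
  by move: (_ * M) (_ * M) => a b; lia.
have CN : #|C| <= N by rewrite -[X in _ <= X]card_ord max_card.
have mnS : k < \sum_(i in C) gcoord (mn i) i + #|C|.
  by apply: leq_trans mnk _; rewrite -sum1_card -big_split /=; apply: leq_sum => i _; lia.
have sumC x : \sum_(i in C) gcoord x i + \sum_(i | i \notin C) gcoord x i = k.
  by rewrite -(sum_gcoord x) [RHS](bigID [in C]).
have leC x : inl x \in Z -> \sum_(i in C) gcoord (mn i) i <= \sum_(i in C) gcoord x i.
  by move=> xZ; apply: leq_sum => i _; exact: mn_le.
have out x h : inl x \in Z -> h \notin C -> gcoord x h <= N.
  move=> xZ hC; move: mnS CN (leC x xZ) (sumC x).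
  rewrite [X in _ -> _ -> _ -> _ + X = _ -> _](bigD1 h)//=.
  by do 3!move: (\sum_(_ | _) _) => ?; move: #|C| (gcoord x h) => ? ?; lia.
have inn x h : inl x \in Z -> h \in C -> gcoord x h <= gcoord (mn h) h + N.
  move=> xZ hC; have : \sum_(i in C | i != h) gcoord (mn i) i <= \sum_(i in C | i != h) gcoord x i.
    by apply: leq_sum => i _; exact: mn_le.
  move: mnS CN (sumC x); rewrite (bigD1 h hC)/= [X in _ -> _ -> X + _ = _ -> _](bigD1 h hC)/=.
  do 3!move: (\sum_(_ | _) _) => ?.
  by move: #|C| (gcoord x h) (gcoord (mn h) h) => ? ? ?; lia.
have pP i : exists x, i \in C -> inl x \in Z /\ c x = i.
  have [/colC[x xZ cx]|_] := boolP (i \in C); first by exists x.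
  by exists x0.
have [p pE] : exists p, forall i, i \in C -> inl (p i) \in Z /\ c (p i) = i.
  by have [p pE] := boolp.choice pP; exists p.
exists C, p; split.
- by apply/set0Pn; exists i0.
- by move=> i /pE[].
- move=> i j h /pE[iZ _] /pE[jZ _]; have [hC|hC] := boolP (h \in C).
    by apply: leq_trans (inn _ _ iZ hC) _; rewrite leq_add2r mn_le.
  by apply: leq_trans (out _ _ iZ hC) _; rewrite leq_addl.
- by move=> i h /pE[iZ _]; exact: out.
Qed.

End Grid.

From mathcomp Require Import all_classical all_reals all_analysis.

Import Order.TTheory GRing.Theory Num.Theory.
Import numFieldNormedType.Exports.

Local Open Scope classical_set_scope.
Local Open Scope ring_scope.

(** * Brouwer's theorem on the simplex *)

Section Brouwer.
Context {R : realType}.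

Definition simplex N : set 'rV[R]_N :=
  [set x | (forall i, 0 <= x ord0 i) /\ \sum_i x ord0 i = 1].

Arguments simplex : clear implicits.

Lemma rV_coord_le N (x : 'rV[R]_N) i : `|x ord0 i| <= `|x|.
Proof.
rewrite [leRHS]/Num.Def.normr/= mx_normrE; apply/bigmax_geP; right => /=.
by exists (ord0, i).
Qed.

Lemma rV_norm_le N (x : 'rV[R]_N) e : 0 <= e ->
  (forall i, `|x ord0 i| <= e) -> `|x| <= e.
Proof.
move=> e0 xe; rewrite [leLHS]/Num.Def.normr/= mx_normrE; apply/bigmax_leP.
by split=> // -[i j] _ /=; rewrite (ord1 i).
Qed.

Lemma compact_simplex N : compact (simplex N).
Proof.
apply: bounded_closed_compact.
  exists 1; split=> // M M1 x [x0 x1]; apply: le_trans (ltW M1).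
  apply: rV_norm_le => // i.
  by rewrite ger0_norm// -x1 (bigD1 i)//= lerDl sumr_ge0.
have -> : simplex N = (\bigcap_(i in [set: 'I_N]) [set x | 0 <= x ord0 i]) `&`
    [set x | \sum_i x ord0 i = 1].
  by apply/seteqP; split => x [H1 H2]; split=> // i; [move=> _; exact: H1|exact: H1].
apply: closedI.
  apply: closed_bigI => i _.
  apply: (@preimage_closed _ _ (fun x : 'rV[R]_N => x ord0 i) [set z | 0 <= z]).
    by move=> x _; exact: coord_continuous.
  exact: closed_ge.
apply: (@preimage_closed _ _ (fun x : 'rV[R]_N => \sum_i x ord0 i) [set 1]).
  move=> x _; move: x.
  apply: continuous_big => [|i _]; [exact: add_continuous|exact: coord_continuous].
exact: closed_eq.
Qed.

(* Near a point which is not fixed, some coordinate is decreased by [f]; by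
   compactness of the simplex this contradicts Scarf's lemma on fine grids,
   a grid point being coloured by a coordinate which [f] does not decrease. *)
Theorem brouwer_simplex N (f : 'rV[R]_N -> 'rV[R]_N) : (1 < N)%N ->
  {within simplex N, continuous f} -> (forall x, simplex N x -> simplex N (f x)) ->
  exists2 x, simplex N x & f x = x.
Proof.
move=> N1 fc fS; apply: contrapT => nofix.
(* The coordinates of [x] and of [f x] have the same sum, so if none decreases they are all
   equal. *)
have dec x : simplex N x -> exists h, f x ord0 h < x ord0 h.
  move=> Sx; apply: contrapT => /forallNP nlt; apply: nofix; exists x => //.
  have le h : x ord0 h <= f x ord0 h by rewrite leNgt; apply/negP/nlt.
  apply/rowP => h; apply/eqP; rewrite -subr_eq0; apply/eqP.
  have : \sum_i (f x ord0 i - x ord0 i) = 0.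
    by rewrite sumrB (fS _ Sx).2 Sx.2 subrr.
  by move/psumr_eq0P => -> // i _; rewrite subr_ge0.
(* The distance [N / (k + 1)] is the one provided by [grid_sperner] on the grid of order [k + 1];
   the lower bound on the coordinate [h] will exclude [h \notin C]. *)
pose P (k : nat) (x : 'rV[R]_N) := exists h, N%:R / k.+1%:R < x ord0 h /\
  forall p, simplex N p -> (forall g, `|p ord0 g - x ord0 g| <= N%:R / k.+1%:R) ->
  f p ord0 h < p ord0 h.
have : \forall k \near \oo, simplex N `<=` P k.
  move: (@compact_simplex N) => /compact_near_coveringP/near_covering_withinP.
  apply=> x Sx.
  have [h fxh] := dec _ Sx.
  have xh0 : 0 < x ord0 h by apply: le_lt_trans fxh; apply: (fS _ Sx).1.
  have : (fun y : 'rV[R]_N => y ord0 h - f y ord0 h) @ within (simplex N) (nbhs x)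
      --> x ord0 h - f x ord0 h.
    apply: cvgB; first by apply: cvg_within_filter; exact: coord_continuous.
    apply: (@cvg_comp _ _ _ f (fun z : 'rV[R]_N => z ord0 h) _ (nbhs (f x))).
      exact: ((subspace_continuousP _ _).1 fc).
    exact: coord_continuous.
  move=> /cvgr_gt/(_ 0); rewrite subr_gt0 => /(_ fxh).
  rewrite near_withinE => /nbhs_ballP[r /= r0 xr].
  exists (ball x (Num.min (r / 2) (x ord0 h / 2)),
      [set k | N%:R / k.+1%:R < Num.min (r / 2) (x ord0 h / 2)]).
    split => /=.
      by apply: nbhsx_ballx; rewrite lt_min !divr_gt0.
    have e0 : 0 < Num.min (r / 2) (x ord0 h / 2) by rewrite lt_min !divr_gt0.
    have N0 : 0 < N%:R :> R by rewrite ltr0n (ltn_trans _ N1).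
    have := near_infty_natSinv_lt (PosNum (divr_gt0 e0 N0)).
    apply: filterS => k /=; rewrite ltr_pdivlMr// mulrC.
    by [].
  move=> [x' k] /= [xx' kS] Sx'.
  move: xx' kS; rewrite -ball_normE /= !lt_min => /andP[x1 x2] /andP[k1 k2].
  have := le_lt_trans (rV_coord_le (x - x') h) x2; rewrite !mxE ltr_norml => /andP[_ x3].
  exists h; split.
    by move: x3 k2; move: (x ord0 h) (x' ord0 h) (N%:R / _) => a b c; lra.
  move=> p Sp px; have := xr p; rewrite -ball_normE /= => /(_ _ Sp).
  rewrite subr_gt0; apply.
  rewrite -(subrKA x') (le_lt_trans (ler_normD _ _))//.
  suff : `|x' - p| <= N%:R / k.+1%:R by move: x1 k1; move: `|x - x'| `|x' - p| (N%:R / _) => a b c; lra.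
  by apply: rV_norm_le => // i; rewrite !mxE distrC.
move=> [k _ /(_ k (leqnn k)) Pk].
pose toR (x : grid N k.+1) : 'rV[R]_N := \row_i ((gcoord x i)%:R / k.+1%:R).
have toRS x : simplex N (toR x).
  split=> [i|]; first by rewrite mxE divr_ge0.
  under eq_bigr do rewrite mxE.
  by rewrite -mulr_suml -natr_sum sum_gcoord divff.
have colP x : exists i, toR x ord0 i <= f (toR x) ord0 i.
  apply: contrapT => /forallNP H.
  have : \sum_i (toR x ord0 i - f (toR x) ord0 i) = 0.
    by rewrite sumrB (fS _ (toRS x)).2 (toRS x).2 subrr.
  have [i _] := grid_sperner N1 (fun _ : grid N k.+1 => Ordinal N1).
  have gt0 j : 0 < toR x ord0 j - f (toR x) ord0 j.
    by rewrite subr_gt0 ltNge; apply/negP/H.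
  move=> /psumr_eq0P E; have := gt0 (Ordinal N1).
  by rewrite E ?ltxx// => j _; exact/ltW.
have [c cP] := choice colP.
have [C [p [/set0Pn[i iC] pc pp pN]]] := grid_sperner N1 c.
(* Near [p i] the coordinate [h] decreases. If [h] is outside [C], this coordinate is too small;
   otherwise [p h], of colour [h] and close to [p i], is a point at which it does not decrease. *)
have [h [hx hp]] := Pk _ (toRS (p i)).
have [hC|hC] := boolP (h \in C); last first.
  move: hx; rewrite mxE ltr_pM2r ?invr_gt0// ltr_nat ltnNge.
  by rewrite pN.
have := cP (p h); rewrite pc// => cph.
suff H g : `|toR (p h) ord0 g - toR (p i) ord0 g| <= N%:R / k.+1%:R.
  by have := hp _ (toRS (p h)) H; rewrite ltNge cph.
rewrite !mxE -mulrBl normrM [`|_^-1|]ger0_norm ?invr_ge0//.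
rewrite ler_pM2r ?invr_gt0// ler_norml lerBlDr lerBrDr.
by rewrite [_ + _%:R in X in _ && X]addrC [- _ + _]addrC lerBlDr -!natrD !ler_nat !pp.
Qed.

End Brouwer.

(** * One-sided calculus and differential equations *)

Section RealLine.
Context {R : realType}.

Lemma nbhs_dist (t : R) (P : set R) :
  (\forall s \near t, P s) <-> exists2 e, 0 < e & forall s, `|s - t| < e -> P s.
Proof.
split=> [/nbhs_ballP[e /= e0 eP]|[e e0 eP]].
  by exists e => // s st; apply: eP; rewrite -ball_normE /= distrC.
by apply/nbhs_ballP; exists e => //= s; rewrite -ball_normE /= distrC => /eP.
Qed.

Lemma at_right_dist (t : R) (P : set R) :
  (\forall s \near t^'+, P s) <->
  exists2 e, 0 < e & forall s, t < s < t + e -> P s.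
Proof.
rewrite /at_right near_withinE; split=> [/nbhs_dist[e e0 eP]|[e e0 eP]].
  exists e => // s.
  by move=> /andP[ts se]; apply: eP => //; rewrite gtr0_norm ?subr_gt0// ltrBlDl.
apply: (nbhs_dist t (fun s => t < s -> P s)).2; exists e => // s.
by move=> st ts; apply: eP; rewrite ts/=; move: st; rewrite ltr_norml => /andP[_]; lra.
Qed.

Lemma at_left_dist (t : R) (P : set R) :
  (\forall s \near t^'-, P s) <->
  exists2 e, 0 < e & forall s, t - e < s < t -> P s.
Proof.
rewrite /at_left near_withinE; split=> [/nbhs_dist[e e0 eP]|[e e0 eP]].
  exists e => // s.
  by move=> /andP[se st]; apply: eP => //; rewrite ltr_norml; apply/andP; split; lra.
apply: (nbhs_dist t (fun s => s < t -> P s)).2; exists e => // s.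
by move=> st ts; apply: eP; rewrite ts andbT; move: st; rewrite ltr_norml => /andP[+ _]; lra.
Qed.

(** Projection of the line onto [[a, b]]. Composing with it turns functions continuous on [[a, b]]
    into functions continuous on the line, so that later statements can assume global continuity. *)
Definition clamp (a b t : R) : R := Num.max a (Num.min b t).

Lemma clamp_continuous a b : continuous (clamp a b).
Proof.
move=> t; apply: (@continuous_max _ _ (cst a) (fun t => Num.min b t)).
  exact: cvg_cst.
by apply: (@continuous_min _ _ (cst b) id); [exact: cvg_cst|exact: cvg_id].
Qed.

Lemma clamp_itv a b t : a <= b -> clamp a b t \in `[a, b].
Proof.
move=> ab; rewrite in_itv /= /clamp le_max lexx /= ge_max ab /=.
by rewrite ge_min lexx.
Qed.

Lemma clamp_id a b t : t \in `[a, b] -> clamp a b t = t.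
Proof.
by rewrite in_itv /= => /andP[ta tb]; rewrite /clamp min_r// max_r.
Qed.

Lemma clamp_continuous_within (Y : topologicalType) a b (f : R -> Y) : a <= b ->
  {within `[a, b], continuous f} -> continuous (f \o clamp a b).
Proof.
move=> ab /subspace_continuousP fc t.
have tab : `[a, b]%classic (clamp a b t) by exact: clamp_itv.
apply: (@cvg_comp _ _ _ (clamp a b) f _ (within `[a, b] (nbhs (clamp a b t)))).
  move=> P; rewrite /within /= => nP.
  move: (@clamp_continuous a b t _ nP); apply: (@filterS _ (nbhs t)) => s /=.
  by apply; exact: clamp_itv.
exact: fc.
Qed.

(** For any slope [eta > 0], the times at which [w] lies below the line of slope [eta] through
    [(a, w a)] form a compact set. Its largest element is [b], since the growth condition would
    allow going further to the right. *)
Lemma dini_base (w : R -> R) a b : a <= b -> continuous w ->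
  (forall t, a <= t < b -> forall eta, 0 < eta ->
    \forall s \near t^'+, w s - w t <= eta * (s - t)) ->
  w b <= w a.
Proof.
move=> ab wc H; apply/ler_addgt0Pr => e e0.
pose eta := e / (b - a + 1).
have eta0 : 0 < eta by rewrite divr_gt0//; lra.
have etaE : eta * (b - a) <= e.
  by rewrite /eta mulrAC ler_pdivrMr ?ler_pM2l//; lra.
pose psi t := w t - w a - eta * (t - a).
have psic : continuous psi.
  move=> t; apply: cvgB; last first.
    by apply: cvgM (cvg_cst _) (cvgB cvg_id (cvg_cst _)).
  by apply: cvgB; [exact: wc|exact: cvg_cst].
pose S := `[a, b]%classic `&` (psi @^-1` [set z | z <= 0]).
have Sc : compact S.
  apply: (@subclosed_compact _ _ `[a, b]%classic); last 2 first.
  - exact: segment_compact.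
  - by move=> x [].
  - apply: closedI; first exact: itv_closed.
    by apply: preimage_closed; [move=> x _; exact: psic|exact: closed_le].
have Sa : S a by split => /=; rewrite ?in_itv/= ?lexx// /psi !subrr mulr0 subrr.
have idc : {within S, continuous (@idfun R)}.
  by apply: continuous_subspaceT => x; exact: cvg_id.
have [c + cmax] : exists2 c : R, c \in S & forall t : R, t \in S -> t <= c.
  exact: (compact_EVT_max (ex_intro _ a Sa) Sc idc).
rewrite inE => -[/= cab]; rewrite /psi => psi0; move: cab; rewrite in_itv /= => /andP[ac cb].
move: cb; rewrite le_eqVlt => /predU1P[cb|cb]; first by move: psi0; rewrite cb; lra.
have /at_right_dist[d d0 dP] := H c (introT andP (conj ac cb)) _ eta0.
pose s := Num.min b (c + d / 2).
have cs : c < s by rewrite lt_min cb /=; lra.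
have sd : s < c + d by rewrite gt_min; apply/orP; right; lra.
have sb : s <= b by rewrite ge_min lexx.
have := dP s (introT andP (conj cs sd)) => ws.
have : s <= c.
  apply: cmax; rewrite inE; split => /=; first by rewrite in_itv/= sb; lra.
  by rewrite /psi; lra.
by rewrite leNgt cs.
Qed.

(* The exceptional set [Fs] is eliminated by splitting [a, b] at its points. *)
Lemma dini (w : R -> R) (Fs : seq R) a b : a <= b -> continuous w ->
  (forall t, a < t < b -> t \notin Fs -> forall eta, 0 < eta ->
    \forall s \near t^'+, w s - w t <= eta * (s - t)) ->
  w b <= w a.
Proof.
move=> ab wc; elim: Fs a b ab => [|c Fs IH] a b ab H.
  move: ab; rewrite le_eqVlt => /predU1P[->//|ab].
  (* Nothing is assumed at [a] itself, so the base case is applied from [a'] and continuity of [w]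
     allows [a'] to tend to [a]. *)
  have H1 : \forall a' \near a^'+, w b <= w a'.
    apply/at_right_dist; exists (b - a) => [|a' /andP[a1 a2]]; first by lra.
    apply: dini_base => // [|t /andP[t1 t2]]; first by lra.
    by apply: H => //; apply/andP; split; lra.
  have : w a' @[a' --> a^'+] --> w a by apply: cvg_at_right_filter; exact: wc.
  by move=> wa; apply: (cvgr_to_ge wa).
have [/andP[ac cb]|nacb] := boolP (a < c < b); last first.
  apply: IH => // t tab tF; apply: H => //.
  by rewrite inE negb_or tF andbT; apply: contraNneq nacb => <-.
apply: (@le_trans _ _ (w c)); apply: IH; rewrite ?ltW// => t /andP[t1 t2] tF;
  apply: H; rewrite ?inE ?negb_or ?tF ?andbT; (try apply/andP; try split); try lra;
  by rewrite ?lt_eqF// ?gt_eqF.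
Qed.

End RealLine.

(** * Gronwall's inequality with right increments *)

Section Gronwall.
Context {R : realType} {Z : normedModType R}.
Implicit Types r : R -> Z.

Lemma is_derive_epsP r (t : R) (d : Z) : is_derive t 1 r d <->
  forall eta, 0 < eta ->
    \forall s \near t, `|r s - r t - (s - t) *: d| <= eta * `|s - t|.
Proof.
split=> [[dr dE] eta eta0|H].
  have : h^-1 *: ((r \o shift t) (h *: 1) - r t) @[h --> 0^'] --> d.
    by rewrite -dE; exact: dr.
  move=> /cvgrPdist_le/(_ _ eta0); rewrite /dnbhs near_withinE.
  move=> /nbhs_dist[e e0 eP]; apply/nbhs_dist; exists e => // s st.
  have [->|nst] := eqVneq s t; first by rewrite !subrr scale0r subr0 !normr0 mulr0.
  have st0 : s - t != 0 by rewrite subr_eq0.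
  have := eP (s - t); rewrite subr0 => /(_ st st0).
  rewrite /= [_ *: 1]mulr1 subrK => le.
  rewrite -[r s - r t]scale1r -(divff st0) -scalerA -scalerBr normrZ mulrC.
  by rewrite ler_wpM2r// distrC.
suff cv : h^-1 *: ((r \o shift t) (h *: 1) - r t) @[h --> 0^'] --> d.
  apply: DeriveDef; first by apply/cvg_ex; exists d.
  exact/cvg_lim.
apply/cvgrPdist_le => eta eta0; rewrite /dnbhs near_withinE.
have /nbhs_dist[e e0 eP] := H _ eta0.
apply: (nbhs_dist 0 (fun h => h != 0 -> `|d - h^-1 *: ((r \o shift t) (h *: 1) - r t)| <= eta)).2.
exists e => // h; rewrite subr0 => he h0.
have := eP (h + t); rewrite addrK => /(_ he).
rewrite /= [_ *: 1]mulr1 => le.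
rewrite distrC -[X in _ - X]scale1r -(mulVf h0) -scalerA -scalerBr normrZ normfV.
by rewrite mulrC ler_pdivrMr ?normr_gt0.
Qed.

Lemma is_derive_right_growth r (t : R) (d : Z) K : is_derive t 1 r d -> `|d| <= K ->
  forall eta, 0 < eta ->
    \forall s \near t^'+, `|r s - r t| <= (K + eta) * (s - t).
Proof.
move=> /is_derive_epsP rd dK eta eta0; have /nbhs_dist[e e0 eP] := rd _ eta0.
apply/at_right_dist; exists e => // s /andP[ts se].
have st : `|s - t| = s - t by rewrite gtr0_norm// subr_gt0.
have := eP s; rewrite st => /(_ _).
have -> : s - t < e by lra.
move=> /(_ isT) le; rewrite -[r s - r t](subrK ((s - t) *: d)).
rewrite (le_trans (ler_normD _ _))// addrC mulrDl lerD// normrZ st mulrC.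
by rewrite ler_wpM2r// subr_ge0 ltW.
Qed.

(** The function [expR (- (L * (t - a))) * |r t| - G t] is nonincreasing by [dini]. Measuring the
    forcing by increments of [G] lets it be large on a set of times that [G] knows to be short. *)
Lemma gronwall r (G : R -> R) (Fs : seq R) a b L : a <= b -> 0 <= L ->
  continuous r -> continuous G -> {homo G : x y / x <= y} ->
  (forall t, a < t < b -> t \notin Fs -> exists g,
    (forall eta, 0 < eta ->
      \forall s \near t^'+, `|r s - r t| <= (L * `|r t| + g + eta) * (s - t)) /\
    \forall s \near t^'+, g * (s - t) <= G s - G t) ->
  `|r b| <= expR (L * (b - a)) * (`|r a| + (G b - G a)).
Proof.
move=> ab L0 rc Gc Gm H.
pose w t := expR (- (L * (t - a))) * `|r t| - G t.
have wc : continuous w.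
  move=> t; apply: cvgB; last exact: Gc.
  apply: cvgM.
    apply: (@cvg_comp _ _ _ (fun t => - (L * (t - a))) expR _
      (nbhs (- (L * (t - a))))); last exact: continuous_expR.
    by apply: cvgN (cvgM (cvg_cst _) (cvgB cvg_id (cvg_cst _))).
  by apply: cvg_norm; exact: rc.
have : w b <= w a.
  apply: (@dini _ _ Fs) => // t tab tF eta eta0.
  have [g [/(_ _ eta0) /at_right_dist[d1 d10 d1P] /at_right_dist[d2 d20 d2P]]] := H t tab tF.
  apply/at_right_dist; exists (Num.min d1 d2); first by rewrite lt_min d10.
  move=> s /andP[ts]; rewrite -ltrBlDl lt_min => /andP[sd1 sd2].
  have {}d1P : `|r s - r t| <= (L * `|r t| + g + eta) * (s - t) by apply: d1P; lra.
  have {}d2P : g * (s - t) <= G s - G t by apply: d2P; lra.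
  have rs : `|r s| <= (1 + L * (s - t)) * `|r t| + (g + eta) * (s - t).
    rewrite -[r s](subrK (r t)) (le_trans (ler_normD _ _))//.
    move: d1P; set A := `|r s - r t|; set B := `|r t| => d1P; lra.
  set e1 := expR (- (L * (s - a))).
  have e10 : 0 <= e1 by exact: expR_ge0.
  have e11 : e1 <= 1.
    by rewrite expR_le1 oppr_le0 mulr_ge0//; move/andP: tab => []; lra.
  (* The exponential weight absorbs the linear growth because [1 + x <= expR x]. *)
  have e1t : e1 * (1 + L * (s - t)) <= expR (- (L * (t - a))).
    have -> : - (L * (t - a)) = - (L * (s - a)) + L * (s - t) by lra.
    by rewrite expRD ler_wpM2l// expR_ge1Dx.
  have h1 : e1 * `|r s| <= expR (- (L * (t - a))) * `|r t| + e1 * ((g + eta) * (s - t)).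
    apply: le_trans (ler_wpM2l e10 rs) _; rewrite mulrDr lerD2r mulrA.
    by rewrite ler_wpM2r.
  have h2 : e1 * ((g + eta) * (s - t)) <= G s - G t + eta * (s - t).
    have Gst : 0 <= G s - G t by rewrite subr_ge0 Gm// ltW.
    have est : 0 <= eta * (s - t) by rewrite mulr_ge0 ?ltW// subr_gt0.
    apply: le_trans (_ : e1 * (G s - G t + eta * (s - t)) <= _).
      by rewrite ler_wpM2l// mulrDl lerD2r.
    by rewrite ler_piMl// addr_ge0.
  move: h1 h2; rewrite /w -/e1; move: (e1 * _) (e1 * _) (expR _ * _) => A B C; lra.
rewrite /w subrr mulr0 oppr0 expR0 mul1r => wba.
rewrite -ler_pdivrMl ?expR_gt0// -expRN; lra.
Qed.

End Gronwall.

Section Cousin.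
Context {R : realType}.

(* Real induction: the supremum of the points reachable from [a] is reached,
   and cannot be less than [b]. *)
Lemma cousin (P : R -> R -> Prop) a b : a <= b -> (forall x, P x x) ->
  (forall x y z, x <= y -> y <= z -> P x y -> P y z -> P x z) ->
  (forall t, a <= t < b -> \forall s \near t^'+, P t s) ->
  (forall t, a < t <= b -> \forall s \near t^'-, P s t) -> P a b.
Proof.
move=> ab P0 PT Pr Pl.
pose S := [set c | a <= c <= b /\ P a c].
have Sa : S a by split; rewrite ?lexx.
have supS : has_sup S by split; [exists a|exists b => c [/andP[_ ]]].
set c := sup S.
have ac : a <= c by apply: ub_le_sup => //; exact: supS.2.
have cb : c <= b by apply: ge_sup; [exists a|move=> d [/andP[]]].
have Pac : P a c.
  move: (ac); rewrite le_eqVlt => /predU1P[<-//|ltac].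
  have /at_left_dist[e e0 eP] := Pl c (introT andP (conj ltac cb)).
  have [d [/andP[ad db] Pad] cd] := sup_adherent e0 supS.
  have dc : d <= c by apply: ub_le_sup => //; [exact: supS.2|split; rewrite ?ad].
  apply: (PT a d c) => //; move: dc; rewrite le_eqVlt => /predU1P[->//|dc].
  by apply: eP; rewrite cd.
move: (cb); rewrite le_eqVlt => /predU1P[<-//|ltcb].
have /at_right_dist[e e0 eP] := Pr c (introT andP (conj ac ltcb)).
pose d := Num.min b (c + e / 2).
have cd : c < d by rewrite lt_min ltcb /=; lra.
have de : d < c + e by rewrite gt_min; apply/orP; right; lra.
have : d <= c.
  apply: ub_le_sup; first exact: supS.2.
  split; first by rewrite ge_min lexx andbT; lra.
  by apply: (PT a c d) => //; [exact: ltW|apply: eP; rewrite cd].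
by rewrite leNgt cd.
Qed.

End Cousin.

Section PiecewiseContinuity.
Context {R : realType}.

(** A form of piecewise continuity with an unordered list of exceptional times, which can be
    enlarged, concatenated and restricted freely, unlike the ordered subdivisions of
    [piecewise_continuous_along]. *)
Definition pcont (Y : topologicalType) (A : set Y) (Fs : seq R) a b (v : R -> Y) :=
  [/\ forall t, a < t < b -> t \notin Fs -> {for t, continuous v},
      forall t, a <= t < b -> exists2 y, A y & v s @[s --> t^'+] --> y &
      forall t, a < t <= b -> exists2 y, A y & v s @[s --> t^'-] --> y].

End PiecewiseContinuity.

Section MeanValue.
Context {R : realType} {Z : normedModType R}.
Implicit Types r : R -> Z.

Lemma mean_value r (Fs : seq R) a b K : a <= b -> 0 <= K -> continuous r ->
  (forall t, a < t < b -> t \notin Fs -> exists2 d, is_derive t 1 r d & `|d| <= K) ->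
  `|r b - r a| <= K * (b - a).
Proof.
move=> ab K0 rc H.
pose r0 t := r t - r a; pose G t := K * t.
have := @gronwall _ _ r0 G Fs a b 0 ab (lexx _).
rewrite mul0r expR0 mul1r /r0 subrr normr0 add0r /G -mulrBr; apply.
- by move=> t; apply: cvgB (rc t) (cvg_cst _).
- by move=> t; apply: cvgM (cvg_cst _) cvg_id.
- by move=> x y xy; rewrite ler_wpM2l.
move=> t tab tF; have [d dd dK] := H t tab tF; exists K.
rewrite mul0r add0r; split; last by near=> s; rewrite mulrBr.
move=> eta eta0; have := is_derive_right_growth dd dK eta0.
by apply: filterS => s; rewrite opprB addrA subrK.
Unshelve. all: by end_near. Qed.

Lemma is_derive_near_eq r1 r2 (t : R) (d : Z) : (\forall s \near t, r1 s = r2 s) ->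
  is_derive t 1 r1 d -> is_derive t 1 r2 d.
Proof. by move=> ?; apply: near_eq_is_derive => //; exact: oner_neq0. Qed.

Lemma is_derive_clamp r a b (t : R) (d : Z) : a < t < b -> is_derive t 1 r d ->
  is_derive t 1 (r \o clamp a b) d.
Proof.
move=> /andP[ta tb]; apply: is_derive_near_eq.
apply/nbhs_dist; exists (Num.min (t - a) (b - t)); first by rewrite lt_min !subr_gt0 ta.
move=> s; rewrite lt_min !ltr_norml => /andP[/andP[s1 _] /andP[_ s2]] /=.
by rewrite clamp_id// in_itv /=; apply/andP; split; lra.
Qed.

(** The functions need not agree at [c]: the constants [r2 c] on the left and [r1 c] on the right
    make the junction continuous without affecting derivatives. *)
Definition glue c r1 r2 t := r1 (Num.min t c) + r2 (Num.max t c).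

Lemma glue_continuous c r1 r2 : continuous r1 -> continuous r2 -> continuous (glue c r1 r2).
Proof.
move=> r1c r2c t; apply: cvgD.
  apply: (@cvg_comp _ _ _ (fun t => Num.min t c) r1 _ (nbhs (Num.min t c))); last exact: r1c.
  by apply: (@continuous_min _ _ id (cst c)); [exact: cvg_id|exact: cvg_cst].
apply: (@cvg_comp _ _ _ (fun t => Num.max t c) r2 _ (nbhs (Num.max t c))); last exact: r2c.
by apply: (@continuous_max _ _ id (cst c)); [exact: cvg_id|exact: cvg_cst].
Qed.

Lemma glue_derivel c r1 r2 (t : R) (d : Z) : t < c -> is_derive t 1 r1 d ->
  is_derive t 1 (glue c r1 r2) d.
Proof.
move=> tc dr; apply: (@is_derive_near_eq (r1 + cst (r2 c))).
  apply/nbhs_dist; exists (c - t); first by rewrite subr_gt0.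
  move=> s; rewrite ltr_norml => /andP[_ sc].
  by rewrite /glue min_l ?max_r//; lra.
by rewrite -[d]addr0; apply: is_deriveD; exact: is_derive_cst.
Qed.

Lemma glue_deriver c r1 r2 (t : R) (d : Z) : c < t -> is_derive t 1 r2 d ->
  is_derive t 1 (glue c r1 r2) d.
Proof.
move=> tc dr; apply: (@is_derive_near_eq (cst (r1 c) + r2)).
  apply/nbhs_dist; exists (t - c); first by rewrite subr_gt0.
  move=> s; rewrite ltr_norml => /andP[sc _].
  by rewrite /glue min_r ?max_l//; lra.
by rewrite -[d]add0r; apply: is_deriveD; exact: is_derive_cst.
Qed.

End MeanValue.

(** * Primitives of piecewise continuous functions with values in a Banach space *)

Section Primitive.
Context {R : realType} {Z : completeNormedModType R}.
Implicit Types r v : R -> Z.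

Lemma le_vanishing (e : R^nat) (x : R) : e @ \oo --> (0 : R) -> (forall n, x <= e n) -> x <= 0.
Proof. by move=> e0 xe; apply: (cvgr_to_ge e0); exact: nearW. Qed.

Lemma uniform_cauchy_lim (u : nat -> R -> Z) (e : R^nat) : e @ \oo --> (0 : R) ->
  (forall n, continuous (u n)) -> (forall n m t, (n <= m)%N -> `|u n t - u m t| <= e n) ->
  exists2 x, continuous x & forall n t, `|u n t - x t| <= e n.
Proof.
move=> e0 uc ue.
have ucv t : cvg (u ^~ t @ \oo).
  apply/cauchy_cvgP/cauchy_exP => eps eps0.
  have /cvgrPdist_lt/(_ _ eps0)[n _ nP] := e0.
  exists (u n t); exists n => // m /= nm.
  rewrite -ball_normE /= (le_lt_trans (ue _ _ _ nm))//.
  by have := nP n (leqnn n); rewrite sub0r normrN => /(le_lt_trans (ler_norm _)).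
pose x t := lim (u ^~ t @ \oo).
have ux n t : `|u n t - x t| <= e n.
  have : `|u n t - u m t| @[m --> \oo] --> `|u n t - x t|.
    by apply: cvg_norm; apply: cvgB (cvg_cst _) (ucv t).
  move=> /cvgr_to_le; apply; exists n => // m /= nm; exact: ue.
exists x => // t; apply/cvgrPdist_lt => eps eps0.
have eps3 : 0 < eps / 3 by lra.
have /cvgrPdist_lt/(_ _ eps3)[n _ nP] := e0.
have en : e n < eps / 3.
  by have := nP n (leqnn n); rewrite sub0r normrN => /(le_lt_trans (ler_norm _)).
have /cvgrPdist_lt/(_ _ eps3) := uc n t; apply: filterS => s us.
rewrite -(subrKA (u n t)) -[u n t - x s](subrKA (u n s)).
have := ux n t; have := ux n s; rewrite [`|_ - x t|]distrC.
have := ler_normD (x t - u n t) (u n t - u n s + (u n s - x s)).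
by have := ler_normD (u n t - u n s) (u n s - x s); lra.
Qed.

(** By [cousin]: on a short interval beside [t], the linear function whose slope is the one-sided
    limit of [v] is an approximate primitive, and [glue] concatenates approximate primitives. *)
Lemma eps_primitive v a b eps : a <= b -> 0 < eps ->
  (forall t, a <= t < b -> cvg (v s @[s --> t^'+])) ->
  (forall t, a < t <= b -> cvg (v s @[s --> t^'-])) ->
  exists V (Fs : seq R), continuous V /\ forall t, a < t < b -> t \notin Fs ->
    exists2 d, is_derive t 1 V d & `|d - v t| <= eps.
Proof.
move=> ab eps0 vr vl.
have lin (y : Z) : continuous (fun t : R => t *: y) /\
    forall t : R, is_derive t 1 (fun t : R => t *: y) y.
  split=> [t|t]; first by apply: cvgZr_tmp.
  apply/is_derive_epsP => eta eta0; near=> s.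
  by rewrite scalerBl subrr normr0 mulr_ge0// ltW.
apply: (@cousin _ (fun a b => exists V (Fs : seq R), continuous V /\
  forall t, a < t < b -> t \notin Fs -> exists2 d, is_derive t 1 V d & `|d - v t| <= eps)) => //.
- move=> x; exists (cst 0), [::]; split=> [t|t /andP[xt tx]]; first exact: cvg_cst.
  by have := lt_trans xt tx; rewrite ltxx.
- move=> x y z xy yz [V1 [F1 [V1c V1P]]] [V2 [F2 [V2c V2P]]].
  exists (glue y V1 V2), (y :: F1 ++ F2); split; first exact: glue_continuous.
  move=> t /andP[xt tz]; rewrite inE mem_cat !negb_or => /and3P[ty t1 t2].
  have [lty|yt|E] := ltgtP t y; last by rewrite E eqxx in ty.
    have [|d d1 d2] := V1P t _ t1; first by rewrite xt.
    by exists d => //; exact: glue_derivel.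
  have [|d d1 d2] := V2P t _ t2; first by rewrite yt.
  by exists d => //; exact: glue_deriver.
- move=> t tab; have /cvgrPdist_le/(_ _ eps0)/at_right_dist[e e0 eP] := vr t tab.
  apply/at_right_dist; exists e => // s /andP[ts se].
  exists (fun x => x *: lim (v s @[s --> t^'+])), [::]; split; first exact: (lin _).1.
  move=> x /andP[tx xs] _; exists (lim (v s @[s --> t^'+])); first exact: (lin _).2.
  by apply: eP; rewrite tx (lt_trans xs).
- move=> t tab; have /cvgrPdist_le/(_ _ eps0)/at_left_dist[e e0 eP] := vl t tab.
  apply/at_left_dist; exists e => // s /andP[es st].
  exists (fun x => x *: lim (v s @[s --> t^'-])), [::]; split; first exact: (lin _).1.
  move=> x /andP[sx xt] _; exists (lim (v s @[s --> t^'-])); first exact: (lin _).2.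
  by apply: eP; rewrite xt (lt_trans es).
Unshelve. all: by end_near. Qed.

(** No integral is used: approximate primitives with errors [1 / (n + 1)] form a uniform Cauchy
    sequence by the mean value inequality, and their limit is differentiable wherever [v] is
    continuous. *)
Lemma primitive v (Fs : seq R) a b (z : Z) : a <= b -> pcont setT Fs a b v ->
  exists V, [/\ continuous V, V a = z &
    forall t, a < t < b -> t \notin Fs -> is_derive t 1 V (v t)].
Proof.
move=> ab [vc vr vl].
pose eps n : R := n.+1%:R^-1.
have eps0 n : 0 < eps n by rewrite /eps invr_gt0.
have /choice[VF VFP] : forall n, exists VF : (R -> Z) * seq R, continuous VF.1 /\
    forall t, a < t < b -> t \notin VF.2 ->
    exists2 d, is_derive t 1 VF.1 d & `|d - v t| <= eps n.
  move=> n; have [||V [F VP]] := eps_primitive ab (eps0 n) (v := v).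
  - by move=> t /vr[y _ vy]; apply/cvg_ex; exists y.
  - by move=> t /vl[y _ vy]; apply/cvg_ex; exists y.
  - by exists (V, F).
(* All approximations are given the value [z] at [a], so that bounds on their derivatives compare
   them. *)
pose u n t := (VF n).1 (clamp a b t) - (VF n).1 a + z.
have uc n : continuous (u n).
  move=> t; apply: cvgD (cvg_cst _); apply: cvgB (cvg_cst _).
  apply: (@cvg_comp _ _ _ (clamp a b) (VF n).1 _ (nbhs (clamp a b t))).
    exact: clamp_continuous.
  exact: (VFP n).1.
have ud n t : a < t < b -> t \notin (VF n).2 ->
    exists2 d, is_derive t 1 (u n) d & `|d - v t| <= eps n.
  move=> tab tF; have [d dd dv] := (VFP n).2 t tab tF; exists d => //.
  rewrite -[d]addr0; apply: is_deriveD.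
  by rewrite -[d]subr0; apply: is_deriveB; exact: is_derive_clamp.
have uclamp n t : u n (clamp a b t) = u n t.
  by rewrite /u [clamp a b (clamp _ _ _)]clamp_id// clamp_itv.
have ua n : u n a = z by rewrite /u clamp_id ?in_itv/= ?lexx// subrr add0r.
have ue n m t : (n <= m)%N -> `|u n t - u m t| <= 2 * eps n * (b - a).
  move=> nm; rewrite -(uclamp n) -(uclamp m).
  have := clamp_itv t ab; move: (clamp a b t) => {}t; rewrite in_itv /= => /andP[at_ tb].
  have := @mean_value _ _ (u n - u m) ((VF n).2 ++ (VF m).2) a t (2 * eps n) at_.
  have -> : (u n - u m) t - (u n - u m) a = u n t - u m t.
    by rewrite !fctE !ua subrr subr0.
  have e2 : 0 <= 2 * eps n by rewrite mulr_ge0// ltW.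
  move=> /(_ e2) H; apply: le_trans (H _ _) _.
  - by move=> s; apply: cvgB; [exact: uc|exact: uc].
  - move=> s /andP[as_ st]; rewrite mem_cat negb_or => /andP[sn sm].
    have sab : a < s < b by rewrite as_ (lt_le_trans st).
    have [d d1 d2] := ud n s sab sn; have [d' d'1 d'2] := ud m s sab sm.
    exists (d - d'); first exact: is_deriveB.
    rewrite -(subrKA (v s)) (le_trans (ler_normD _ _))// mulr2n mulrDl mul1r lerD//.
    rewrite distrC (le_trans d'2)// /eps lef_pV2 ?posrE ?ltr0n//.
    by rewrite ler_nat ltnS.
  - by rewrite ler_wpM2l// lerD2r.
have e0 : (fun n => 2 * eps n * (b - a)) @ \oo --> (0 : R).
  rewrite -[X in _ --> X](mul0r (b - a)); apply: cvgM (cvg_cst _).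
  rewrite -[X in _ --> X](mulr0 2); apply: cvgM (cvg_cst _) _.
  exact: cvg_harmonic.
have [V Vc uV] := uniform_cauchy_lim e0 uc ue.
have uVl t : u n t @[n --> \oo] --> V t.
  apply/cvgrPdist_le => x x0; have /cvgrPdist_le/(_ _ x0) := e0.
  apply: filterS => n; rewrite sub0r normrN => le.
  by rewrite distrC (le_trans (uV n t))// (le_trans (ler_norm _)).
exists V; split=> //.
  have uaz : u n a @[n --> \oo] --> z.
    by rewrite (_ : (fun n => u n a) = cst z); [exact: cvg_cst|apply/funext].
  exact: (cvg_unique _ (uVl a) uaz).
move=> t tab tF; apply/is_derive_epsP => eta eta0.
have eta2 : 0 < eta / 2 by lra.
have /cvgrPdist_le/(_ _ eta2)/nbhs_dist[e e_gt0 eP] := vc t tab tF.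
have /andP[ta tb] := tab.
apply/nbhs_dist; exists (Num.min e (Num.min (t - a) (b - t))).
  by rewrite !lt_min e_gt0 !subr_gt0 ta.
move=> s; rewrite !lt_min => /andP[se /andP[sa sb]].
(* Near a continuity time [t] the derivative of [u n] is within [eps n + eta / 2] of [v t]. The
   resulting bound on increments survives the limit in [n]. *)
have step n x y : a < x -> x <= y -> y < b ->
    (forall w, x < w < y -> `|w - t| < e) ->
    `|u n y - u n x - (y - x) *: v t| <= (eps n + eta / 2) * (y - x).
  move=> ax xy yb we.
  have := @mean_value _ _ (u n - *:%R^~ (v t)) (VF n).2 x y (eps n + eta / 2) xy.
  have -> : (u n - *:%R^~ (v t)) y - (u n - *:%R^~ (v t)) x = u n y - u n x - (y - x) *: v t.
    by rewrite !fctE scalerBl !opprB addrACA [RHS]addrACA [- _ - _ in LHS]addrC.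
  apply.
  - by rewrite addr_ge0// ltW.
  - by move=> w; apply: cvgB; [exact: uc|apply: cvgZr_tmp].
  move=> w /andP[xw wy] wF; have wab : a < w < b by rewrite (lt_trans ax)// (lt_trans wy).
  have [d d1 d2] := ud n w wab wF; exists (d - v t).
    apply: is_deriveB; apply/is_derive_epsP => x0 x00; near=> z0.
    by rewrite scalerBl subrr normr0 mulr_ge0// ltW.
  rewrite -(subrKA (v w)) (le_trans (ler_normD _ _))// lerD//.
  by rewrite distrC eP// we// xw.
have lim : `|u n s - u n t - (s - t) *: v t| @[n --> \oo] -->
    `|V s - V t - (s - t) *: v t|.
  by apply: cvg_norm; apply: cvgB (cvg_cst _); apply: cvgB; exact: uVl.
apply: (cvgr_to_le lim).
have /cvgrPdist_le/(_ _ eta2) : eps n @[n --> \oo] --> (0 : R) by exact: cvg_harmonic.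
apply: filterS => n; rewrite sub0r normrN => /(le_trans (ler_norm _)) epsn.
apply: (@le_trans _ _ ((eps n + eta / 2) * `|s - t|)); last first.
  by rewrite ler_wpM2r//; lra.
move: sa sb; rewrite !ltr_norml => /andP[sa _] /andP[_ sb].
move: se; rewrite ltr_norml => /andP[se1 se2].
have [ts|st] := leP t s.
  rewrite ger0_norm ?subr_ge0//; apply: step => //; try lra.
  by move=> w /andP[tw ws]; rewrite ltr_norml; apply/andP; split; lra.
rewrite ltr0_norm ?subr_lt0// opprB.
have -> : u n s - u n t - (s - t) *: v t = - (u n t - u n s - (t - s) *: v t).
  by rewrite -[s - t]opprB scaleNr opprK opprB opprB addrC.
rewrite normrN; apply: step; rewrite ?ltW//; try lra.
by move=> w /andP[tw ws]; rewrite ltr_norml; apply/andP; split; lra.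
Unshelve. all: by end_near. Qed.

End Primitive.

(** * Picard iteration on the whole interval *)

Section Picard.
Context {R : realType} {Z : completeNormedModType R}.

(** Weighing differences of iterates by [expR (2 * L * t)] makes every iteration halve them on all
    of [[0, T]], so no subdivision of the interval is needed. *)
Theorem picard (Phi : R -> Z -> Z) (Fs : seq R) (T L : R) (z0 : Z) :
  0 <= T -> 0 < L ->
  (forall t x y, 0 < t < T -> `|Phi t x - Phi t y| <= L * `|x - y|) ->
  (forall x : R -> Z, continuous x -> pcont setT Fs 0 T (fun t => Phi t (x t))) ->
  exists x : R -> Z, [/\ continuous x, x 0 = z0 &
    forall t, 0 < t < T -> t \notin Fs -> is_derive t 1 x (Phi t (x t))].
Proof.
move=> T0 L0 PhiL Phic.
have /choice[P PP] : forall x : R -> Z, exists X : R -> Z, continuous x ->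
    [/\ continuous X, X 0 = z0 &
    forall t, 0 < t < T -> t \notin Fs -> is_derive t 1 X (Phi t (x t))].
  move=> x; have [xc|nxc] := pselect (continuous x); last by exists x.
  by have [X] := primitive z0 T0 (Phic x xc); exists X.
pose x := fix loop n := if n is n'.+1 then P (loop n') else cst z0.
have xc n : continuous (x n).
  elim: n => [t|n IH]; first exact: cvg_cst.
  by have [] := PP _ IH.
have x0 n : x n 0 = z0 by case: n => [//|n]; have [] := PP _ (xc n).
have xd n t : 0 < t < T -> t \notin Fs -> is_derive t 1 (x n.+1) (Phi t (x n t)).
  by have [_ _] := PP _ (xc n); apply.
have [c _ cP] : exists2 c : R, c \in `[0, T]%classic &
    forall t : R, t \in `[0, T]%classic -> `|x 1%N t - x 0%N t| <= `|x 1%N c - x 0%N c|.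
  apply: (compact_EVT_max (f := fun t => `|x 1%N t - x 0%N t|)).
  - by exists 0; rewrite /= in_itv /= lexx.
  - exact: segment_compact.
  - by apply: continuous_subspaceT => t; apply: cvg_norm; apply: cvgB; exact: xc.
set C := `|_| in cP.
have C0 : 0 <= C by exact: normr_ge0.
pose q n : R := (2^-1) ^+ n.
have q0 n : 0 <= q n by rewrite exprn_ge0 ?invr_ge0.
have qS n : q n.+1 = q n / 2 by rewrite /q exprSr.
have bound n t : 0 <= t <= T -> `|x n.+1 t - x n t| <= C * q n * expR (2 * L * t).
  elim: n t => [|n IH] t /andP[t0 tT].
    rewrite /q expr0 mulr1; apply: le_trans (cP t _) _.
      by rewrite inE /= in_itv /= t0.
    by rewrite ler_peMr//; apply: le_trans (expR_ge1Dx _); rewrite lerDl mulr_ge0// mulr_ge0// ltW.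
  (* The derivative of [G] is [L * (C * q n * expR (2 * L * s))], the bound on the difference of the
     right-hand sides; integrating the exponential gives the factor [1 / 2]. *)
  pose G s := C * q n.+1 * expR (2 * L * s).
  have := @gronwall _ _ (x n.+2 - x n.+1) G Fs 0 t 0 t0 (lexx _).
  rewrite mul0r expR0 mul1r !fctE !x0 subrr normr0 add0r => H.
  apply: le_trans (H _ _ _ _) _; last by rewrite /G gerBl !mulr_ge0 ?expR_ge0.
  - by move=> s; apply: cvgB; exact: xc.
  - move=> s; apply: cvgM (cvg_cst _) _.
    apply: (@cvg_comp _ _ _ (fun s => 2 * L * s) expR _ (nbhs (2 * L * s))).
      by apply: cvgM (cvg_cst _) cvg_id.
    exact: continuous_expR.
  - move=> a b ab; rewrite ler_wpM2l ?mulr_ge0// ler_expR ler_wpM2l// mulr_ge0//.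
    exact: ltW.
  move=> s /andP[s0 st] sF; have sT : 0 < s < T by rewrite s0 (lt_le_trans st).
  exists (L * (C * q n * expR (2 * L * s))); split; last first.
    apply/at_right_dist; exists 1 => // s' /andP[ss' _].
    rewrite /G; have -> : 2 * L * s' = 2 * L * s + 2 * L * (s' - s) by lra.
    rewrite expRD qS.
    have := expR_ge1Dx (2 * L * (s' - s)).
    have A0 : 0 <= C * (q n / 2) * expR (2 * L * s).
      by rewrite !mulr_ge0 ?expR_ge0 ?invr_ge0.
    move=> /(ler_wpM2l A0) H1.
    move: H1; move: (expR (2 * L * s)) (expR (2 * L * (s' - s))) => e1 e2.
    by lra.
  move=> eta eta0; rewrite mul0r add0r.
  apply: (is_derive_right_growth (d := Phi s (x n.+1 s) - Phi s (x n s))) => //.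
    by apply: is_deriveB; exact: xd.
  apply: le_trans (PhiL _ _ _ sT) _; rewrite ler_wpM2l ?(ltW L0)//.
  by apply: IH; case/andP: sT => *; rewrite !ltW.
pose K := 2 * C * expR (2 * L * T).
have K0 : 0 <= K by rewrite !mulr_ge0 ?expR_ge0.
have tail n m t : 0 <= t <= T -> `|x n t - x (n + m)%N t| <= K * q n - K * q (n + m)%N.
  move=> tT; elim: m => [|m IH]; first by rewrite addn0 !subrr normr0.
  rewrite addnS -(subrKA (x (n + m)%N t)) (le_trans (ler_normD _ _))//.
  have := bound (n + m)%N t tT; rewrite distrC qS.
  have : C * q (n + m)%N * expR (2 * L * t) <= K * q (n + m)%N / 2.
    have -> : K * q (n + m)%N / 2 = C * q (n + m)%N * expR (2 * L * T).
      by rewrite /K; lra.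
    rewrite ler_wpM2l ?mulr_ge0// ler_expR ler_wpM2l ?mulr_ge0 ?(ltW L0)//.
    by case/andP: tT.
  by move: IH; lra.
pose u n t := x n (clamp 0 T t).
have clampP t : 0 <= clamp 0 T t <= T by have := clamp_itv t T0; rewrite in_itv.
have uc n : continuous (u n).
  move=> t; apply: (@cvg_comp _ _ _ (clamp 0 T) (x n) _ (nbhs (clamp 0 T t))).
    exact: clamp_continuous.
  exact: xc.
have e0 : (fun n => K * q n) @ \oo --> (0 : R).
  rewrite -[X in _ --> X](mulr0 K); apply: cvgM (cvg_cst _) _; apply: cvg_expr.
  by rewrite ger0_norm ?invr_ge0//; lra.
have [|y yc uy] := uniform_cauchy_lim e0 uc.
  move=> n m t nm; rewrite -(subnKC nm); apply: le_trans (tail _ _ _ (clampP t)) _.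
  by rewrite gerBl mulr_ge0.
have [Xc X0 Xd] := PP _ yc.
(* The uniform limit [y] is only known to be continuous. Its Picard image [P y] has the required
   derivatives and coincides with [y] on [[0, T]]. *)
have Xy t : 0 <= t <= T -> P y t = y t.
  move=> /andP[t0 tT].
  have close n : `|P y t - x n.+1 t| <= L * (K * q n) * t.
    have := @mean_value _ _ (P y - x n.+1) Fs 0 t (L * (K * q n)) t0.
    rewrite !fctE X0 x0 subrr !subr0; apply.
    - by rewrite !mulr_ge0// ltW.
    - by move=> s; apply: cvgB; [exact: Xc|exact: xc].
    move=> s /andP[s0 st] sF; have sT : 0 < s < T by rewrite s0 (lt_le_trans st).
    exists (Phi s (y s) - Phi s (x n s)).
      by apply: is_deriveB; [exact: Xd|exact: xd].
    apply: le_trans (PhiL _ _ _ sT) _; rewrite ler_wpM2l ?(ltW L0)// distrC.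
    have := uy n s; rewrite /u clamp_id// in_itv /=.
    by case/andP: sT => *; rewrite !ltW.
  apply/eqP; rewrite -subr_eq0 -normr_le0.
  apply: (@le_vanishing _ (fun n => L * (K * q n) * t + K * q n.+1)).
    rewrite -[X in _ --> X]addr0; apply: cvgD.
      rewrite -[X in _ --> X](mul0r t); apply: cvgM (cvg_cst _).
      by rewrite -[X in _ --> X](mulr0 L); apply: cvgM (cvg_cst _) _.
    by move: e0; rewrite -(cvg_shiftS (fun n => K * q n)).
  move=> n; rewrite -(subrKA (x n.+1 t)) (le_trans (ler_normD _ _))// lerD//.
  by have := uy n.+1 t; rewrite /u clamp_id// in_itv /= t0.
exists (P y); split=> // t tT tF; rewrite Xy; first exact: Xd.
by case/andP: tT => *; rewrite !ltW.
Qed.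

End Picard.

(** * Piecewise functions *)

Section Partitions.
Context {R : realType}.

Lemma near_notin (Fs : seq R) (t : R) : \forall s \near t, s != t -> s \notin Fs.
Proof.
elim: Fs => [|c Fs IH]; first by near=> s.
have : \forall s \near t, s != t -> s != c.
  have [->|tc] := eqVneq c t; first by near=> s.
  have : \forall s \near t, `|s - t| < `|c - t|.
    by apply/nbhs_dist; exists `|c - t| => //; rewrite normr_gt0 subr_eq0.
  by apply: filterS => s + _; apply: contraTneq => ->; rewrite ltxx.
move=> H; near=> s => st; rewrite inE negb_or.
have Hs : s != t -> s != c by near: s.
have IHs : s != t -> s \notin Fs by near: s.
by rewrite Hs// IHs.
Unshelve. all: by end_near. Qed.

Lemma near_open_notin (Fs : seq R) (t a b : R) : a < t < b -> t \notin Fs ->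
  \forall s \near t, a < s < b /\ s \notin Fs.
Proof.
move=> /andP[at_ tb] tF; have := near_notin Fs t.
have : \forall s \near t, a < s < b.
  apply/nbhs_dist; exists (Num.min (t - a) (b - t)); first by rewrite lt_min !subr_gt0 at_.
  by move=> s; rewrite lt_min !ltr_norml => /andP[/andP[? ?] /andP[? ?]]; apply/andP; split; lra.
apply: filterS2 => s sab sF; split=> //.
by have [->//|/sF] := eqVneq s t.
Qed.

Lemma near_right_notin (Fs : seq R) (t b : R) : t < b ->
  \forall s \near t^'+, t < s < b /\ s \notin Fs.
Proof.
move=> tb; have /nbhs_dist[e e0 eP] := near_notin Fs t.
apply/at_right_dist; exists (Num.min e (b - t)); first by rewrite lt_min e0 subr_gt0.
move=> s /andP[ts]; rewrite -ltrBlDl lt_min => /andP[se sb]; split.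
  by rewrite ts; lra.
by apply: eP; rewrite ?gt_eqF// gtr0_norm// subr_gt0.
Qed.

Lemma near_left_notin (Fs : seq R) (t a : R) : a < t ->
  \forall s \near t^'-, a < s < t /\ s \notin Fs.
Proof.
move=> at_; have /nbhs_dist[e e0 eP] := near_notin Fs t.
apply/at_left_dist; exists (Num.min e (t - a)); first by rewrite lt_min e0 subr_gt0.
move=> s; rewrite ltrBlDr -ltrBlDl lt_min => /andP[/andP[se sb] ts]; split.
  by rewrite ts; lra.
by apply: eP; rewrite ?lt_eqF// distrC gtr0_norm// ?subr_gt0.
Qed.

Lemma path_piece_right (d a b : R) s t : path <%R a s -> last a s = b -> a <= t < b ->
  exists2 i, (i < size s)%N & nth d (a :: s) i <= t < nth d (a :: s) i.+1.
Proof.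
elim: s a => [|c s IH] a /=; first by move=> _ -> /andP[/le_lt_trans]/[apply]; rewrite ltxx.
move=> /andP[ac cs] lb /andP[at_ tb]; have [tc|ct] := ltP t c.
  by exists 0%N => //=; rewrite at_.
by have [|i si iP] := IH c cs lb; [rewrite ct|exists i.+1].
Qed.

Lemma path_piece_left (d a b : R) s t : path <%R a s -> last a s = b -> a < t <= b ->
  exists2 i, (i < size s)%N & nth d (a :: s) i < t <= nth d (a :: s) i.+1.
Proof.
elim: s a => [|c s IH] a /=; first by move=> _ -> /andP[/lt_le_trans]/[apply]; rewrite ltxx.
move=> /andP[ac cs] lb /andP[at_ tb]; have [tc|ct] := leP t c.
  by exists 0%N => //=; rewrite at_.
by have [|i si iP] := IH c cs lb; [rewrite ct|exists i.+1].
Qed.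

Lemma path_piece_notin (d a : R) s t i : path <%R a s -> (i < size s)%N ->
  nth d (a :: s) i < t < nth d (a :: s) i.+1 -> t \notin a :: s.
Proof.
move=> pas si /andP[it ti]; apply/negP => tin.
have sor : sorted <%R (a :: s) by [].
have jt : nth d (a :: s) (index t (a :: s)) = t by rewrite nth_index.
have js : (index t (a :: s) < size (a :: s))%N by rewrite index_mem.
move: it ti; rewrite -jt !lt_sorted_ltn_nth ?inE//; last by rewrite ltnS ltnW.
by rewrite ltnS => h1 h2; have := leq_trans h1 h2; rewrite ltnn.
Qed.

Lemma path_bounds (d a b : R) s i : path <%R a s -> last a s = b -> (i < size s)%N ->
  a <= nth d (a :: s) i /\ nth d (a :: s) i.+1 <= b.
Proof.
move=> pas lb si; have sor : sorted <%R (a :: s) by [].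
split.
  by rewrite -[a in X in X <= _]/(nth d (a :: s) 0) lt_sorted_leq_nth ?inE// ltnW.
have -> : b = nth d (a :: s) (size s) by rewrite nth_last.
by rewrite lt_sorted_leq_nth ?inE ?ltnS.
Qed.

Lemma partition_through (Fs : seq R) (T : R) : 0 < T ->
  exists2 s, itv_partition 0 T s & forall x, x \in Fs -> 0 < x < T -> x \in s.
Proof.
move=> T0; pose p := sort <=%R (undup [seq x <- Fs | 0 < x < T]).
have inp x : (x \in p) = (0 < x < T) && (x \in Fs).
  by rewrite mem_sort mem_undup mem_filter.
exists (rcons p T); last by move=> x xF x0T; rewrite mem_rcons inE inp x0T xF orbT.
split; last by rewrite last_rcons.
rewrite rcons_path path_sortedE; last exact: lt_trans.
rewrite sort_lt_sorted undup_uniq andbT; apply/andP; split.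
  by apply/allP => x; rewrite inp => /andP[/andP[]].
by have := mem_last 0 p; rewrite inE inp => /predU1P[->//|/andP[/andP[]]].
Qed.

End Partitions.

Section Conversions.
Context {R : realType} {Y : topologicalType}.

Lemma cvg_right_of_continuous (u : R -> Y) t : {for t, continuous u} ->
  u s @[s --> t^'+] --> u t.
Proof. by move=> uc; apply: cvg_within_filter. Qed.

Lemma cvg_left_of_continuous (u : R -> Y) t : {for t, continuous u} ->
  u s @[s --> t^'-] --> u t.
Proof. by move=> uc; apply: cvg_within_filter. Qed.

Lemma pcont_of_along (A : set Y) (T : R) (u : R -> Y) s :
  (forall t, 0 < t < T -> A (u t)) -> piecewise_continuous_along T A u s ->
  pcont A s 0 T u.
Proof.
move=> Au [[ps lT] H].
have int t i : (i < size s)%N -> nth T (0 :: s) i < t < nth T (0 :: s) i.+1 ->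
    {for t, continuous u} /\ A (u t).
  move=> si tP; have [uc _ _] := H i si; split; first by apply: uc; rewrite in_itv.
  have [b1 b2] := path_bounds T ps (eqP lT) si; case/andP: tP => t1 t2.
  by apply: Au; rewrite (le_lt_trans b1)// (lt_le_trans t2).
split=> t /andP[t0 tT].
- move=> ts; have [|i si /andP[it ti]] := path_piece_right T ps (eqP lT) (t := t).
    by rewrite ltW.
  apply: (int t i si _).1; rewrite ti andbT lt_neqAle it andbT.
  have : nth T (0 :: s) i \in 0 :: s by rewrite mem_nth//= ltnW.
  rewrite inE => /predU1P[->|]; first by rewrite lt_eqF.
  by apply: contraTneq => ->.
- have [|i si /andP[it ti]] := path_piece_right T ps (eqP lT) (t := t); first by rewrite t0.
  move: it; rewrite le_eqVlt => /predU1P[<-|it]; first by have [] := H i si.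
  have [uc Aut] := int t i si (introT andP (conj it ti)).
  by exists (u t) => //; exact: cvg_right_of_continuous.
- have [|i si /andP[it ti]] := path_piece_left T ps (eqP lT) (t := t); first by rewrite t0.
  move: ti; rewrite le_eqVlt => /predU1P[->|ti]; first by have [] := H i si.
  have [uc Aut] := int t i si (introT andP (conj it ti)).
  by exists (u t) => //; exact: cvg_left_of_continuous.
Qed.

Lemma along_of_pcont (A : set Y) (Fs : seq R) (T : R) (u : R -> Y) : 0 < T ->
  pcont A Fs 0 T u -> exists2 s, piecewise_continuous_along T A u s &
  forall i t, (i < size s)%N -> t \in `]nth T (0 :: s) i, nth T (0 :: s) i.+1[ ->
    0 < t < T /\ t \notin Fs.
Proof.
move=> T0 [uc ur ul]; have [s [ps lT] sF] := partition_through Fs T0.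
have int i t : (i < size s)%N -> t \in `]nth T (0 :: s) i, nth T (0 :: s) i.+1[ ->
    0 < t < T /\ t \notin Fs.
  move=> si; rewrite in_itv /= => tP; have [b1 b2] := path_bounds T ps (eqP lT) si.
  have t0T : 0 < t < T.
    by case/andP: tP => t1 t2; rewrite (le_lt_trans b1)// (lt_le_trans t2).
  split=> //; apply/negP => /sF/(_ t0T).
  by have := path_piece_notin ps si tP; rewrite inE negb_or => /andP[_ /negP].
exists s => //; split=> // i si a b.
have ab : a < b.
  have sor : sorted <%R (0 :: s) by [].
  by rewrite /a /b lt_sorted_ltn_nth ?inE// ltnS ltnW.
have [b1 b2] := path_bounds T ps (eqP lT) si.
split.
- by move=> t /(int i t si)[t0T tF]; exact: uc.
- by apply: ur; rewrite b1 (lt_le_trans ab).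
- by apply: ul; rewrite b2 (le_lt_trans b1).
Qed.

End Conversions.

Section ExtendedDerivative.
Context {R : realType} {Z : normedModType R}.
Implicit Types x v : R -> Z.

Lemma derive1_is_derive x (t : R) : derivable x t 1 -> is_derive t 1 x (derive1 x t).
Proof. by move=> dx; rewrite derive1E; exact: derivableP. Qed.

(** Frees the extended derivative from the subdivision picked by [xget]: what remains is its
    description by one-sided limits of [derive1 x]. *)
Lemma ext_derivP (T : R) x : 0 < T -> (exists s, piecewise_C1_along T x s) ->
  [/\ forall t, 0 <= t < T -> derive1 x r @[r --> t^'+] --> ext_deriv T x t,
      derive1 x r @[r --> T^'-] --> ext_deriv T x T &
      exists Fs : seq R, forall t, 0 < t < T -> t \notin Fs ->
        {for t, continuous (derive1 x)} /\ is_derive t 1 x (ext_deriv T x t)].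
Proof.
move=> T0 exs; rewrite /ext_deriv.
set s := xget _ _; have [[pa lT] H] : piecewise_C1_along T x s by exact: xgetPex.
have [dc dr dl] := pcont_of_along (fun _ _ => I) (conj pa lT).
split.
- move=> t /andP[t0 tT]; rewrite lt_eqF//; case: ifPn => ts.
    by have [|y _ yP] := dr t; [rewrite t0|apply/cvg_ex; exists y].
  move: ts; rewrite inE negb_or => /andP[t0' ts]; apply: cvg_right_of_continuous.
  by apply: dc => //; rewrite lt_neqAle eq_sym t0' t0.
- by rewrite eqxx; have [|y _ yP] := dl T; [rewrite T0 lexx|apply/cvg_ex; exists y].
exists s => t /andP[t0 tT] ts; rewrite lt_eqF// inE gt_eqF//= (negbTE ts).
split; first by apply: dc => //; rewrite t0.
apply: derive1_is_derive; case: pa => ps lst.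
have [|i si /andP[it ti]] := path_piece_right T ps (eqP lst) (t := t); first by rewrite ltW.
apply: (H i si); rewrite in_itv /= ti andbT lt_neqAle it andbT.
have : nth T (0 :: s) i \in 0 :: s by rewrite mem_nth//= ltnW.
rewrite inE => /predU1P[->|]; first by rewrite lt_eqF.
by apply: contraTneq => ->.
Qed.

(** Off the finite set [Fs], [v] coincides with [derive1 x], hence has the same one-sided limits at
    all times. By [ext_derivP] these limits determine the extended derivative. *)
Lemma PC1_intro (T : R) (G : set Z) (Fs : seq R) x v : 0 < T ->
  {within `[0, T], continuous x} -> pcont setT Fs 0 T v ->
  (forall t, 0 < t < T -> t \notin Fs -> is_derive t 1 x (v t)) ->
  (forall t, 0 <= t < T -> v s @[s --> t^'+] --> v t) -> v s @[s --> T^'-] --> v T ->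
  (forall t, t \in `[0, T] -> G (x t)) ->
  PC1 T G x /\ forall t, t \in `[0, T] -> ext_deriv T x t = v t.
Proof.
move=> T0 xc [vc vr vl] xd vrc vlc xG.
have d1v t : 0 < t < T -> t \notin Fs -> v t = derive1 x t.
  by move=> t0T tF; rewrite derive1E; apply/esym; exact: (@derive_val _ _ _ _ _ _ _ (xd t t0T tF)).
have eqr t : 0 <= t < T -> \forall s \near t^'+, v s = derive1 x s.
  move=> /andP[t0 tT]; have := near_right_notin Fs tT; apply: filterS => s [/andP[ts sT] sF].
  by apply: d1v => //; rewrite sT (le_lt_trans t0).
have eql t : 0 < t <= T -> \forall s \near t^'-, v s = derive1 x s.
  move=> /andP[t0 tT]; have := near_left_notin Fs t0; apply: filterS => s [/andP[ts sT] sF].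
  by apply: d1v => //; rewrite ts (lt_le_trans sT).
have dpc : pcont setT Fs 0 T (derive1 x).
  split=> t tT.
  - move=> tF; have := near_open_notin tT tF => H.
    rewrite /prop_for /continuous_at -(d1v _ tT tF); apply: cvg_trans (vc t tT tF).
    by apply: near_eq_cvg; apply: filterS H => s [sT sF]; exact: d1v.
  - have [y _ yP] := vr t tT; exists y => //; apply: cvg_trans yP.
    by apply: near_eq_cvg; exact: eqr.
  - have [y _ yP] := vl t tT; exists y => //; apply: cvg_trans yP.
    by apply: near_eq_cvg; exact: eql.
have [s sP sF] := along_of_pcont T0 dpc.
have C1 : exists s, piecewise_C1_along T x s.
  exists s; split=> // i si t tP; have [t0T tF] := sF i t si tP.
  exact: (@ex_derive _ _ _ _ _ _ _ (xd t t0T tF)).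
split; first by split.
have [er el _] := ext_derivP T0 C1.
move=> t; rewrite in_itv /= => /andP[t0]; rewrite le_eqVlt => /predU1P[->|tT].
  apply: (cvg_unique _ el) => //; apply: cvg_trans vlc.
  by apply: near_eq_cvg; apply: eql; rewrite T0 lexx.
have t0T : 0 <= t < T by rewrite t0.
apply: (cvg_unique _ (er t t0T)) => //; apply: cvg_trans (vrc t t0T).
by apply: near_eq_cvg; exact: eqr.
Qed.

End ExtendedDerivative.

(** * Compactness and differentiability *)

Section CompactHull.
Context {R : realType} {Y : topologicalType}.

Lemma within_itv_continuous (w : R -> Y) a b :
  (forall t, a <= t < b -> w s @[s --> t^'+] --> w t) ->
  (forall t, a < t <= b -> w s @[s --> t^'-] --> w t) ->
  {within `[a, b], continuous w}.
Proof.
move=> wr wl; apply/subspace_continuousP => t /=; rewrite in_itv /= => /andP[at_ tb] P nP.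
have [e1 e10 e1P] : exists2 e, 0 < e & forall s, t < s < t + e -> s <= b -> P (w s).
  have [tb'|bt] := ltP t b; last first.
    by exists 1 => // s /andP[ts _] /(lt_le_trans ts); rewrite ltNge bt.
  have /at_right_dist[e e0 eP] := wr t (introT andP (conj at_ tb')) _ nP.
  by exists e => // s /eP.
have [e2 e20 e2P] : exists2 e, 0 < e & forall s, t - e < s < t -> a <= s -> P (w s).
  have [ta|ta] := ltP a t; last first.
    by exists 1 => // s /andP[_ st] /le_lt_trans/(_ st); rewrite ltNge ta.
  have /at_left_dist[e e0 eP] := wl t (introT andP (conj ta tb)) _ nP.
  by exists e => // s /eP.
rewrite /= /within /=; apply: (nbhs_dist t (fun s => s \in `[a, b] -> P (w s))).2.
exists (Num.min e1 e2); first by rewrite lt_min e10.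
move=> s; rewrite lt_min !ltr_norml in_itv /= => /andP[/andP[h1 h2] /andP[h3 h4]] /andP[as_ sb].
have [st|ts|->] := ltgtP s t; last exact: nbhs_singleton.
  by apply: e2P => //; rewrite st andbT; lra.
by apply: e1P => //; rewrite ts; lra.
Qed.

Lemma pcont_split (A : set Y) (c : R) (Fs : seq R) a b (v : R -> Y) : a < c < b ->
  pcont A (c :: Fs) a b v -> pcont A Fs a c v /\ pcont A Fs c b v.
Proof.
move=> /andP[ac cb] [vc vr vl]; split; split=> t /andP[t1 t2].
- move=> tF; apply: vc; first by rewrite t1 (lt_trans t2).
  by rewrite inE negb_or tF lt_eqF.
- by apply: vr; rewrite t1 (lt_trans t2).
- by apply: vl; rewrite t1 ltW// (le_lt_trans t2).
- move=> tF; apply: vc; first by rewrite t2 (lt_trans ac).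
  by rewrite inE negb_or tF gt_eqF.
- by apply: vr; rewrite t2 ltW// (lt_le_trans ac).
- by apply: vl; rewrite t2 (lt_trans ac).
Qed.

(** Between two exceptional times, [v] completed by its one-sided limits is continuous on a closed
    interval, with compact image. The image stays in [A] because [pcont] requires the limits to lie
    there. *)
Lemma pcont_compact (A : set Y) (Fs : seq R) a b (v : R -> Y) : a <= b ->
  (forall t, a <= t <= b -> A (v t)) -> pcont A Fs a b v ->
  exists M : set Y, [/\ compact M, M `<=` A & forall t, a <= t <= b -> M (v t)].
Proof.
elim: Fs a b => [|c Fs IH] a b ab Av vp.
  move: ab; rewrite le_eqVlt => /predU1P[ab|ab].
    exists [set v a]; split=> [|_ ->|t]; first exact: compact_set1.
      by apply: Av; rewrite ab lexx.
    by rewrite -ab -eq_le => /eqP <-.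
  have [vc vr vl] := vp.
  have [|ya Aya vya] := vr a; first by rewrite lexx ab.
  have [|yb Ayb vyb] := vl b; first by rewrite lexx ab.
  pose w t := if t <= a then ya else if b <= t then yb else v t.
  have wv t : a < t < b -> w t = v t.
    by move=> /andP[at_ tb]; rewrite /w leNgt at_ /= leNgt tb.
  have wa : w a = ya by rewrite /w lexx.
  have wb : w b = yb by rewrite /w leNgt ab lexx.
  have wc : {within `[a, b], continuous w}.
    apply: within_itv_continuous => t /andP[at_ tb].
      have vw : w s @[s --> t^'+] `=>` (v s @[s --> t^'+]).
        apply: near_eq_cvg; have := near_right_notin [::] tb; apply: filterS => s.
        by move=> [/andP[ts sb] _]; rewrite wv// sb (le_lt_trans at_).
      move: at_; rewrite le_eqVlt => /predU1P[at_|at_].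
        by rewrite -at_ wa; rewrite -at_ in vw; exact: cvg_trans vya.
      rewrite wv ?at_//; apply: cvg_trans vw _; apply: cvg_right_of_continuous.
      by apply: vc => //; rewrite at_.
    have vw : w s @[s --> t^'-] `=>` (v s @[s --> t^'-]).
      apply: near_eq_cvg; have := near_left_notin [::] at_; apply: filterS => s.
      by move=> [/andP[ts sb] _]; rewrite wv// ts (lt_le_trans sb).
    move: tb; rewrite le_eqVlt => /predU1P[tb|tb].
      by rewrite tb wb; rewrite tb in vw; exact: cvg_trans vyb.
    rewrite wv ?at_//; apply: cvg_trans vw _; apply: cvg_left_of_continuous.
    by apply: vc => //; rewrite at_.
  exists ([set v a] `|` [set v b] `|` w @` `[a, b]); split.
  - apply: compactU; last by apply: continuous_compact => //; exact: segment_compact.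
    by apply: compactU; exact: compact_set1.
  - move=> _ [[->|->]|[t /= + <-]]; [by apply: Av; rewrite lexx ltW..|].
    rewrite in_itv /= => tab; rewrite /w; case: ifPn => // _; case: ifPn => // _.
    exact: Av.
  - move=> t /andP[]; rewrite le_eqVlt => /predU1P[<-|at_]; first by do 2 left.
    rewrite le_eqVlt => /predU1P[->|tb]; first by left; right.
    by right; exists t; rewrite ?wv ?at_//= in_itv /= !ltW.
have [acb|nacb] := boolP (a < c < b); last first.
  apply: IH => //; have [vc vr vl] := vp; split=> // t tab tF; apply: vc => //.
  by rewrite inE negb_or tF andbT; apply: contraNneq nacb => <-.
have [vp1 vp2] := pcont_split acb vp; case/andP: acb => ac cb.
have [|M1 [M1c M1A M1v]] := IH a c (ltW ac) _ vp1.
  by move=> t /andP[t1 t2]; apply: Av; rewrite t1 (le_trans t2)// ltW.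
have [|M2 [M2c M2A M2v]] := IH c b (ltW cb) _ vp2.
  by move=> t /andP[t1 t2]; apply: Av; rewrite t2 (le_trans _ t1)// ltW.
exists (M1 `|` M2); split; first exact: compactU.
  by move=> y [/M1A|/M2A].
move=> t /andP[t1 t2]; have [tc|ct] := leP t c; first by left; apply: M1v; rewrite t1.
by right; apply: M2v; rewrite t2 ltW.
Qed.

End CompactHull.

Section CompactNormed.
Context {R : realType} {V : normedModType R}.
Implicit Types K O : set V.

Lemma normed_nbhs (x : V) (P : set V) : (\forall y \near x, P y) <->
  exists2 e, 0 < e & forall y, `|y - x| < e -> P y.
Proof.
split=> [/nbhs_ballP[e /= e0 eP]|[e e0 eP]].
  by exists e => // s st; apply: eP; rewrite -ball_normE /= distrC.
by apply/nbhs_ballP; exists e => //= s; rewrite -ball_normE /= distrC => /eP.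
Qed.

Lemma compact_thicken K O : compact K -> open O -> K `<=` O ->
  exists2 r, 0 < r & forall k x, K k -> `|x - k| < r -> O x.
Proof.
move=> /compact_near_coveringP Kc Oo KO.
have : \forall r \near (0 : R)^'+, K `<=` (fun k => forall x, `|x - k| < r -> O x).
  apply: Kc => x Kx.
  have /normed_nbhs[e e0 eP] : \forall y \near x, O y by apply: open_nbhs_nbhs; split=> //; exact: KO.
  exists ([set y | `|y - x| < e / 2], [set r | r < e / 2]).
    split; first by apply/normed_nbhs; exists (e / 2) => //; lra.
    by apply/at_right_dist; exists (e / 2) => [|r /andP[]]; [lra|rewrite add0r].
  move=> [k r] /= [kx re] z zk; apply: eP; rewrite -(subrKA k).
  by apply: le_lt_trans (ler_normD _ _) _; lra.
move=> /at_right_dist[r r0 rP]; exists (r / 2); first by lra.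
by move=> k x Kk; apply: (rP (r / 2)) => //; lra.
Qed.

(** Meant for arguments by contradiction: a sequence of counterexamples approaching [K] yields a
    compact set, to which hypotheses quantified over compact sets apply. *)
Lemma compact_add_seq K (k kap : nat -> V) : compact K -> (forall n, K (kap n)) ->
  (forall e, 0 < e -> \forall n \near \oo, `|k n - kap n| < e) ->
  compact (K `|` range k).
Proof.
move=> /compact_near_coveringP Kc Kkap kkap; apply/compact_near_coveringP => I F P FF H.
have HK : \forall i \near F, K `<=` P i by apply: Kc => x Kx; apply: H; left.
(* A neighbourhood of a point of [K] also takes care of the late terms whose companion [kap m] is
   near that point; the finitely many early terms are treated separately. *)
have : \forall p \near (F, \oo), K `<=` (fun x => forall m, (p.2 <= m)%N -> kap m = x -> P p.1 (k m)).
  apply: (Kc _ (filter_prod F \oo)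
    (fun p x => forall m, (p.2 <= m)%N -> kap m = x -> P p.1 (k m))) => x Kx.
  have [[B1 B2] /= [xB1 FB2] B12] := H x (or_introl Kx).
  move: xB1 => /normed_nbhs[e e0 eP].
  have e2 : 0 < e / 2 by lra.
  exists ([set y | `|y - x| < e / 2],
    B2 `*` [set n | forall m, (n <= m)%N -> `|k m - kap m| < e / 2]).
    split; first by apply/normed_nbhs; exists (e / 2).
    exists (B2, [set n | forall m, (n <= m)%N -> `|k m - kap m| < e / 2]) => //=.
    split=> //; have [N _ NP] := kkap _ e2; exists N => // n /= Nn m nm; apply: NP.
    exact: leq_trans Nn nm.
  move=> [y [i n]] /= [yx [B2i nP]] m nm kapm; apply: (B12 (k m, i)) => /=; split=> //.
  apply: eP; rewrite -(subrKA (kap m)); apply: le_lt_trans (ler_normD _ _) _.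
  by have := nP m nm; rewrite kapm; lra.
move=> [[B1 B2] /= [FB1 [N _ NB2]] B12].
have Hlt : \forall i \near F, forall m : 'I_N, P i (k m).
  apply: filter_forall => m.
  have [[C1 C2] /= [kC1 FC2] C12] : \forall x' \near k m & i \near F, P i x'.
    by apply: H; right; exists m.
  by apply: filterS FC2 => i C2i; apply: (C12 (k m, i)); split=> //; exact: nbhs_singleton.
near=> i => x [Kx|[m _ <-]].
  have Ki : K `<=` P i by near: i.
  exact: Ki.
have [mN|Nm] := ltnP m N.
  have Hi : forall m : 'I_N, P i (k m) by near: i.
  exact: (Hi (Ordinal mN)).
have B1i : B1 i by near: i.
by apply: (B12 (i, N) _ (kap m)) => //=; split=> //; apply: NB2 => /=.
Unshelve. all: by end_near. Qed.

End CompactNormed.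

Section Hadamard.
Context {R : realType}.

(** The definition covers directions in a compact set, whereas actual variations only approach them.
    If no [d] worked, bad directions [k'] tending to [K] would form with it a compact set by
    [compact_add_seq], contradicting the definition there. *)
Lemma hadamard_unif {X Y : normedModType R} (f : X -> Y) x (D : blin X Y) (K : set X) eta :
  is_hadamard f x D -> compact K -> K !=set0 -> 0 < eta ->
  exists2 d, 0 < d & forall t k k', 0 < t < d -> K k -> `|k' - k| < d ->
    `|t^-1 *: (f (x + t *: k') - f x) - D k| <= eta.
Proof.
move=> fD Kc K0 eta0; apply: contrapT => nd.
have /choice[p pP] : forall n : nat, exists p : R * X * X,
    [/\ 0 < p.1.1 < n.+1%:R^-1, K p.1.2, `|p.2 - p.1.2| < n.+1%:R^-1 &
    eta < `|p.1.1^-1 *: (f (x + p.1.1 *: p.2) - f x) - D p.1.2|].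
  move=> n; apply: contrapT => np; apply: nd; exists n.+1%:R^-1; first by rewrite invr_gt0.
  move=> t k k' tn Kk kk'; rewrite leNgt; apply/negP => lt.
  by apply: np; exists (t, k, k').
have small e : 0 < e -> \forall n \near \oo, n.+1%:R^-1 < e :> R.
  by move=> e0; have := near_infty_natSinv_lt (PosNum e0).
have pk e : 0 < e -> \forall n \near \oo, `|(p n).2 - (p n).1.2| < e.
  move=> /small; apply: filterS => n; apply: lt_trans.
  by have [] := pP n.
have Kpc : compact (K `|` range (fun n => (p n).2)).
  by apply: (compact_add_seq Kc _ pk) => n; have [] := pP n.
have eta2 : 0 < eta / 2 by lra.
have [k0 Kk0] := K0.
have nb : nbhs (0%E : \bar R) [set y | (y < (eta / 2)%:E)%E].
  by apply: open_nbhs_nbhs; split; [exact: open_ereal_lt_ereal|rewrite /= lte_fin].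
have [|t1 t10 t1P] := (at_right_dist _ _).1 (fD _ Kpc _ _ nb).
  by exists k0; left.
pose C := opnorm D + 1.
have C0 : 0 < C by rewrite ltr_wpDl// opnorm_ge0.
have e0 : 0 < Num.min t1 (eta / 2 / C) by rewrite lt_min t10 divr_gt0.
have [n _ /(_ n (leqnn n)) /=] := small _ e0.
have [/andP[tn0 tn] Kn kn etan] := pP n.
rewrite lt_min => /andP[n1 n2].
have /= := t1P (p n).1.1; rewrite tn0 add0r (lt_trans tn n1) => /(_ isT) supP.
have q1 : `|(p n).1.1^-1 *: (f (x + (p n).1.1 *: (p n).2) - f x) - D (p n).2| < eta / 2.
  rewrite -lte_fin; apply: le_lt_trans supP; apply: ereal_sup_ubound.
  by exists (p n).2 => //; right; exists n.
have q2 : `|D (p n).2 - D (p n).1.2| < eta / 2.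
  rewrite -raddfB; apply: le_lt_trans (opnormP _ _) _.
  have := lt_trans kn n2; rewrite ltr_pdivlMr// mulrC; apply: le_lt_trans.
  by rewrite ler_wpM2r// lerDl.
move: etan; rewrite ltNge => /negP; apply.
rewrite -(subrKA (D (p n).2)) (le_trans (ler_normD _ _))//; lra.
Qed.

Lemma norm_quotient {Y : normedModType R} (t eta : R) (a b : Y) : 0 < t ->
  `|a - t^-1 *: b| <= eta -> `|b - t *: a| <= eta * t.
Proof.
move=> t0 le; have -> : b - t *: a = - t *: (a - t^-1 *: b).
  by rewrite scalerBr !scaleNr scalerA mulfV ?gt_eqF// scale1r opprK addrC.
by rewrite normrZ normrN gtr0_norm// mulrC ler_wpM2r// ltW.
Qed.

(** The one-sided limit in the direction [- h] controls the left increments, so the derivative along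
    the line is two-sided. *)
Lemma is_gateaux_is_derive {X Y : normedModType R} (f : X -> Y) (z h : X) (s : R) (D : blin X Y) :
  is_gateaux f (z + s *: h) D -> is_derive s 1 (fun s => f (z + s *: h)) (D h).
Proof.
move=> fD; apply/is_derive_epsP => eta eta0.
have [e1 e10 e1P] := (at_right_dist _ _).1 ((cvgrPdist_le _ _).1 (fD h) _ eta0).
have [e2 e20 e2P] := (at_right_dist _ _).1 ((cvgrPdist_le _ _).1 (fD (- h)) _ eta0).
apply/nbhs_dist; exists (Num.min e1 e2); first by rewrite lt_min e10.
move=> s'; rewrite lt_min => /andP[se1 se2].
have [s's|ss'|->] := ltgtP s' s; last first.
- by rewrite !subrr scale0r subr0 !normr0 mulr0.
- have t0 : 0 < s' - s by rewrite subr_gt0.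
  have tE : `|s' - s| = s' - s by rewrite gtr0_norm.
  have := e1P (s' - s); rewrite t0 add0r -tE se1 tE => /(_ isT)/(norm_quotient t0).
  have -> : z + s *: h + (s' - s) *: h = z + s' *: h.
    by rewrite -addrA -scalerDl subrKC.
  by move=> le; rewrite [X in _ <= _ * X]gtr0_norm.
have t0 : 0 < s - s' by rewrite subr_gt0.
have tE : `|s' - s| = s - s' by rewrite distrC gtr0_norm.
have := e2P (s - s'); rewrite t0 add0r -tE se2 tE => /(_ isT)/(norm_quotient t0).
have -> : z + s *: h + (s - s') *: - h = z + s' *: h.
  by rewrite scalerN -scaleNr opprB -addrA -scalerDl subrKC.
have -> : (s - s') *: D (- h) = (s' - s) *: D h.
  by rewrite raddfN scalerN -scaleNr opprB.
by [].
Qed.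

Lemma gateaux_lipschitz {X Y : normedModType R} (f : X -> Y) (C : set X) (L : R) x y :
  (forall s : R, 0 <= s <= 1 -> C (x + s *: (y - x))) ->
  (forall z, C z -> gateaux_differentiable f z /\ `|Dgateaux f z| <= L) ->
  `|f y - f x| <= L * `|y - x|.
Proof.
move=> Cxy fC; pose r (s : R) := f (x + s *: (y - x)).
have rd (s : R) : 0 <= s <= 1 -> is_derive s 1 r (Dgateaux f (x + s *: (y - x)) (y - x)).
  move=> s01; apply: is_gateaux_is_derive; have [[D fD] _] := fC _ (Cxy s s01).
  by rewrite /Dgateaux; apply: (xgetPex 0); exists D.
have L0 : 0 <= L.
  by apply: le_trans (fC _ (Cxy 0 _)).2; rewrite ?normr_ge0 ?lexx ?ler01.
have rc : continuous (r \o clamp 0 1).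
  apply: clamp_continuous_within => //; apply: derivable_within_continuous => s.
  by rewrite in_itv /= => /rd[].
have := @mean_value _ _ (r \o clamp 0 1) [::] 0 1 (L * `|y - x|) ler01.
rewrite subr0 mulr1 /= !clamp_id ?in_itv/= ?lexx ?ler01//.
rewrite /r scale1r subrKC scale0r addr0; apply=> //.
- by rewrite mulr_ge0.
- move=> s /andP[s0 s1] _; have s01 : 0 <= s <= 1 by rewrite !ltW.
  exists (Dgateaux f (x + s *: (y - x)) (y - x)).
    by apply: is_derive_clamp; [rewrite s0|exact: rd].
  apply: le_trans (opnormP _ _) _; rewrite ler_wpM2r//.
  exact: (fC _ (Cxy s s01)).2.
Qed.

End Hadamard.

Section BlinComplete.
Context {R : realType} {X : normedModType R} {Y : completeNormedModType R}.

Lemma opnorm_bound (f : blin X Y) (C : R) : 0 <= C -> (forall x, `|f x| <= C * `|x|) -> `|f| <= C.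
Proof.
move=> C0 fC; apply: opnorm_le => x x1; apply: le_trans (fC x) _.
by rewrite ler_piMr.
Qed.

Lemma blin_dist (f g : blin X Y) x : `|f x - g x| <= `|f - g| * `|x|.
Proof. exact: (opnormP (f - g) x). Qed.

(** Limits are taken pointwise. Completeness is what allows the adjoint equation to be solved by
    [picard] in [blin E R^o]. *)
Lemma blin_cauchy_cvg (F : set_system (blin X Y)) : ProperFilter F -> cauchy F -> cvg F.
Proof.
move=> FF /cauchyP Fc.
have near_e e : 0 < e -> exists f0 : blin X Y, \forall f \near F, `|f0 - f| < e.
  by move=> e0; have [f0 f0P] := Fc _ e0; exists f0; move: f0P; rewrite -ball_normE.
have evc x : cvg ((fun f : blin X Y => f x) @ F).
  apply/cauchy_cvgP/cauchy_exP => e e0.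
  have C0 : 0 < `|x| + 1 by rewrite ltr_wpDl.
  have [f0 f0P] := near_e _ (divr_gt0 e0 C0).
  exists (f0 x); rewrite -ball_normE /=; apply: filterS f0P => f /= ff0.
  apply: le_lt_trans (blin_dist _ _ _) _.
  move: ff0; rewrite ltr_pdivlMr//; apply: le_lt_trans.
  by rewrite ler_wpM2l// lerDl.
pose g x := lim ((fun f : blin X Y => f x) @ F).
have gP x : (fun f : blin X Y => f x) @ F --> g x by exact: evc.
have gle f0 e : 0 <= e -> (\forall f \near F, `|f0 - f| < e) -> forall x, `|f0 x - g x| <= e * `|x|.
  move=> e0 f0P x; have : (fun f : blin X Y => `|f0 x - f x|) @ F --> `|f0 x - g x|.
    by apply: cvg_norm; apply: cvgB (cvg_cst _) (gP x).
  move=> /cvgr_to_le; apply; apply: filterS f0P => f /ltW ff0.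
  by apply: le_trans (blin_dist _ _ _) _; rewrite ler_wpM2r.
have gl : linear g.
  move=> a x y; apply: (cvg_unique _ (gP (a *: x + y))) => //.
  have : (fun f : blin X Y => a *: f x + f y) @ F --> a *: g x + g y.
    by apply: cvgD (gP y); apply: cvgZl_tmp; exact: gP.
  apply: cvg_trans; apply: near_eq_cvg; apply: nearW => f.
  exact: (esym (blin_linear f a x y)).
have gb : g \in @bounded_linear R X Y.
  apply/bounded_linearP; split=> //; have [f0 f0P] := near_e 1 ltr01.
  exists (1 + opnorm f0) => x; have := gle _ _ ler01 f0P x.
  have := opnormP f0 x; rewrite mulrDl => h1 h2.
  rewrite -[g x](subrK (f0 x)) (le_trans (ler_normD _ _))// lerD// distrC.
  exact: h2.
apply/cvg_ex; exists (BLin gb); apply/cvgrPdist_le => e e0.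
have e2 : 0 < e / 2 by lra.
have [f0 f0P] := near_e _ e2.
have h0 : `|f0 - BLin gb| <= e / 2.
  apply: opnorm_bound; first exact: ltW.
  by move=> x; apply: gle => //; exact: ltW.
apply: filterS f0P => f; rewrite distrC => ff0.
rewrite distrC -(subrKA f0); apply: le_trans (ler_normD _ _) _; lra.
Qed.

HB.instance Definition _ := Uniform_isComplete.Build (blin X Y) blin_cauchy_cvg.

End BlinComplete.

Section BlinContinuity.
Context {R : realType} {X Y Z : normedModType R}.

Lemma cvg_blin {I : Type} (F : set_system I) {FF : Filter F} (A : I -> blin X Y) (x : I -> X)
    (A0 : blin X Y) (x0 : X) :
  A @ F --> A0 -> x @ F --> x0 -> (fun i => A i (x i)) @ F --> A0 x0.
Proof.
move=> AA xx; apply/cvgrPdist_le => e e0.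
have C0 : 0 < `|x0| + 1 by rewrite ltr_wpDl.
have B0 : 0 < `|A0| + 1 by rewrite ltr_wpDl.
have eC : 0 < e / 2 / (`|x0| + 1) by rewrite !divr_gt0.
have eB : 0 < e / 2 / (`|A0| + 1) by rewrite !divr_gt0.
near=> i.
have h1 : `|A i - A0| <= e / 2 / (`|x0| + 1).
  by near: i; apply: cvgr_distC_le.
have h2 : `|x i - x0| <= e / 2 / (`|A0| + 1).
  by near: i; apply: cvgr_distC_le.
have h3 : `|x i - x0| <= 1 by near: i; apply: cvgr_distC_le.
rewrite distrC -(subrKA (A0 (x i))) (le_trans (ler_normD _ _))//.
have k1 : `|A i (x i) - A0 (x i)| <= e / 2.
  apply: le_trans (opnormP (A i - A0) (x i)) _.
  have xi : `|x i| <= `|x0| + 1.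
    by rewrite -[x i](subrK x0) (le_trans (ler_normD _ _))// addrC lerD2l.
  by apply: le_trans (ler_pM _ _ h1 xi) _ => //; rewrite ?opnorm_ge0// divfK// gt_eqF.
have k2 : `|A0 (x i) - A0 x0| <= e / 2.
  rewrite -raddfB; apply: le_trans (opnormP A0 _) _; rewrite mulrC.
  have A01 : opnorm A0 <= `|A0| + 1 by rewrite lerDl.
  by apply: le_trans (ler_pM _ _ h2 A01) _ => //; rewrite ?opnorm_ge0// divfK// gt_eqF.
by move: k1 k2; lra.
Unshelve. all: by end_near. Qed.

Lemma blin_continuous (f : blin X Y) : continuous f.
Proof. by move=> x; apply: (@cvg_blin _ (nbhs x) _ (fun=> f) id) => //; exact: cvg_cst. Qed.

Lemma opnorm_comp (g : blin Y Z) (f : blin X Y) : `|blin_comp g f| <= `|g| * `|f|.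
Proof.
apply: opnorm_le => x x1; apply: le_trans (opnormP g (f x)) _.
by rewrite ler_wpM2l ?opnorm_ge0// opnorm_ge.
Qed.

Lemma cvg_blin_comp {I : Type} (F : set_system I) {FF : Filter F}
    (G : I -> blin Y Z) (A : I -> blin X Y)
    (G0 : blin Y Z) (A0 : blin X Y) :
  G @ F --> G0 -> A @ F --> A0 -> (fun i => blin_comp (G i) (A i)) @ F --> blin_comp G0 A0.
Proof.
move=> GG AA; apply/cvgrPdist_le => e e0.
have C0 : 0 < `|A0| + 1 by rewrite ltr_wpDl.
have B0 : 0 < `|G0| + 1 by rewrite ltr_wpDl.
have eC : 0 < e / 2 / (`|A0| + 1) by rewrite !divr_gt0.
have eB : 0 < e / 2 / (`|G0| + 1) by rewrite !divr_gt0.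
near=> i.
have h1 : `|G i - G0| <= e / 2 / (`|A0| + 1).
  by near: i; apply: cvgr_distC_le.
have h2 : `|A i - A0| <= e / 2 / (`|G0| + 1).
  by near: i; apply: cvgr_distC_le.
have h3 : `|A i - A0| <= 1 by near: i; apply: cvgr_distC_le.
rewrite distrC; have -> : blin_comp (G i) (A i) - blin_comp G0 A0 =
    blin_comp (G i - G0) (A i) + blin_comp G0 (A i - A0).
  apply/val_inj/funext => x.
  change (G i (A i x) - G0 (A0 x) = G i (A i x) - G0 (A i x) + G0 (A i x - A0 x)).
  by rewrite raddfB addrA subrK.
rewrite (le_trans (ler_normD _ _))//.
have k1 : `|blin_comp (G i - G0) (A i)| <= e / 2.
  apply: le_trans (opnorm_comp _ _) _.
  have Ai : `|A i| <= `|A0| + 1.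
    by rewrite -[A i](subrK A0) (le_trans (ler_normD _ _))// addrC lerD2l.
  by apply: le_trans (ler_pM _ _ h1 Ai) _ => //; rewrite divfK// gt_eqF.
have k2 : `|blin_comp G0 (A i - A0)| <= e / 2.
  apply: le_trans (opnorm_comp _ _) _; rewrite mulrC.
  have G01 : `|G0| <= `|G0| + 1 by rewrite lerDl.
  by apply: le_trans (ler_pM _ _ h2 G01) _ => //; rewrite divfK// gt_eqF.
by move: k1 k2; lra.
Unshelve. all: by end_near. Qed.

End BlinContinuity.

Section GateauxMax.
Context {R : realType} {X Y : normedModType R}.

(** Fermat's rule: the derivative is nonpositive in the directions [h] and [- h]. It yields the
    linear relation contradicting hypothesis (e) when [theta = 0]. *)
Lemma gateaux_max_eq0 (phi : X -> Y) (u : X) (U : set X) (p : blin Y R^o) :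
  nbhs u U -> gateaux_differentiable phi u ->
  (forall zeta, U zeta -> p (phi zeta) <= p (phi u)) -> blin_comp p (Dgateaux phi u) = 0.
Proof.
move=> /normed_nbhs[e e0 eU] [D0 phiD0] pmax.
have phiD : is_gateaux phi u (Dgateaux phi u) by apply: (xgetPex 0); exists D0.
have le0 h : p (Dgateaux phi u h) <= 0.
  have := cvg_comp _ _ (phiD h) (@blin_continuous _ _ _ p (Dgateaux phi u h)).
  move=> /cvgr_to_le; apply.
  have h0 : 0 < `|h| + 1 by rewrite ltr_wpDl.
  apply/at_right_dist; exists (e / (`|h| + 1)); first by rewrite divr_gt0.
  move=> t /=; rewrite add0r => /andP[t0 te].
  rewrite linearZ raddfB /= [_ *: _]mulrC pmulr_lle0 ?invr_gt0// subr_le0.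
  apply: pmax; apply: eU; rewrite addrC addKr normrZ gtr0_norm//.
  move: te; rewrite ltr_pdivlMr//; apply: le_lt_trans.
  by rewrite ler_wpM2l ?(ltW t0)// lerDl.
apply/val_inj/funext => h; apply/le_anti; apply/andP; split; first exact: le0.
by have := le0 (- h); rewrite !raddfN oppr_le0.
Qed.

End GateauxMax.

(** * Open sets of exceptional times and their measure *)

Section SmallOpenSets.
Context {R : realType}.
Let mu := @lebesgue_measure R.

(* [m t] is the measure of the part of [E] before [t]. *)
Lemma open_set_clock (E : set R) (T kap : R) : open E -> E `<=` `[0, T] ->
  (mu E < kap%:E)%E -> 0 <= T ->
  exists m : R -> R, [/\ continuous m, {homo m : x y / x <= y}, m T - m 0 <= kap &
    forall t, E t -> \forall s \near t^'+, s - t <= m s - m t].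
Proof.
move=> Eo ET Ekap T0.
have Em : measurable E by exact: measurable_realfun.open_measurable.
have fin (A : set R) : measurable A -> mu (E `&` A) \is a fin_num.
  move=> Am; apply/fin_numPlt; rewrite (@lt_le_trans _ _ 0%E)//=.
  rewrite (le_lt_trans _ (ltry kap))// ltW// (le_lt_trans _ Ekap)//.
  by apply: le_measure; rewrite ?inE//; exact: measurableI.
pose m t := fine (mu (E `&` `]-oo, t])).
have mB s t : s <= t -> m t - m s = fine (mu (E `&` `]s, t])).
  move=> st; apply/eqP; rewrite subr_eq -fineD ?fin//; apply/eqP; congr fine.
  rewrite -measureU; first by rewrite -setIUr setUC -itv_bndbnd_setU// bnd_simp.
  - exact: measurableI.
  - exact: measurableI.
  - rewrite -setIIr [X in _ `&` X](_ : _ = set0) ?setI0//.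
    by apply/seteqP; split => // x [/=]; rewrite !in_itv /= => /andP[sx _] /(lt_le_trans sx); rewrite ltxx.
have itv_mu s t : s <= t -> mu `]s, t] = (t - s)%:E.
  move=> st; rewrite /mu lebesgue_measure_itv /= lte_fin.
  by case: ltP => //; rewrite EFinB; move=> ts; rewrite (@le_anti _ _ s t) ?st// subee.
have mle s t : s <= t -> m t - m s <= t - s.
  move=> st; rewrite mB// -lee_fin fineK ?fin// -itv_mu//.
  by apply: le_measure; rewrite ?inE//; exact: measurableI.
have mono : {homo m : x y / x <= y}.
  by move=> x y xy; rewrite -subr_ge0 mB// fine_ge0.
exists m; split=> //.
- move=> t; apply/cvgrPdist_le => e e0; apply/nbhs_dist; exists e => // s se.
  have [st|/ltW ts] := leP s t.
    rewrite ger0_norm ?subr_ge0 ?mono//; apply: le_trans (mle _ _ st) _.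
    by move: se; rewrite ltr_norml; lra.
  rewrite distrC ger0_norm ?subr_ge0 ?mono//; apply: le_trans (mle _ _ ts) _.
  by move: se; rewrite ltr_norml; lra.
- rewrite mB// -lee_fin fineK ?fin//; apply/ltW; apply: le_lt_trans Ekap.
  by apply: le_measure; rewrite ?inE//; exact: measurableI.
move=> t Et; have /nbhs_dist[e e0 eP] : nbhs t E by apply: open_nbhs_nbhs.
apply/at_right_dist; exists e => // s /andP[ts se].
have -> : m s - m t = s - t.
  rewrite mB ?(ltW ts)// [X in mu X](_ : _ = `]t, s]%classic) ?itv_mu ?(ltW ts)//.
  apply/seteqP; split=> [x []//|x xts]; split=> //; apply: eP.
  by move: xts; rewrite /= in_itv /= => /andP[tx xs]; rewrite gtr0_norm ?subr_gt0//; lra.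
exact: lexx.
Qed.

(** The measures tend to 0 by continuity from above, [[0, T]] having finite measure;
    [open_set_clock] is applied to a set of measure below [kap]. *)
Lemma small_open_sets (E : nat -> set R) (T kap : R) : (forall n, open (E n)) ->
  (forall n, E n `<=` `[0, T]) -> (forall n m, (n <= m)%N -> E m `<=` E n) ->
  (forall t, ~ forall n, E n t) -> 0 <= T -> 0 < kap ->
  exists n (m : R -> R), [/\ continuous m, {homo m : x y / x <= y}, m T - m 0 <= kap &
    forall t, E n t -> \forall s \near t^'+, s - t <= m s - m t].
Proof.
move=> Eo ET Edec Ecap T0 kap0.
have Em n : measurable (E n) by exact: measurable_realfun.open_measurable.
have cap0 : \bigcap_n E n = set0.
  by apply/seteqP; split => // t Et; apply: (Ecap t) => n; exact: Et.
have := @nonincreasing_cvg_mu _ _ _ mu E.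
rewrite cap0 measure0 => H.
have : mu (E n) @[n --> \oo] --> 0%E.
  apply: H => //.
    have le : (mu (E 0%N) <= mu `[0%R, T]%classic)%E by apply: le_measure; rewrite ?inE; [exact: Em|exact: measurable_itv|exact: ET].
    apply: le_lt_trans le _; rewrite /mu lebesgue_measure_itv /=; case: ifP => //= _; exact: ltry.
  by apply/nonincreasing_seqP => n; apply/subsetPset; exact: Edec.
move=> /(_ [set y | (y < kap%:E)%E]).
have nb : nbhs (0%E : \bar R) [set y | (y < kap%:E)%E].
  by apply: open_nbhs_nbhs; split; [exact: open_ereal_lt_ereal|rewrite /= lte_fin].
move=> /(_ nb)[n _ /(_ n (leqnn n)) /= En].
by have [m] := open_set_clock (Eo n) (ET n) En T0; exists n, m.
Qed.

End SmallOpenSets.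

(** * The reference process *)

Section Retraction.
Context {R : realType} {E : normedModType R}.

(* Precomposition with this radial retraction onto a ball makes a locally
   Lipschitz dynamics globally so. *)
Definition retract (a : R) (z : E) : E := (a / Num.max a `|z|) *: z.

Lemma retract_norm a z : 0 < a -> `|retract a z| <= a.
Proof.
move=> a0; have m0 : 0 < Num.max a `|z| by rewrite lt_max a0.
have am : 0 <= a / Num.max a `|z| by rewrite divr_ge0// ltW.
rewrite normrZ ger0_norm// mulrAC ler_pdivrMr// ler_pM2l//.
by rewrite le_max lexx orbT.
Qed.

Lemma retract_id a z : 0 < a -> `|z| <= a -> retract a z = z.
Proof. by move=> a0 za; rewrite /retract max_l// divff ?gt_eqF// scale1r. Qed.

Lemma retract_lip a z w : 0 < a -> `|retract a z - retract a w| <= 2 * `|z - w|.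
Proof.
move=> a0; set m := Num.max a `|z|; set n := Num.max a `|w|.
have m0 : 0 < m by rewrite lt_max a0.
have n0 : 0 < n by rewrite lt_max a0.
have mn : `|n - m| <= `|z - w|.
  have := ler_dist_dist z w; rewrite distrC /n /m.
  have := normr_ge0 (z - w).
  case: (leP a `|w|) => h1; case: (leP a `|z|) => h2; rewrite !ler_norml => ? /andP[? ?].
  - by apply/andP; split; lra.
  - by apply/andP; split; lra.
  - by apply/andP; split; lra.
  - by apply/andP; split; lra.
(* The factor 2 comes from this splitting: the change of vector at fixed scale and the change of
   scale each cost at most [|z - w|]. *)
have -> : retract a z - retract a w = (a / m) *: (z - w) + (a / m * ((n - m) / n)) *: w.
  rewrite /retract -/m -/n scalerBr -addrA; congr (_ + _).
  rewrite -scaleNr -scaleNr -scalerDl; congr (_ *: _); field.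
  by rewrite !gt_eqF.
have am : 0 <= a / m <= 1.
  by rewrite divr_ge0 ?(ltW a0) ?(ltW m0)//= ler_pdivrMr// mul1r le_max lexx.
case/andP: am; move: (a / m) => k k0 k1.
have qw : `|(n - m) / n| * `|w| <= `|z - w|.
  apply: le_trans mn; rewrite normrM normfV [`|n|]gtr0_norm// -mulrA ler_piMr//.
  by rewrite mulrC ler_pdivrMr// mul1r le_max lexx orbT.
apply: le_trans (ler_normD _ _) _.
have -> : 2 * `|z - w| = `|z - w| + `|z - w| by lra.
rewrite lerD// normrZ; first by rewrite ger0_norm// ler_piMl.
rewrite normrM ger0_norm// -mulrA; apply: le_trans qw.
by rewrite ler_piMl// mulr_ge0.
Qed.

End Retraction.

Record process {R : realType} {E : completeNormedModType R} {Y : normedModType R}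
  (T : R) (Omega : set E) (U : set Y) (f : R -> E -> Y -> E) (x0 : R -> E) (u0 : R -> Y) : Prop := {
  pr_T : 0 < T;
  pr_Omega : open Omega;
  pr_x0 : PC1 T Omega x0;
  pr_u0 : NPC0 T U u0;
  pr_ode : forall t, t \in `[0, T] -> ext_deriv T x0 t = f t (x0 t) (u0 t);
  pr_cont : {within [set z : R * E * Y |
      [/\ z.1.1 \in `[0, T], Omega z.1.2 & U z.2]],
    continuous (fun z : R * E * Y => f z.1.1 z.1.2 z.2)};
  pr_gateaux : forall t xi zeta, t \in `[0, T] -> Omega xi -> U zeta ->
    gateaux_differentiable (fun xi' => f t xi' zeta) xi;
  pr_frechet : forall t zeta, t \in `[0, T] -> U zeta ->
    differentiable (fun xi => f t xi zeta) (x0 t);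
  pr_frechet_cont : {within [set z : R * Y | z.1 \in `[0, T] /\ U z.2],
    continuous (fun z : R * Y => Dfrechet (fun xi => f z.1 xi z.2) (x0 z.1))};
  pr_bounded : forall (K : set E) (M : set Y),
    compact K -> K !=set0 -> K `<=` Omega ->
    compact M -> M !=set0 -> M `<=` U ->
    (ereal_sup [set (`|Dgateaux (fun xi => f z.1.1 xi z.2) z.1.2|)%:E
      | z in [set z : R * E * Y | [/\ z.1.1 \in `[0%R, T], K z.1.2 & M z.2]]]
     < +oo)%E }.

Lemma cvg_within_in {I : Type} {S : topologicalType} (F : set_system I) {FF : Filter F}
    (D : set S) (g : I -> S) (l : S) :
  (\forall i \near F, D (g i)) -> g @ F --> l -> g @ F --> within D (nbhs l).
Proof.
move=> FD gl Q; rewrite /within /= => nQ; have := gl _ nQ => FQ.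
by rewrite /fmap /=; apply: filterS2 FD FQ => i Di; apply.
Qed.

Section Tube.
Context {R : realType} {E : completeNormedModType R} {Y : normedModType R}.
Context {T : R} {Omega : set E} {U : set Y} {f : R -> E -> Y -> E} {x0 : R -> E} {u0 : R -> Y}.
Variable P : process T Omega U f x0 u0.

Definition xbar (T : R) (x0 : R -> E) := x0 \o clamp 0 T.
Local Notation X0 := (xbar T x0).

Lemma T_ge0 : 0 <= T. Proof. exact/ltW/(pr_T P). Qed.

Lemma in_itv_le t : (t \in `[0, T]) = (0 <= t <= T). Proof. by rewrite in_itv. Qed.

Lemma xbarE t : 0 <= t <= T -> X0 t = x0 t.
Proof. by move=> tT; rewrite /xbar /= clamp_id// in_itv_le. Qed.

Lemma xbar_continuous : continuous X0.
Proof. by apply: clamp_continuous_within; [exact: T_ge0|have [] := pr_x0 P]. Qed.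

Lemma xbar_Omega t : Omega (X0 t).
Proof. by have [_ _] := pr_x0 P; apply; apply: clamp_itv; exact: T_ge0. Qed.

Lemma u0_U t : 0 <= t <= T -> U (u0 t).
Proof. by move=> tT; have [[u0U _] _ _] := pr_u0 P; apply: u0U; rewrite in_itv_le. Qed.

Lemma u0_right t : 0 <= t < T -> u0 s @[s --> t^'+] --> u0 t.
Proof. by move=> tT; have [_ ur _] := pr_u0 P; apply: ur; rewrite in_itv. Qed.

Lemma u0_left : u0 s @[s --> T^'-] --> u0 T.
Proof. by have [] := pr_u0 P. Qed.

Lemma u0_pcont : exists Fs, pcont U Fs 0 T u0.
Proof.
have [[u0U [s sP]] _ _] := pr_u0 P; exists s; apply: pcont_of_along sP => t /andP[t0 tT].
by apply: u0U; rewrite in_itv_le !ltW.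
Qed.

Lemma xbar_derive : exists Fs : seq R, forall t, 0 < t < T -> t \notin Fs ->
  is_derive t 1 X0 (f t (X0 t) (u0 t)).
Proof.
have [_ x0C _] := pr_x0 P; have [_ _ [Fs FsP]] := ext_derivP (pr_T P) x0C.
exists Fs => t tT tF; have t01 : 0 <= t <= T by case/andP: tT => *; rewrite !ltW.
apply: is_derive_clamp => //; rewrite xbarE// -(pr_ode P) ?in_itv_le//.
by have [] := FsP t tT tF.
Qed.

Lemma f_cvg {I : Type} (F : set_system I) {FF : Filter F} (tau : I -> R) (xi : I -> E)
    (zeta : I -> Y) t x z :
  (\forall i \near F, [/\ 0 <= tau i <= T, Omega (xi i) & U (zeta i)]) ->
  tau @ F --> t -> xi @ F --> x -> zeta @ F --> z ->
  0 <= t <= T -> Omega x -> U z ->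
  (fun i => f (tau i) (xi i) (zeta i)) @ F --> f t x z.
Proof.
move=> dom tt xx zz tT xO zU.
have fc := (subspace_continuousP _ _).1 (pr_cont P) (t, x, z).
have /fc : [set z : R * E * Y | [/\ z.1.1 \in `[0, T], Omega z.1.2 & U z.2]] (t, x, z).
  by split; rewrite //= in_itv_le.
apply: (@cvg_comp _ _ _ (fun i => (tau i, xi i, zeta i))
  (fun z : R * E * Y => f z.1.1 z.1.2 z.2)).
apply: cvg_within_in; last exact: (cvg_pair (cvg_pair tt xx) zz).
by apply: filterS dom => i []; rewrite -in_itv_le.
Qed.

Lemma D_cvg {I : Type} (F : set_system I) {FF : Filter F} (tau : I -> R) (zeta : I -> Y) t z :
  (\forall i \near F, 0 <= tau i <= T /\ U (zeta i)) ->
  tau @ F --> t -> zeta @ F --> z -> 0 <= t <= T -> U z ->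
  (fun i => Dfrechet (fun xi => f (tau i) xi (zeta i)) (x0 (tau i))) @ F -->
    Dfrechet (fun xi => f t xi z) (x0 t).
Proof.
move=> dom tt zz tT zU.
have fc := (subspace_continuousP _ _).1 (pr_frechet_cont P) (t, z).
have /fc : [set z : R * Y | z.1 \in `[0, T] /\ U z.2] (t, z) by split; rewrite //= in_itv_le.
apply: (@cvg_comp _ _ _ (fun i => (tau i, zeta i))
  (fun z : R * Y => Dfrechet (fun xi => f z.1 xi z.2) (x0 z.1))).
apply: cvg_within_in; last exact: (cvg_pair tt zz).
by apply: filterS dom => i []; rewrite -in_itv_le.
Qed.

Definition Alin t := Dfrechet (fun xi => f t xi (u0 t)) (x0 t).

Lemma near_itv_right t : 0 <= t < T -> \forall s \near t^'+, 0 <= s <= T.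
Proof.
move=> /andP[t0 tT]; have := near_right_notin [::] tT; apply: filterS => s [/andP[ts sT] _].
by rewrite (le_trans t0) ?ltW.
Qed.

Lemma near_itv_left t : 0 < t <= T -> \forall s \near t^'-, 0 <= s <= T.
Proof.
move=> /andP[t0 tT]; have := near_left_notin [::] t0; apply: filterS => s [/andP[ts sT] _].
by rewrite ltW//= (le_trans _ tT)// ltW.
Qed.

Lemma near_itv t : 0 < t < T -> \forall s \near t, 0 <= s <= T.
Proof.
move=> tT; have := near_open_notin tT (Fs := [::]) isT; apply: filterS => s [/andP[ts sT] _].
by rewrite !ltW.
Qed.

Lemma cvg_id_at_right t : (fun s : R => s) @ t^'+ --> t.
Proof. by apply: cvg_within_filter; exact: cvg_id. Qed.

Lemma cvg_id_at_left t : (fun s : R => s) @ t^'- --> t.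
Proof. by apply: cvg_within_filter; exact: cvg_id. Qed.

Lemma Alin_right t : 0 <= t < T -> Alin s @[s --> t^'+] --> Alin t.
Proof.
move=> /[dup] tT /andP[t0 t1]; have t01 : 0 <= t <= T by rewrite t0 ltW.
apply: D_cvg; [|exact: cvg_id_at_right|exact: u0_right|by []|exact: u0_U].
by apply: filterS (near_itv_right tT) => s sT; split=> //; exact: u0_U.
Qed.

Lemma Alin_left : Alin s @[s --> T^'-] --> Alin T.
Proof.
have TT : 0 <= T <= T by rewrite T_ge0 lexx.
have TT' : 0 < T <= T by rewrite (pr_T P) lexx.
apply: D_cvg; [|exact: cvg_id_at_left|exact: u0_left|by []|exact: u0_U].
by apply: filterS (near_itv_left TT') => s sT; split=> //; exact: u0_U.
Qed.

Lemma Alin_pcont Fs : pcont U Fs 0 T u0 -> pcont setT Fs 0 T Alin.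
Proof.
move=> [uc ur ul]; split=> t /andP[t0 tT].
- move=> tF; have tT' : 0 < t < T by rewrite t0.
  have t01 : 0 <= t <= T by rewrite !ltW.
  apply: D_cvg; [|exact: cvg_id|exact: uc|by []|exact: u0_U].
  by apply: filterS (near_itv tT') => s sT; split=> //; exact: u0_U.
- have tT' : 0 <= t < T by rewrite t0.
  by exists (Alin t) => //; exact: Alin_right.
- have tT' : 0 < t <= T by rewrite t0.
  have [|y yU uy] := ul t; first by rewrite t0.
  exists (Dfrechet (fun xi => f t xi y) (x0 t)) => //.
  apply: D_cvg; [|exact: cvg_id_at_left|exact: uy| |by []]; last by rewrite ltW.
  by apply: filterS (near_itv_left tT') => s sT; split=> //; exact: u0_U.
Qed.

Lemma pcont_bounded (V : normedModType R) (v : R -> V) Fs : pcont setT Fs 0 T v ->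
  exists2 B, 0 <= B & forall t, 0 <= t <= T -> `|v t| <= B.
Proof.
move=> vp; have [M [Mc _ Mv]] := pcont_compact T_ge0 (fun _ _ => I) vp.
have [B [Br BP]] := compact_bounded Mc.
exists (`|B| + 1) => [|t tT]; first by rewrite addr_ge0.
by apply: (BP (`|B| + 1)); [rewrite ltr_pwDr// ler_norm|exact: Mv].
Qed.

(** Hypothesis (b) bounds derivatives on compact sets only, while a tube in infinite dimension is
    not relatively compact. If the bound failed in all tubes, counterexamples would approach the
    trajectory, and with it form a compact set on which (b) does apply. *)
Lemma dgateaux_tube (M : set Y) : compact M -> M !=set0 -> M `<=` U ->
  exists r L : R, [/\ 0 < r, 0 < L,
    forall t x, 0 <= t <= T -> `|x - X0 t| < r -> Omega x &
    forall t x z, 0 <= t <= T -> M z -> `|x - X0 t| < r ->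
      `|Dgateaux (fun xi => f t xi z) x| <= L].
Proof.
move=> Mc M0 MU.
pose K := X0 @` `[0, T].
have Kc : compact K.
  apply: continuous_compact; last exact: segment_compact.
  by apply: continuous_subspaceT; exact: xbar_continuous.
have KX t : 0 <= t <= T -> K (X0 t) by move=> tT; exists t; rewrite //= in_itv_le.
have KO : K `<=` Omega by move=> _ [t _ <-]; exact: xbar_Omega.
have [r0 r00 r0P] := compact_thicken Kc (pr_Omega P) KO.
apply: contrapT => nex.
have /choice[p pP] : forall n : nat, exists p : R * E * Y,
   [/\ 0 <= p.1.1 <= T, M p.2, `|p.1.2 - X0 p.1.1| < Num.min r0 n.+1%:R^-1 &
    n.+1%:R < `|Dgateaux (fun xi => f p.1.1 xi p.2) p.1.2|].
  move=> n; apply: contrapT => np; apply: nex.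
  have n0 : 0 < n.+1%:R^-1 :> R by rewrite invr_gt0.
  exists (Num.min r0 n.+1%:R^-1), n.+1%:R; split => //.
  - by rewrite lt_min r00 n0.
  - move=> t x tT; rewrite lt_min => /andP[xr _]; apply: r0P xr; exact: KX.
  - move=> t x z tT zM xr; rewrite leNgt; apply/negP => lt.
    by apply: np; exists (t, x, z).
have K'c : compact (K `|` range (fun n => (p n).1.2)).
  apply: (compact_add_seq (kap := fun n => X0 (p n).1.1) Kc) => [n|e e0].
    by apply: KX; have [] := pP n.
  have := near_infty_natSinv_lt (PosNum e0); apply: filterS => n /=; apply: lt_trans.
  by have [_ _ + _] := pP n; rewrite lt_min => /andP[].
have K'O : K `|` range (fun n => (p n).1.2) `<=` Omega.
  move=> x [/KO//|[n _ <-]]; have [tT _ + _] := pP n; rewrite lt_min => /andP[xr _].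
  by apply: r0P xr; exact: KX.
have K'0 : K `|` range (fun n => (p n).1.2) !=set0.
  by exists (X0 0); left; apply: KX; rewrite lexx T_ge0.
have := pr_bounded P K'c K'0 K'O Mc M0 MU.
set S := ereal_sup _ => SOO.
have SP n : ((n.+1%:R)%:E < S)%E.
  have [tT zM xr lt] := pP n; apply: lt_le_trans (_ : (`|Dgateaux (fun xi => f (p n).1.1 xi (p n).2) (p n).1.2|%:E) <= S)%E.
    by rewrite lte_fin.
  apply: ereal_sup_ubound; exists (p n) => //; split=> //=.
  by right; exists n.
have [s Ss] : exists s, S = s%:E.
  move: SOO (SP 0%N); case: (S) => [s _ _|//|//]; first by exists s.
have /archi_boundP : 0 <= `|s| by [].
have := SP (Num.bound `|s|); rewrite Ss lte_fin => h1 h2.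
have := lt_trans h1 (le_lt_trans (ler_norm s) h2).
by rewrite ltr_nat ltnNge leqnSn.
Qed.

Lemma f_bounded_on (M : set Y) : compact M -> M `<=` U ->
  exists2 B, 0 <= B & forall t z, 0 <= t <= T -> M z -> `|f t (X0 t) z| <= B.
Proof.
move=> Mc MU; pose K := `[0, T]%classic `*` M.
have Kc : compact K by apply: compact_setX => //; exact: segment_compact.
have fK : compact ((fun z : R * Y => f z.1 (X0 z.1) z.2) @` K).
  apply: continuous_compact => //; apply/subspace_continuousP => -[t z] [/= tT zM].
  apply: f_cvg.
  - rewrite near_withinE; apply: nearW => -[t' z'] [/= t'T z'M]; split.
    + by rewrite -in_itv_le.
    + exact: xbar_Omega.
    + exact: MU.
  - by apply: cvg_within_filter; exact: cvg_fst.
  - apply: (@cvg_comp _ _ _ (fun z : R * Y => z.1) X0 _ (nbhs t)); last exact: xbar_continuous.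
    by apply: cvg_within_filter; exact: cvg_fst.
  - by apply: cvg_within_filter; exact: cvg_snd.
  - by rewrite -in_itv_le.
  - exact: xbar_Omega.
  - exact: MU.
have [B [Br BP]] := compact_bounded fK.
exists (`|B| + 1) => [|t z tT zM]; first by rewrite addr_ge0.
apply: (BP (`|B| + 1)); first by rewrite ltr_pwDr// ler_norm.
by exists (t, z) => //; split=> //=; rewrite in_itv_le.
Qed.

End Tube.

Section LinearEquations.
Context {R : realType}.

Lemma linear_ode {Z : completeNormedModType R} (A : R -> blin Z Z) (Fs : seq R) T (z0 : Z) :
  0 <= T -> pcont setT Fs 0 T A ->
  exists y : R -> Z, [/\ continuous y, y 0 = z0 &
    forall t, 0 < t < T -> t \notin Fs -> is_derive t 1 y (A t (y t))].
Proof.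
move=> T0 Ap.
have [M [Mc _ Mv]] := pcont_compact T0 (fun _ _ => I) Ap.
have [C [Cr CP]] := compact_bounded Mc.
have C0 : 0 < `|C| + 1 by rewrite ltr_wpDl.
apply: (@picard _ _ (fun t z => A t z) Fs T (`|C| + 1)) => //.
  move=> t x y /andP[t0 tT]; rewrite -raddfB; apply: le_trans (opnormP _ _) _.
  rewrite ler_wpM2r//; apply: (CP (`|C| + 1)); first by rewrite ltr_pwDr// ler_norm.
  by apply: Mv; rewrite !ltW.
move=> x xc; have [Ac Ar Al] := Ap; split=> t tT.
- by move=> tF; apply: cvg_blin; [exact: Ac|exact: xc].
- have [B _ AB] := Ar t tT; exists (B (x t)) => //.
  by apply: cvg_blin => //; exact: (cvg_right_of_continuous (xc t)).
- have [B _ AB] := Al t tT; exists (B (x t)) => //.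
  by apply: cvg_blin => //; exact: (cvg_left_of_continuous (xc _)).
Qed.

Lemma linear_ode_comp {E : completeNormedModType R} (A : R -> blin E E) (Fs : seq R) T
    (p0 : blin E R^o) : 0 <= T -> pcont setT Fs 0 T A ->
  exists p : R -> blin E R^o, [/\ continuous p, p 0 = p0 &
    forall t, 0 < t < T -> t \notin Fs -> is_derive t 1 p (blin_comp (p t) (A t))].
Proof.
move=> T0 Ap.
have [M [Mc _ Mv]] := pcont_compact T0 (fun _ _ => I) Ap.
have [C [Cr CP]] := compact_bounded Mc.
have C0 : 0 < `|C| + 1 by rewrite ltr_wpDl.
apply: (@picard _ (blin E R^o) (fun t z => blin_comp z (A t)) Fs T (`|C| + 1)) => //.
  move=> t x y /andP[t0 tT].
  have -> : blin_comp x (A t) - blin_comp y (A t) = blin_comp (x - y) (A t) by apply/val_inj.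
  apply: le_trans (opnorm_comp _ _) _; rewrite mulrC ler_wpM2r//.
  apply: (CP (`|C| + 1)); first by rewrite ltr_pwDr// ler_norm.
  by apply: Mv; rewrite !ltW.
move=> x xc; have [Ac Ar Al] := Ap; split=> t tT.
- by move=> tF; apply: cvg_blin_comp; [exact: xc|exact: Ac].
- have [B _ AB] := Ar t tT; exists (blin_comp (x t) B) => //.
  by apply: cvg_blin_comp => //; exact: (cvg_right_of_continuous (xc t)).
- have [B _ AB] := Al t tT; exists (blin_comp (x t) B) => //.
  by apply: cvg_blin_comp => //; exact: (cvg_left_of_continuous (xc _)).
Qed.

End LinearEquations.

Section Dynamics.
Context {R : realType} {E : completeNormedModType R} {Y : normedModType R}.
Context {T : R} {Omega : set E} {U : set Y} {f : R -> E -> Y -> E} {x0 : R -> E} {u0 : R -> Y}.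
Variable P : process T Omega U f x0 u0.
Local Notation X0 := (xbar T x0).

Record tube (M : set Y) (a L B : R) : Prop := {
  tube_M : M `<=` U;
  tube_a : 0 < a;
  tube_L : 0 < L;
  tube_B : 0 <= B;
  tube_in : forall t w, 0 <= t <= T -> `|w| <= a -> Omega (X0 t + w);
  tube_lip : forall t w w' z, 0 <= t <= T -> M z -> `|w| <= a -> `|w'| <= a ->
    `|f t (X0 t + w) z - f t (X0 t + w') z| <= L * `|w - w'|;
  tube_bound : forall t w z, 0 <= t <= T -> M z -> `|w| <= a -> `|f t (X0 t + w) z| <= B }.

(** Balls are convex, so the bound on Gateaux differentials is a Lipschitz constant. The radius is
    halved so that closed balls fit into the open tube of [dgateaux_tube]. *)
Lemma exists_tube (M : set Y) : compact M -> M !=set0 -> M `<=` U ->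
  exists a L B, tube M a L B.
Proof.
move=> Mc M0 MU; have [r [L [r0 L0 rO rL]]] := dgateaux_tube P Mc M0 MU.
have [B B0 BP] := f_bounded_on P Mc MU.
have lip t w w' z : 0 <= t <= T -> M z -> `|w| <= r / 2 -> `|w'| <= r / 2 ->
    `|f t (X0 t + w) z - f t (X0 t + w') z| <= L * `|w - w'|.
  move=> tT zM wr w'r.
  have := @gateaux_lipschitz _ _ _ (fun xi => f t xi z) (fun x => `|x - X0 t| < r) L
    (X0 t + w') (X0 t + w).
  rewrite opprD addrACA subrr add0r; apply => [s /andP[s0 s1]|x xr].
    rewrite -[X0 t + w' + _]addrA [X0 t + _ - _]addrAC subrr add0r.
    have -> : w' + s *: (w - w') = (1 - s) *: w' + s *: w.
      by rewrite scalerBr scalerBl scale1r addrA addrAC.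
    apply: le_lt_trans (ler_normD _ _) _; rewrite !normrZ.
    rewrite ger0_norm ?subr_ge0// ger0_norm//.
    have h1 : (1 - s) * `|w'| <= (1 - s) * (r / 2) by rewrite ler_wpM2l// subr_ge0.
    have h2 : s * `|w| <= s * (r / 2) by rewrite ler_wpM2l.
    lra.
  split; last exact: rL.
  by apply: (pr_gateaux P); [rewrite in_itv|exact: rO xr|exact: MU].
exists (r / 2), L, (B + L * (r / 2)); split=> //; first by lra.
- by rewrite addr_ge0// mulr_ge0; lra.
- by move=> t w tT wr; apply: (rO t) => //; rewrite addrAC subrr add0r; lra.
move=> t w z tT zM wr; rewrite -[f _ _ _](subrK (f t (X0 t + 0) z)).
rewrite (le_trans (ler_normD _ _))// addrC lerD//; first by rewrite addr0 BP.
apply: le_trans (lip t w 0 z tT zM wr _) _; first by rewrite normr0; lra.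
by rewrite subr0 ler_wpM2l// ltW.
Qed.

Section InTube.
Variables (M : set Y) (a L B : R).
Hypothesis HM : tube M a L B.

Definition Fm t x z := f t (X0 t + retract a (x - X0 t)) z.

Lemma Fm_lip t x y z : 0 <= t <= T -> M z -> `|Fm t x z - Fm t y z| <= 2 * L * `|x - y|.
Proof.
move=> tT zM; apply: le_trans (tube_lip HM tT zM _ _) _.
- exact/retract_norm/(tube_a HM).
- exact/retract_norm/(tube_a HM).
rewrite [2 * L]mulrC -mulrA ler_wpM2l ?(ltW (tube_L HM))//.
apply: le_trans (retract_lip _ _ (tube_a HM)) _.
by rewrite opprB addrA subrK.
Qed.

Lemma Fm_bound t x z : 0 <= t <= T -> M z -> `|Fm t x z| <= B.
Proof. by move=> tT zM; apply: (tube_bound HM) => //; exact/retract_norm/(tube_a HM). Qed.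

Lemma Fm_id t x z : `|x - X0 t| <= a -> Fm t x z = f t x z.
Proof. by move=> xa; rewrite /Fm retract_id// ?(tube_a HM)// subrKC. Qed.

Definition is_traj (u : R -> Y) (Fs : seq R) (x : R -> E) :=
  [/\ continuous x, x 0 = x0 0 &
   forall t, 0 < t < T -> t \notin Fs -> is_derive t 1 x (Fm t (x t) (u t))].

Lemma retract_continuous : continuous (retract a : E -> E).
Proof.
move=> z; apply/cvgrPdist_le => e e0; apply/normed_nbhs; exists (e / 2); first by lra.
move=> y yz; apply: le_trans (retract_lip _ _ (tube_a HM)) _.
by rewrite distrC; lra.
Qed.

Lemma Fm_cvg {I : Type} (F : set_system I) {FF : Filter F} (tau : I -> R) (xi : I -> E)
    (zeta : I -> Y) t x z :
  (\forall i \near F, 0 <= tau i <= T /\ U (zeta i)) ->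
  tau @ F --> t -> xi @ F --> x -> zeta @ F --> z ->
  0 <= t <= T -> U z ->
  (fun i => Fm (tau i) (xi i) (zeta i)) @ F --> Fm t x z.
Proof.
move=> dom tt xx zz tT zU.
have Xt : (fun i => X0 (tau i)) @ F --> X0 t.
  by apply: (@cvg_comp _ _ _ tau X0 _ (nbhs t)) => //; exact: (xbar_continuous P).
apply: (f_cvg P) => //.
- apply: filterS dom => i [h1 h2]; split=> //.
  by apply: (tube_in HM) => //; exact/retract_norm/(tube_a HM).
- apply: cvgD => //.
  apply: (@cvg_comp _ _ _ (fun i => xi i - X0 (tau i)) (retract a) _ (nbhs (x - X0 t))).
    exact: cvgB.
  exact: retract_continuous.
- by apply: (tube_in HM) => //; exact/retract_norm/(tube_a HM).
Qed.

Lemma exists_traj u Fs : pcont U Fs 0 T u -> (forall t, 0 <= t <= T -> M (u t)) ->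
  exists x, is_traj u Fs x.
Proof.
move=> [uc ur ul] uM; have T0 := T_ge0 P.
have uU t : 0 <= t <= T -> U (u t) by move=> /uM /(tube_M HM).
apply: (@picard _ _ (fun t x => Fm t x (u t)) Fs T (2 * L)) => //.
- by rewrite mulr_gt0// (tube_L HM).
- by move=> t x y /andP[t0 tT]; apply: Fm_lip; [|apply: uM]; rewrite !ltW.
move=> x xc; split=> t /[dup] tT /andP[t0 t1].
- move=> tF; have t01 : 0 <= t <= T by rewrite !ltW.
  apply: (@Fm_cvg _ (nbhs t) _ id x u); [|exact: cvg_id|exact: xc|exact: uc|by []|exact: uU].
  by apply: filterS (near_itv tT) => s sT; split=> //; exact: uU.
- have t01 : 0 <= t <= T by rewrite t0 ltW.
  have [y yU uy] := ur t tT; exists (Fm t (x t) y) => //.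
  apply: (@Fm_cvg _ (t^'+) _ id x u); [|exact: cvg_id_at_right|exact: (cvg_right_of_continuous (xc t))|by []|by []|by []].
  by apply: filterS (near_itv_right tT) => s sT; split=> //; exact: uU.
- have t01 : 0 <= t <= T by rewrite ltW.
  have [y yU uy] := ul t tT; exists (Fm t (x t) y) => //.
  apply: (@Fm_cvg _ (t^'-) _ id x u); [|exact: cvg_id_at_left|exact: (cvg_left_of_continuous (xc _))|by []|by []|by []].
  by apply: filterS (near_itv_left tT) => s sT; split=> //; exact: uU.
Qed.

(** At equal controls the velocities differ by at most [2 * L] times the distance. Where the
    controls differ, an extra [2 * B] is enough, velocities being bounded by [B], and [G] pays for
    it. *)
Lemma stability u v Fs x y (G : R -> R) : is_traj u Fs x -> is_traj v Fs y ->
  (forall t, 0 <= t <= T -> M (u t)) -> (forall t, 0 <= t <= T -> M (v t)) ->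
  continuous G -> {homo G : s t / s <= t} ->
  (forall t, 0 < t < T -> t \notin Fs -> u t = v t \/
     \forall s \near t^'+, 2 * B * (s - t) <= G s - G t) ->
  forall t, 0 <= t <= T -> `|x t - y t| <= expR (2 * L * T) * (G T - G 0).
Proof.
move=> [xc xi xd] [yc yi yd] uM vM Gc Gm HG t /andP[t0 tT].
have L0 : 0 <= 2 * L by rewrite mulr_ge0// ltW// (tube_L HM).
have GG : 0 <= G T - G 0 by rewrite subr_ge0 Gm// (T_ge0 P).
have := @gronwall _ _ (x - y) G Fs 0 t (2 * L) t0 L0.
rewrite !fctE subr0 xi yi subrr normr0 add0r => H.
apply: le_trans (H _ Gc Gm _) _; first by move=> s; apply: cvgB; [exact: xc|exact: yc].
  move=> s /andP[s0 st] sF; have sT : 0 < s < T by rewrite s0 (lt_le_trans st).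
  have s01 : 0 <= s <= T by case/andP: sT => *; rewrite !ltW.
  have dxy := is_deriveB (xd s sT sF) (yd s sT sF).
  have d1 : `|Fm s (x s) (u s) - Fm s (y s) (u s)| <= 2 * L * `|x s - y s|.
    by apply: Fm_lip => //; exact: uM.
  have [uv|uG] := HG s sT sF.
    exists 0; split; last by apply: filterS (near_right_notin [::] (ltr_pwDr ltr01 (lexx s))) =>
      r [/andP[/ltW sr _] _]; rewrite mul0r subr_ge0 Gm.
    move=> eta eta0; rewrite addr0; apply: is_derive_right_growth dxy _ _ eta0.
    by rewrite -uv.
  exists (2 * B); split=> // eta eta0; apply: is_derive_right_growth dxy _ _ eta0.
  rewrite -(subrKA (Fm s (y s) (u s))) (le_trans (ler_normD _ _))// lerD//.
  apply: le_trans (ler_normB _ _) _; rewrite mulr2n mulrDl mul1r lerD// Fm_bound//.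
    exact: uM.
  exact: vM.
apply: ler_pM; rewrite ?expR_ge0 ?subr_ge0 ?Gm// ?lerD2r ?Gm//.
by rewrite ler_expR ler_wpM2l.
Qed.

Lemma xbar_traj : exists Fs : seq R, forall Fs' : seq R, {subset Fs <= Fs'} -> is_traj u0 Fs' X0.
Proof.
have [Fs FsP] := xbar_derive P; exists Fs => Fs' sub; split.
- exact: (xbar_continuous P).
- by rewrite (xbarE (x0 := x0))// lexx (T_ge0 P).
move=> t tT tF; rewrite Fm_id; last by rewrite subrr normr0 ltW// (tube_a HM).
by apply: FsP => //; apply: contra tF; exact: sub.
Qed.

Lemma traj_admissible u Fs x : NPC0 T U u -> pcont U Fs 0 T u -> is_traj u Fs x ->
  (forall t, 0 <= t <= T -> `|x t - X0 t| <= a) ->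
  PC1 T Omega x /\ forall t, t \in `[0, T] -> ext_deriv T x t = f t (x t) (u t).
Proof.
move=> [[uU _] urc ulc] [uc ur ul] [xc xi xd] xa.
have T0 := pr_T P; have T0' := T_ge0 P.
have uU' t : 0 <= t <= T -> U (u t) by move=> tT; apply: uU; rewrite in_itv.
have xO t : 0 <= t <= T -> Omega (x t).
  by move=> tT; rewrite -(subrKC (X0 t) (x t)); apply: (tube_in HM) => //; exact: xa.
have cvgF (F : set_system R) (FF : Filter F) t z : 0 <= t <= T -> U z ->
    (\forall s \near F, 0 <= s <= T) -> (fun s : R => s) @ F --> t -> x @ F --> x t -> u @ F --> z ->
    (fun s => f s (x s) (u s)) @ F --> f t (x t) z.
  move=> tT zU FT tt xx uz; apply: (f_cvg P) => //; last exact: xO.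
  by apply: filterS FT => s sT; split=> //; [exact: xO|exact: uU'].
apply: (@PC1_intro _ _ T Omega Fs x (fun t => f t (x t) (u t))) => //.
- by apply: continuous_subspaceT.
- split=> t /[dup] tT /andP[t0 t1].
  + move=> tF; have t01 : 0 <= t <= T by rewrite !ltW.
    apply: (cvgF (nbhs t) _ t (u t)); [by []|exact: uU'|exact: near_itv|exact: cvg_id|exact: xc|exact: uc].
  + have t01 : 0 <= t <= T by rewrite t0 ltW.
    have [y yU uy] := ur t tT; exists (f t (x t) y) => //.
    apply: (cvgF (t^'+) _ t y); [by []|by []|exact: near_itv_right|exact: cvg_id_at_right|exact: (cvg_right_of_continuous (xc t))|by []].
  + have t01 : 0 <= t <= T by rewrite ltW.
    have [y yU uy] := ul t tT; exists (f t (x t) y) => //.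
    apply: (cvgF (t^'-) _ t y); [by []|by []|exact: near_itv_left|exact: cvg_id_at_left|exact: (cvg_left_of_continuous (xc _))|by []].
- move=> t tT tF; rewrite -Fm_id; first exact: xd.
  by apply: xa; case/andP: tT => *; rewrite !ltW.
- move=> t /[dup] tT /andP[t0 t1]; have t01 : 0 <= t <= T by rewrite t0 ltW.
  apply: (cvgF (t^'+) _ t (u t)); [by []|exact: uU'|exact: near_itv_right|exact: cvg_id_at_right| |].
    exact: (cvg_right_of_continuous (xc t)).
  by apply: urc; rewrite in_itv.
- have TT : 0 <= T <= T by rewrite T0' lexx.
  have TT' : 0 < T <= T by rewrite T0 lexx.
  apply: (cvgF (T^'-) _ T (u T)); [by []|exact: uU'|exact: near_itv_left|exact: cvg_id_at_left| |by []].
  exact: (cvg_left_of_continuous (xc _)).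
Qed.

End InTube.
End Dynamics.

(** * Needle variations *)

Section Patches.
Context {R : realType} {Y : topologicalType}.

Lemma near_right_ge (s t : R) : \forall r \near t^'+, (s <= r) = (s <= t).
Proof.
apply/at_right_dist; have [st|ts] := leP s t.
  by exists 1 => // r /andP[tr _]; rewrite (le_trans st)// ltW.
exists (s - t); first by rewrite subr_gt0.
by move=> r /andP[_ rs]; apply/negbTE; rewrite -ltNge; lra.
Qed.

Lemma near_left_ge (s t : R) : \forall r \near t^'-, (s <= r) = (s < t).
Proof.
apply/at_left_dist; have [ts|st] := leP t s.
  by exists 1 => // r /andP[_ rt]; apply/negbTE; rewrite -ltNge (lt_le_trans rt).
exists (t - s); first by rewrite subr_gt0.
by move=> r /andP[sr _]; lra.
Qed.

Lemma near_ge (s t : R) : t != s -> \forall r \near t, (s <= r) = (s < t).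
Proof.
move=> ts; apply/nbhs_dist; exists `|t - s|; first by rewrite normr_gt0 subr_eq0.
move=> r; have [st|st] := ltP s t.
  by rewrite [`|t - s|]gtr0_norm ?subr_gt0// ltr_norml => /andP[]; lra.
rewrite [`|t - s|]distrC [`|s - t|]ger0_norm ?subr_ge0// ltr_norml => /andP[_ rs].
by apply/negbTE; rewrite -ltNge; lra.
Qed.

Lemma NPC0_intro (T : R) (A : set Y) (u : R -> Y) (Fs : seq R) : 0 < T ->
  (forall t, 0 <= t <= T -> A (u t)) -> pcont A Fs 0 T u ->
  (forall t, 0 <= t < T -> u s @[s --> t^'+] --> u t) -> u s @[s --> T^'-] --> u T ->
  NPC0 T A u.
Proof.
move=> T0 uA up ur ul; split; last exact: ul.
  split; first by move=> t; rewrite in_itv; exact: uA.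
  by have [s sP _] := along_of_pcont T0 up; exists s.
by move=> t; rewrite in_itv; exact: ur.
Qed.

(** Right continuity survives because the modified interval is closed on the left and open on the
    right; [s' < T] leaves the value and the left limit at [T] untouched. *)
Lemma NPC0_patch (T : R) (A : set Y) (w : R -> Y) (Fs : seq R) (v : Y) s s' :
  0 <= s -> s' < T -> A v -> NPC0 T A w -> pcont A Fs 0 T w ->
  0 < T ->
  let w' t := if s <= t < s' then v else w t in
  NPC0 T A w' /\ pcont A (s :: s' :: Fs) 0 T w'.
Proof.
move=> s0 s'T Av [[wA _] wr wl] [pc pr pl] T0 w'.
have wA' t : 0 <= t <= T -> A (w t) by move=> tT; apply: wA; rewrite in_itv.
have w'A t : 0 <= t <= T -> A (w' t) by move=> tT; rewrite /w'; case: ifP => // _; exact: wA'.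
have nr t : \forall r \near t^'+, (if s <= t < s' then v else w r) = w' r.
  apply: filterS2 (near_right_ge s t) (near_right_ge s' t) => r h1 h2.
  by rewrite /w' h1 [r < s']ltNge h2 -ltNge.
have nl t : \forall r \near t^'-, (if s < t <= s' then v else w r) = w' r.
  apply: filterS2 (near_left_ge s t) (near_left_ge s' t) => r h1 h2.
  by rewrite /w' h1 [r < s']ltNge h2 -leNgt.
have nn t : t != s -> t != s' -> \forall r \near t, (if s < t <= s' then v else w r) = w' r.
  move=> h1 h2; apply: filterS2 (near_ge h1) (near_ge h2) => r e1 e2.
  by rewrite /w' e1 [r < s']ltNge e2 -leNgt.
have w'p : pcont A (s :: s' :: Fs) 0 T w'.
  split=> t tT.
  - rewrite !inE !negb_or => /and3P[ts ts' tF].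
    have -> : {for t, continuous w'} = (w' @ t --> (if s < t <= s' then v else w t)).
      rewrite /prop_for /continuous_at {2}/w' [s <= t]le_eqVlt [s == t]eq_sym (negbTE ts) /=.
      by rewrite [t <= s']le_eqVlt (negbTE ts').
    apply: cvg_trans (_ : (fun r => if s < t <= s' then v else w r) @ t --> _).
      by apply: near_eq_cvg; exact: nn.
    by case: ifP => _; [exact: cvg_cst|exact: pc].
  - exists (if s <= t < s' then v else xget v [set y | A y /\ w r @[r --> t^'+] --> y]).
      by case: ifP => // _; case: xgetP => // y _ [].
    apply: cvg_trans (_ : (fun r => if s <= t < s' then v else w r) @ t^'+ --> _).
      by apply: near_eq_cvg; exact: nr.
    case: ifP => _; first exact: cvg_cst.
    by case: xgetP => [y _ []//|no]; have [y yA wy] := pr t tT; case: (no y).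
  - exists (if s < t <= s' then v else xget v [set y | A y /\ w r @[r --> t^'-] --> y]).
      by case: ifP => // _; case: xgetP => // y _ [].
    apply: cvg_trans (_ : (fun r => if s < t <= s' then v else w r) @ t^'- --> _).
      by apply: near_eq_cvg; exact: nl.
    case: ifP => _; first exact: cvg_cst.
    by case: xgetP => [y _ []//|no]; have [y yA wy] := pl t tT; case: (no y).
split=> //; apply: (NPC0_intro T0 w'A w'p).
- move=> t tT; apply: cvg_trans (_ : (fun r => if s <= t < s' then v else w r) @ t^'+ --> _).
    by apply: near_eq_cvg; exact: nr.
  by rewrite /w'; case: ifP => _; [exact: cvg_cst|apply: wr; rewrite in_itv].
- apply: cvg_trans (_ : (fun r => if s < T <= s' then v else w r) @ T^'- --> _).
    by apply: near_eq_cvg; exact: nl.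
  by rewrite /w' [T <= s']leNgt s'T andbF [T < s']ltNge (ltW s'T) andbF.
Qed.

End Patches.

Section Ramps.
Context {R : realType}.
Implicit Types l s t : R.

Lemma sum_continuous {V : normedModType R} (I : finType) (g : I -> R -> V) :
  (forall i, continuous (g i)) -> continuous (fun t => \sum_i g i t).
Proof. by move=> gc; apply: continuous_big => [|i _]; [exact: add_continuous|exact: gc]. Qed.

(** For [l >= 0], the length of the part of [[s, s + l]] before [t], that is, the primitive of the
    indicator of a needle. *)
Definition ramp l s t := clamp 0 l (t - s).

Lemma ramp_continuous l s : continuous (ramp l s).
Proof.
move=> t; apply: (@cvg_comp _ _ _ (fun t => t - s) (clamp 0 l) _ (nbhs (t - s))).
  by apply: cvgB (cvg_cst _); exact: cvg_id.
exact: clamp_continuous.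
Qed.

Lemma ramp_mono l s : {homo ramp l s : x y / x <= y}.
Proof.
move=> x y xy; rewrite /ramp /clamp ge_max le_max lexx /= le_max; apply/orP; right.
by rewrite le_min ge_min lexx /= ge_min lerD2r xy orbT.
Qed.

Lemma ramp_ge0 l s t : 0 <= ramp l s t.
Proof. by rewrite /ramp /clamp le_max lexx. Qed.

Lemma ramp_le l s t : 0 <= l -> ramp l s t <= l.
Proof. by move=> l0; rewrite /ramp /clamp ge_max l0 ge_min lexx. Qed.

Lemma ramp0 l s t : 0 <= l -> t <= s -> ramp l s t = 0.
Proof.
move=> l0 ts; apply/le_anti; rewrite ramp_ge0 andbT /ramp /clamp ge_max lexx /= ge_min.
by rewrite subr_le0 ts orbT.
Qed.

Lemma ramp_lin l s t : 0 <= l -> s <= t <= s + l -> ramp l s t = t - s.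
Proof.
by move=> l0 /andP[st tl]; rewrite /ramp clamp_id// in_itv /= subr_ge0 st lerBlDl.
Qed.

Lemma ramp_top l s t : 0 <= l -> s + l <= t -> ramp l s t = l.
Proof.
move=> l0 tl; apply/le_anti; rewrite ramp_le//= /ramp /clamp le_max le_min lexx /=.
by rewrite lerBrDl tl orbT.
Qed.

Lemma ramp_growth l s t : s <= t < s + l -> \forall r \near t^'+, r - t <= ramp l s r - ramp l s t.
Proof.
move=> /andP[st tl]; have l0 : 0 <= l by lra.
apply/at_right_dist; exists (s + l - t); first by lra.
move=> r /andP[tr rl]; rewrite !ramp_lin//; try (apply/andP; split); lra.
Qed.

Lemma ramp_derive0l l s t : 0 <= l -> t < s -> is_derive t 1 (ramp l s) 0.
Proof.
move=> l0 ts; apply: (@is_derive_near_eq _ _ (cst (0 : R))).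
apply/nbhs_dist; exists (s - t); first by lra.
by move=> r; rewrite ltr_norml => /andP[_ rs]; rewrite ramp0//; lra.
Qed.

Lemma ramp_derive0r l s t : 0 <= l -> s + l < t -> is_derive t 1 (ramp l s) 0.
Proof.
move=> l0 ts; apply: (@is_derive_near_eq _ _ (cst l)).
apply/nbhs_dist; exists (t - (s + l)); first by lra.
by move=> r; rewrite ltr_norml => /andP[rs _]; rewrite ramp_top//; lra.
Qed.

Lemma ramp_derive1 l s t : s < t < s + l -> is_derive t 1 (ramp l s) 1.
Proof.
move=> /andP[st tl]; apply: (@is_derive_near_eq _ _ (id - cst s)).
  apply/nbhs_dist; exists (Num.min (t - s) (s + l - t)); first by rewrite lt_min; lra.
  move=> r; rewrite lt_min !ltr_norml => /andP[/andP[h1 _] /andP[_ h2]].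
  by rewrite !fctE ramp_lin//; [lra|apply/andP; split; lra].
by rewrite -[X in is_derive _ _ _ X]subr0; apply: is_deriveB.
Qed.

Lemma leibniz_algebra {V : lmodType R} (a a' d u : R) (y e v : V) :
  a' *: (e + d *: v + y) - a *: y - d *: (u *: y + a *: v) =
  a' *: e + (a' - a - d * u) *: y + ((a' - a) * d) *: v.
Proof.
rewrite !scalerDr !scalerA [(a' - a) * d]mulrBl !scalerBl [a * d]mulrC opprD -!addrA.
by congr (_ + _); do 3!(rewrite addrCA; congr (_ + _)).
Qed.

Lemma is_derive_scale {V : normedModType R} (phi : R -> R) (y : R -> V) t (dphi : R) (dy : V) :
  is_derive t 1 phi dphi -> is_derive t 1 y dy ->
  is_derive t 1 (fun s => phi s *: y s) (dphi *: y t + phi t *: dy).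
Proof.
move=> dphi_ dy_.
have phic : {for t, continuous phi}.
  by apply/differentiable_continuous/derivable1_diffP; exact: (@ex_derive _ _ _ _ _ _ _ dphi_).
move: dphi_ dy_ => /is_derive_epsP dp /is_derive_epsP dd.
apply/is_derive_epsP => eta eta0.
have e1 : 0 < eta / 3 / (`|phi t| + 1) by rewrite !divr_gt0// ltr_wpDl.
have e2 : 0 < eta / 3 / (`|y t| + 1) by rewrite !divr_gt0// ltr_wpDl.
have e3 : 0 < eta / 3 / (`|dy| + 1) by rewrite !divr_gt0// ltr_wpDl.
near=> r.
have h1 : `|y r - y t - (r - t) *: dy| <= eta / 3 / (`|phi t| + 1) * `|r - t|.
  by near: r; exact: dd.
have h2 : `|phi r - phi t - (r - t) *: dphi| <= eta / 3 / (`|y t| + 1) * `|r - t|.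
  by near: r; exact: dp.
have h3 : `|phi t - phi r| <= eta / 3 / (`|dy| + 1).
  by near: r; move/cvgrPdist_le : phic; apply.
have h4 : `|phi t - phi r| <= 1.
  by near: r; move/cvgrPdist_le : phic; apply.
have -> : phi r *: y r - phi t *: y t - (r - t) *: (dphi *: y t + phi t *: dy) =
    phi r *: (y r - y t - (r - t) *: dy) + (phi r - phi t - (r - t) *: dphi) *: y t
    + ((phi r - phi t) * (r - t)) *: dy.
  by rewrite -leibniz_algebra !subrK.
have C1 : 0 < `|phi t| + 1 by rewrite ltr_wpDl.
have C2 : 0 < `|y t| + 1 by rewrite ltr_wpDl.
have C3 : 0 < `|dy| + 1 by rewrite ltr_wpDl.
have k1 : `|phi r *: (y r - y t - (r - t) *: dy)| <= eta / 3 * `|r - t|.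
  have pr : `|phi r| <= `|phi t| + 1.
    by rewrite -[phi r](subrK (phi t)) (le_trans (ler_normD _ _))// addrC lerD2l distrC.
  rewrite normrZ; apply: le_trans (ler_pM _ _ pr h1) _ => //.
  by rewrite mulrA mulrCA mulfV ?gt_eqF// mulr1.
have k2 : `|(phi r - phi t - (r - t) *: dphi) *: y t| <= eta / 3 * `|r - t|.
  have yt : `|y t| <= `|y t| + 1 by rewrite lerDl.
  rewrite normrZ; apply: le_trans (ler_pM _ _ h2 yt) _ => //.
  by rewrite mulrAC divfK// gt_eqF.
have k3 : `|((phi r - phi t) * (r - t)) *: dy| <= eta / 3 * `|r - t|.
  have yt : `|dy| <= `|dy| + 1 by rewrite lerDl.
  rewrite normrZ normrM distrC mulrAC ler_wpM2r//.
  by apply: le_trans (ler_pM _ _ h3 yt) _ => //; rewrite divfK// gt_eqF.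
apply: le_trans (ler_normD _ _) _; apply: le_trans (lerD (ler_normD _ _) (lexx _)) _.
by move: k1 k2 k3; lra.
Unshelve. all: by end_near. Qed.

End Ramps.

Section Needles.
Context {R : realType} {E : completeNormedModType R} {Y : normedModType R}.
Context {T : R} {Omega : set E} {U : set Y} {f : R -> E -> Y -> E} {x0 : R -> E} {u0 : R -> Y}.
Variable P : process T Omega U f x0 u0.
Local Notation X0 := (xbar T x0).
Variables (N : nat) (tn : 'I_N -> R) (vn : 'I_N -> Y) (c : R).
Hypothesis tn_itv : forall i, 0 <= tn i < T.
Hypothesis vn_U : forall i, U (vn i).
Hypothesis c_ge0 : 0 <= c.

(* Offsetting the needles by multiples of [eps * c] keeps them disjoint even
   when several of them are based at the same instant. *)
Definition nstart eps (i : 'I_N) := tn i + (val i)%:R * (eps * c).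

Definition in_needle eps (al : 'I_N -> R) i t := nstart eps i <= t < nstart eps i + eps * al i.

(** If needles overlapped, the first one in the enumeration would prevail; at a small scale at most
    one contains [t]. *)
Definition needle_control eps al t :=
  foldr (fun i z => if in_needle eps al i t then vn i else z) (u0 t) (enum 'I_N).

Definition box (al : 'I_N -> R) := forall i, 0 <= al i <= c.

(** A length [N * (eps * c)], one slot [eps * c] per needle, is reserved after each instant. It must
    end before [T] and before the next distinct instant. *)
Definition small_scale eps := [/\ 0 < eps, forall i, tn i + N%:R * (eps * c) < T &
  forall i j, tn i < tn j -> tn i + N%:R * (eps * c) <= tn j].

Lemma near_small_scale : exists2 e0, 0 < e0 & forall eps, 0 < eps < e0 -> small_scale eps.
Proof.
have shift (a b : R) : a < b -> \forall e \near 0^'+, a + N%:R * (e * c) < b.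
  move=> ab; apply/at_right_dist.
  have C0 : 0 < N%:R * c + 1 by rewrite ltr_wpDl// mulr_ge0.
  exists ((b - a) / (N%:R * c + 1)) => [|e]; first by rewrite divr_gt0 ?subr_gt0.
  rewrite add0r ltr_pdivlMr// => /andP[e0 eb].
  have : e * (N%:R * c) < b - a by apply: le_lt_trans eb; rewrite ler_wpM2l ?lerDl// ltW.
  by rewrite mulrCA; lra.
have H1 : \forall e \near 0^'+, forall i, tn i + N%:R * (e * c) < T.
  by apply: filter_forall => i; apply: shift; case/andP: (tn_itv i).
have H2 : \forall e \near 0^'+, forall i j, tn i < tn j -> tn i + N%:R * (e * c) <= tn j.
  apply: filter_forall => i; apply: filter_forall => j.
  have [ij|ji] := ltP (tn i) (tn j); last by near=> e.
  by apply: filterS (shift _ _ ij) => e /ltW.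
have [e0 e00 e0P] := (at_right_dist _ _).1 (filterI H1 H2).
exists e0 => // eps /andP[h1 h2]; split=> //.
  by apply: (e0P eps _).1; rewrite h1 add0r.
by apply: (e0P eps _).2; rewrite h1 add0r.
Unshelve. all: by end_near. Qed.

Lemma needle_end eps al i : 0 < eps -> box al ->
  nstart eps i + eps * al i <= tn i + (val i).+1%:R * (eps * c).
Proof.
move=> eps0 bal; rewrite /nstart -addrA lerD2l -natr1 mulrDl mul1r lerD2l ler_pM2l//.
by case/andP: (bal i).
Qed.

Lemma tn_nstart eps i : 0 < eps -> tn i <= nstart eps i.
Proof. by move=> eps0; rewrite lerDl !mulr_ge0// ltW. Qed.

Lemma needle_lt_T eps al i : small_scale eps -> box al -> nstart eps i + eps * al i < T.
Proof.
move=> [eps0 epsT _] bal; apply: le_lt_trans (needle_end i eps0 bal) _.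
apply: le_lt_trans (epsT i); rewrite lerD2l ler_wpM2r ?mulr_ge0 ?(ltW eps0)//.
by rewrite ler_nat ltn_ord.
Qed.

(** Needles based at the same instant lie in different slots; those based at different instants are
    separated by the reserved lengths of [small_scale]. *)
Lemma needle_disjoint eps al i j t : small_scale eps -> box al ->
  in_needle eps al i t -> in_needle eps al j t -> i = j.
Proof.
move=> fe bal; have [eps0 _ eps_sep] := fe.
have ec : 0 <= eps * c by rewrite mulr_ge0// ltW.
have key i' j' : tn i' <= tn j' -> (tn i' = tn j' -> (i' < j')%N) ->
    in_needle eps al i' t -> in_needle eps al j' t -> False.
  move=> le eqlt /andP[_ ti] /andP[jt _].
  have := le_lt_trans jt ti; apply/negP; rewrite -leNgt.
  apply: le_trans (needle_end i' eps0 bal) _.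
  move: le; rewrite le_eqVlt => /predU1P[/[dup] eq -> |lt].
    by rewrite lerD2l ler_wpM2r// ler_nat; exact: eqlt.
  apply: le_trans (tn_nstart _ eps0); apply: le_trans (eps_sep _ _ lt).
  by rewrite lerD2l ler_wpM2r// ler_nat ltn_ord.
move=> ti tj; have [ij|ji|/val_inj//] := ltngtP i j.
  have [le|lt] := leP (tn i) (tn j); first by case: (key i j).
  by case: (key j i) => //; [exact: ltW|move=> eq; rewrite eq ltxx in lt].
have [le|lt] := leP (tn j) (tn i); first by case: (key j i).
by case: (key i j) => //; [exact: ltW|move=> eq; rewrite eq ltxx in lt].
Qed.

Lemma needle_control_in eps al i t : small_scale eps -> box al -> in_needle eps al i t ->
  needle_control eps al t = vn i.
Proof.
move=> fe bal ti; rewrite /needle_control; have : i \in enum 'I_N by rewrite mem_enum.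
elim: (enum 'I_N) => [//|j s IH]; rewrite inE /= => ijs.
case: ifPn => tj; first by rewrite (needle_disjoint fe bal ti tj).
by case/predU1P: ijs => [ij|/IH//]; rewrite -ij ti in tj.
Qed.

Lemma needle_control_out eps al t : (forall i, ~~ in_needle eps al i t) ->
  needle_control eps al t = u0 t.
Proof.
move=> tout; rewrite /needle_control; elim: (enum 'I_N) => [//|i s IH] /=.
by rewrite (negbTE (tout i)).
Qed.

Lemma needle_control_eq eps al be t :
  (forall i, in_needle eps al i t = in_needle eps be i t) ->
  needle_control eps al t = needle_control eps be t.
Proof.
move=> eqn; rewrite /needle_control; elim: (enum 'I_N) => [//|i s IH] /=.
by rewrite eqn IH.
Qed.

Lemma needle_control_NPC0 eps al : small_scale eps -> box al ->
  NPC0 T U (needle_control eps al) /\ exists Fs, pcont U Fs 0 T (needle_control eps al).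
Proof.
move=> fe bal; have [eps0 _ _] := fe; rewrite /needle_control.
elim: (enum 'I_N) => [|i s [IH1 [Fs IH2]]] /=; first by split; [exact: pr_u0 P|exact: u0_pcont P].
have s0 : 0 <= nstart eps i by apply: le_trans (tn_nstart i eps0); case/andP: (tn_itv i).
have [h1 h2] := NPC0_patch s0 (needle_lt_T i fe bal) (vn_U i) IH1 IH2 (pr_T P).
by split=> //; eexists; exact: h2.
Qed.

Lemma needle_hull : exists M : set Y, [/\ compact M, M !=set0, M `<=` U,
  forall t, 0 <= t <= T -> M (u0 t) & forall i, M (vn i)].
Proof.
have [Fs up] := u0_pcont P.
have [M [Mc MU Mu]] := pcont_compact (T_ge0 P) (fun t tT => u0_U P tT) up.
exists (M `|` range vn); split.
- by apply: compactU => //; apply: finite_compact; exact: finite_image.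
- by exists (u0 0); left; apply: Mu; rewrite lexx (T_ge0 P).
- by move=> y [/MU//|[i _ <-]].
- by move=> t tT; left; exact: Mu.
- by move=> i; right; exists i.
Qed.

Lemma needle_control_M (M : set Y) eps al t : M (u0 t) -> (forall i, M (vn i)) ->
  M (needle_control eps al t).
Proof.
move=> Mu Mv; rewrite /needle_control; elim: (enum 'I_N) => [//|i s IH] /=.
by case: ifP.
Qed.

Lemma needle_control0 eps t : needle_control eps (fun=> 0) t = u0 t.
Proof.
apply: needle_control_out => i; rewrite /in_needle mulr0 addr0.
by apply/negP => /andP[/le_lt_trans]/[apply]; rewrite ltxx.
Qed.

Section InTube.
Variables (M : set Y) (a L B : R).
Hypothesis HM : @tube R E Y T Omega U f x0 M a L B.
Hypothesis Mu0 : forall t, 0 <= t <= T -> M (u0 t).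
Hypothesis Mvn : forall i, M (vn i).

(** The two controls can differ only between the two end points of some needle, and the lengths of
    these gaps add up to [eps * \sum_i |al i - be i|]. The sum of their ramps serves as [G] in
    [stability]. *)
Lemma needle_lipschitz eps al be Fs x y : 0 <= eps ->
  @is_traj _ _ _ T f x0 a (needle_control eps al) Fs x ->
  @is_traj _ _ _ T f x0 a (needle_control eps be) Fs y ->
  forall t, 0 <= t <= T ->
  `|x t - y t| <= expR (2 * L * T) * (2 * B) * eps * \sum_i `|al i - be i|.
Proof.
move=> eps0 xal ybe t tT.
pose l i := eps * `|al i - be i|.
have l0 i : 0 <= l i by rewrite mulr_ge0.
pose s i := nstart eps i + eps * Num.min (al i) (be i).
pose G r := 2 * B * \sum_i ramp (l i) (s i) r.
have B2 : 0 <= 2 * B by rewrite mulr_ge0// (tube_B HM).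
have Gc : continuous G.
  by move=> r; apply: cvgM (cvg_cst _) _; apply: sum_continuous => i; exact: ramp_continuous.
have Gm : {homo G : r r' / r <= r'}.
  by move=> r r' rr; rewrite ler_wpM2l// ler_sum// => i _; exact: ramp_mono.
have := stability P HM xal ybe _ _ Gc Gm _ tT.
have -> : expR (2 * L * T) * (2 * B) * eps * \sum_i `|al i - be i| =
    expR (2 * L * T) * (2 * B * \sum_i l i).
  by rewrite /l -mulr_sumr; ring.
move=> H; apply: le_trans (H _ _ _) _.
- by move=> r rT; apply: needle_control_M => //; exact: Mu0.
- by move=> r rT; apply: needle_control_M => //; exact: Mu0.
- move=> r rT _.
  have [/forallP eqn|/forallPn[i ni]] := boolP [forall i, in_needle eps al i r == in_needle eps be i r].
    by left; apply: needle_control_eq => i; exact/eqP.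
  right; have sr : s i <= r < s i + l i.
    have minmax : eps * Num.min (al i) (be i) + eps * `|al i - be i| = eps * Num.max (al i) (be i).
      by rewrite -mulrDr; congr (_ * _); case: leP => h; [rewrite distrC|]; rewrite ger0_norm; lra.
    rewrite /s /l -[_ + _ + _]addrA minmax.
    move: ni; rewrite /in_needle; case: (leP (al i) (be i)) => h.
      have hh : eps * al i <= eps * be i by rewrite ler_wpM2l.
      case: (leP (nstart eps i) r) => //= nr; case: (ltP r (nstart _ _ + eps * al i)) => //=.
        move=> h1; have h2 : r < nstart eps i + eps * be i by rewrite (lt_le_trans h1)// lerD2l.
        by rewrite h2.
      by move=> h1; case: ltP => // h2 _; rewrite h1.
    have hh : eps * be i <= eps * al i by rewrite ler_wpM2l// ltW.
    case: (leP (nstart eps i) r) => //= nr; case: (ltP r (nstart _ _ + eps * be i)) => //=.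
      move=> h1; have h2 : r < nstart eps i + eps * al i by rewrite (lt_le_trans h1)// lerD2l.
      by rewrite h2.
    by move=> h1; case: ltP => // h2 _; rewrite h1.
  apply: filterS2 (ramp_growth sr) (near_right_notin [::] (ltr_pwDr ltr01 (lexx r))) =>
    r' h1 [/andP[/ltW rr' _] _].
  rewrite /G -mulrBr -sumrB ler_wpM2l// (bigD1 i)//= -[r' - r]addr0 lerD//.
  by apply: sumr_ge0 => j _; rewrite subr_ge0 ramp_mono.
rewrite ler_wpM2l ?expR_ge0// /G -mulrBr -sumrB ler_wpM2l// ler_sum// => i _.
by rewrite (le_trans (_ : _ <= ramp (l i) (s i) T))// ?ramp_le// gerBl ramp_ge0.
Qed.

End InTube.

End Needles.

(** * First-order expansion of the end point *)

Section Expansion.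
Context {R : realType} {E : completeNormedModType R} {Y : normedModType R}.
Context {T : R} {Omega : set E} {U : set Y} {f : R -> E -> Y -> E} {x0 : R -> E} {u0 : R -> Y}.
Variable P : process T Omega U f x0 u0.
Local Notation X0 := (xbar T x0).
Local Notation A := (@Alin _ _ _ f x0 u0).

Lemma frechet_remainder t z : 0 <= t <= T -> U z -> forall eta, 0 < eta ->
  exists2 d, 0 < d & forall w, `|w| < d ->
    `|f t (X0 t + w) z - f t (X0 t) z - Dfrechet (fun xi => f t xi z) (x0 t) w| <= eta * `|w|.
Proof.
move=> tT zU eta eta0; rewrite (xbarE tT).
have tI : t \in `[0, T] by rewrite in_itv.
have df := pr_frechet P tI zU.
have /eqaddoP/(_ _ eta0)/normed_nbhs[d d0 dP] := diff_locally df.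
exists d => // w wd; have := dP w; rewrite subr0 => /(_ wd).
by rewrite !fctE /= [w + _]addrC opprD addrA DfrechetP.
Qed.

Lemma is_traj_sub a (u : R -> Y) (Fs Fs' : seq R) x : {subset Fs <= Fs'} ->
  @is_traj _ _ _ T f x0 a u Fs x -> @is_traj _ _ _ T f x0 a u Fs' x.
Proof.
move=> sub [xc xi xd]; split=> // t tT tF; apply: xd => //.
by apply: contra tF; exact: sub.
Qed.

(* The Fréchet remainder is small relative to [w] only pointwise in time; the
   exceptional times form open sets decreasing to the empty set. *)
Lemma remainder_clock (a eta kap : R) (Fs : seq R) : pcont U Fs 0 T u0 ->
  (forall t w, 0 <= t <= T -> `|w| <= a -> Omega (X0 t + w)) ->
  0 < a -> 0 < eta -> 0 < kap ->
  exists (d : R) (m : R -> R), [/\ 0 < d, continuous m, {homo m : s t / s <= t},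
    m T - m 0 <= kap &
    forall t, 0 < t < T -> t \notin Fs ->
      (forall w, `|w| < d -> `|f t (X0 t + w) (u0 t) - f t (X0 t) (u0 t) - A t w| <= eta * `|w|) \/
      \forall s \near t^'+, s - t <= m s - m t].
Proof.
move=> up aO a0 eta0 kap0.
pose rem t w := f t (X0 t + w) (u0 t) - f t (X0 t) (u0 t) - A t w.
pose En (n : nat) := [set t | [/\ 0 < t < T, t \notin Fs &
  exists2 w, `|w| < a / n.+1%:R & eta * `|w| < `|rem t w|]].
have [uc ur ul] := up; have [Ac _ _] := Alin_pcont P up.
have an n : a / n.+1%:R <= a by rewrite ler_pdivrMr// ler_peMr ?(ltW a0)// ler1n.
have [||||||n [m [mc mm mT mE]]] := @small_open_sets _ En T kap.
- move=> n; rewrite openE => t [tT tF [w wa wr]] /=.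
  have t01 : 0 <= t <= T by case/andP: tT => *; rewrite !ltW.
  (* The witness [w] is kept fixed: at a continuity time of [u0] its remainder is continuous in
     time, so the strict inequality persists nearby and [En n] is open. *)
  have remc : rem s w @[s --> t] --> rem t w.
    have dom : \forall s \near t, 0 <= s <= T by exact: near_itv.
    have fw w' : `|w'| <= a -> f s (X0 s + w') (u0 s) @[s --> t] --> f t (X0 t + w') (u0 t).
      move=> w'a; apply: (f_cvg P (F := nbhs t) (tau := id) (xi := fun s => X0 s + w') (zeta := u0)).
      + by apply: filterS dom => s sT; split=> //; [exact: aO|exact: (u0_U P)].
      + exact: cvg_id.
      + by apply: cvgD (cvg_cst _); exact: (xbar_continuous P).
      + exact: uc.
      + by [].
      + exact: aO.
      + exact: (u0_U P).
    apply: cvgB.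
      apply: cvgB; first by apply: fw; rewrite (le_trans _ (an n))// ltW.
      have := fw 0; rewrite normr0 ltW// => /(_ isT).
      rewrite addr0; apply: cvg_trans; apply: near_eq_cvg; apply: nearW => s.
      by rewrite addr0.
    by apply: cvg_blin (cvg_cst _); exact: Ac.
  change (\forall s \near t, En n s).
  have near_ws : \forall s \near t, eta * `|w| < `|rem s w| by apply: (@cvgr_norm_gt _ _ _ _ _ (fun s => rem s w) (rem t w) remc).
  apply: filterS2 (near_open_notin tT tF) near_ws => s [sT sF] ws.
  by split=> //; exists w.
- by move=> n t [/andP[t0 tT] _ _]; rewrite /= in_itv /= !ltW.
- move=> n n' nn' t [tT tF [w wa wr]]; split=> //; exists w => //.
  apply: lt_le_trans wa _; rewrite ler_pM2l// lef_pV2 ?posrE ?ltr0n//.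
  by rewrite ler_nat ltnS.
- move=> t tE; have [tT tF _] := tE 0%N.
  have t01 : 0 <= t <= T by case/andP: tT => *; rewrite !ltW.
  (* Fréchet differentiability at the single instant [t] excludes it from [En n] as soon as
     [a / (n + 1) < d]. *)
  have [d d0 dP] := frechet_remainder t01 (u0_U P t01) eta0.
  have da : 0 < d / a by rewrite divr_gt0.
  have [n _ /(_ n (leqnn n)) /= nd] := near_infty_natSinv_lt (PosNum da).
  have [_ _ [w wn wr]] := tE n.
  have : `|w| < d.
    apply: lt_trans wn _; move: nd => /=; rewrite ltr_pdivlMr// mulrC.
    by [].
  by move=> /dP; rewrite leNgt wr.
- exact: (T_ge0 P).
- exact: kap0.
exists (a / n.+1%:R), m; split=> //; first by rewrite divr_gt0.
move=> t tT tF; have [Et|nEt] := pselect (En n t); first by right; exact: mE.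
left=> w wa; rewrite leNgt; apply/negP => wr; apply: nEt; split=> //.
by exists w.
Qed.

(** During a needle, [y] is close to its initial value, the jump [k - l] of the velocity at the base
    instant. The rearrangement exhibits five differences, each of them small. *)
Lemma needle_defect {V : zmodType} (q p o k l y w : V) :
  p - o - y - w = p - q + (q - k) - (o - l) - (y - (k - l)) - w.
Proof.
congr (_ - _); rewrite subrKA [- (y - _)]opprB [- (o - l)]opprB.
rewrite [l - o]addrC [p - k + _]addrACA [- k + l]addrC -[l - k]opprB.
by rewrite addrA subrK.
Qed.

Lemma ler_norm5 {V : normedModType R} (p q o y w : V) :
  `|p + q - o - y - w| <= `|p| + `|q| + `|o| + `|y| + `|w|.
Proof.
do 3!(apply: le_trans (ler_normB _ _) _; rewrite lerD2r).
exact: ler_normD.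
Qed.

Section NeedleExpansion.
Variables (N : nat) (tn : 'I_N -> R) (vn : 'I_N -> Y) (c : R).
Hypothesis tn_itv : forall i, 0 <= tn i < T.
Hypothesis vn_U : forall i, U (vn i).
Hypothesis c_ge0 : 0 <= c.

Definition needle_jump t v := f t (X0 t) v - f t (X0 t) (u0 t).

(* The variation caused by a needle at [tn i]; it is frozen before [tn i] so as
   to be defined on the whole of [0, T]. *)
Definition is_response (t0 : R) (v : Y) (y : R -> E) := [/\ continuous y, y 0 = needle_jump t0 v &
  exists Fs : seq R, forall t, 0 < t < T -> t \notin Fs ->
    is_derive t 1 y (if t < t0 then 0 else A t (y t))].

Lemma exists_response t0 v : exists y, is_response t0 v y.
Proof.
have [Fs up] := u0_pcont P; have [Ac Ar Al] := Alin_pcont P up.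
pose B t : blin E E := if t < t0 then 0 else A t.
have nn t : t != t0 -> \forall r \near t, (if t < t0 then 0 else A r) = B r.
  move=> tt0; have := near_ge tt0; apply: filterS => r h.
  by rewrite /B [r < t0]ltNge h -leNgt le_eqVlt (negbTE tt0).
have nr t : \forall r \near t^'+, (if t < t0 then 0 else A r) = B r.
  by have := near_right_ge t0 t; apply: filterS => r h; rewrite /B [r < t0]ltNge h -ltNge.
have nl t : \forall r \near t^'-, (if t <= t0 then 0 else A r) = B r.
  by have := near_left_ge t0 t; apply: filterS => r h; rewrite /B [r < t0]ltNge h -leNgt.
have Bp : pcont setT (t0 :: Fs) 0 T B.
  split=> t tT.
  - rewrite inE negb_or => /andP[tt0 tF]; rewrite /prop_for /continuous_at {2}/B.
    apply: cvg_trans (_ : (fun r => if t < t0 then 0 else A r) @ t --> _).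
      by apply: near_eq_cvg; exact: nn.
    by case: ifP => _; [exact: cvg_cst|exact: Ac].
  - have [b _ bP] := Ar t tT; exists (if t < t0 then 0 else b) => //.
    apply: cvg_trans (_ : (fun r => if t < t0 then 0 else A r) @ t^'+ --> _).
      by apply: near_eq_cvg; exact: nr.
    by case: ifP => _ //; exact: cvg_cst.
  - have [b _ bP] := Al t tT; exists (if t <= t0 then 0 else b) => //.
    apply: cvg_trans (_ : (fun r => if t <= t0 then 0 else A r) @ t^'- --> _).
      by apply: near_eq_cvg; exact: nl.
    by case: ifP => _ //; exact: cvg_cst.
have [y [yc y0 yd]] := linear_ode (needle_jump t0 v) (T_ge0 P) Bp.
exists y; split=> //; exists (t0 :: Fs) => t tT tF; have := yd t tT tF.
by rewrite /B; case: ifP.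
Qed.

Lemma response_frozen t0 v y t : is_response t0 v y -> t0 <= T -> 0 <= t <= t0 ->
  y t = needle_jump t0 v.
Proof.
move=> [yc y0 [Fs yd]] t0T /andP[t_0 tt0].
have := @mean_value _ _ y Fs 0 t 0 t_0 (lexx _) yc.
rewrite mul0r y0 => H; apply/eqP; rewrite -subr_eq0 -normr_le0; apply: H.
move=> s /andP[s0 st] sF; exists 0; last by rewrite normr0.
have := yd s _ sF; rewrite (lt_le_trans st tt0); apply.
by rewrite s0 (lt_le_trans st)// (le_trans tt0).
Qed.

Lemma needle_summand_derive eps al i (y : R -> E) (Fs : seq R) t : 0 < eps -> box c al ->
  (forall t, 0 < t < T -> t \notin Fs -> is_derive t 1 y (if t < tn i then 0 else A t (y t))) ->
  0 < t < T -> t \notin Fs -> t != nstart tn c eps i -> t != nstart tn c eps i + eps * al i ->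
  is_derive t 1 (fun t => ramp (eps * al i) (nstart tn c eps i) t *: y t)
    ((in_needle tn c eps al i t)%:R *: y t +
     ramp (eps * al i) (nstart tn c eps i) t *: A t (y t)).
Proof.
move=> eps0 bal yd tT tF ts te.
have l0 : 0 <= eps * al i by rewrite mulr_ge0 ?(ltW eps0)//; case/andP: (bal i).
have tns := tn_nstart tn c_ge0 i eps0.
rewrite /in_needle; have [st|st|E'] := ltgtP t (nstart tn c eps i); last by rewrite E' eqxx in ts.
  rewrite ramp0 ?(ltW st)// scale0r scale0r addr0.
  have := is_derive_scale (ramp_derive0l l0 st) (yd t tT tF).
  by rewrite ramp0 ?(ltW st)// !scale0r addr0.
have yt : is_derive t 1 y (A t (y t)).
  by have := yd t tT tF; rewrite ltNge (le_trans tns (ltW st)).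
have [et|et|E'] := ltgtP t (nstart tn c eps i + eps * al i); last by rewrite E' eqxx in te.
  have h : nstart tn c eps i < t < nstart tn c eps i + eps * al i by rewrite st.
  exact: is_derive_scale (ramp_derive1 h) yt.
exact: is_derive_scale (ramp_derive0r l0 et) yt.
Qed.

Section InTube.
Variables (M : set Y) (a L B : R).
Hypothesis HM : @tube R E Y T Omega U f x0 M a L B.
Hypothesis Mu0 : forall t, 0 <= t <= T -> M (u0 t).
Hypothesis Mvn : forall i, M (vn i).

Let K := expR (2 * L * T) * (2 * B) * (N%:R * c).

Lemma K_ge0 : 0 <= K.
Proof. by rewrite !mulr_ge0 ?expR_ge0// (tube_B HM). Qed.

(** The reference trajectory is the one with needles of length zero, so [needle_lipschitz] applies
    with [be = 0]. *)
Lemma needle_closeness eps al Fs x : 0 <= eps -> box c al ->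
  @is_traj _ _ _ T f x0 a (needle_control (u0 := u0) tn vn c eps al) Fs x ->
  forall t, 0 <= t <= T -> `|x t - X0 t| <= K * eps.
Proof.
move=> eps0 bal xal t tT; have [FX XP] := xbar_traj P HM.
have sub1 : {subset Fs <= Fs ++ FX} by move=> r rF; rewrite mem_cat rF.
have sub2 : {subset FX <= Fs ++ FX} by move=> r rF; rewrite mem_cat rF orbT.
have x0al : @is_traj _ _ _ T f x0 a (needle_control (u0 := u0) tn vn c eps (fun=> 0)) (Fs ++ FX) X0.
  have [h1 h2 h3] := XP _ sub2; split=> // r rT rF.
  by rewrite needle_control0; exact: h3.
have := needle_lipschitz P HM Mu0 Mvn eps0 (is_traj_sub sub1 xal) x0al tT.
move/le_trans; apply; rewrite /K [_ * (_ * c) * _]mulrAC ler_wpM2l//.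
  by rewrite !mulr_ge0 ?expR_ge0// (tube_B HM).
have -> : N%:R * c = \sum_(i < N) c by rewrite sumr_const card_ord mulr_natl.
by apply: ler_sum => i _; rewrite subr0; case/andP: (bal i) => h1 h2; rewrite ger0_norm.
Qed.

Lemma needle_values eta (y : 'I_N -> R -> E) : 0 < eta -> (forall i, continuous (y i)) ->
  \forall d \near 0^'+, forall i t, tn i < t < tn i + d ->
    [/\ `|f t (X0 t) (vn i) - f (tn i) (X0 (tn i)) (vn i)| <= eta,
        `|f t (X0 t) (u0 t) - f (tn i) (X0 (tn i)) (u0 (tn i))| <= eta &
        `|y i t - y i (tn i)| <= eta].
Proof.
move=> eta0 yc; apply: filter_forall => i.
have tT := tn_itv i; have t01 : 0 <= tn i <= T by case/andP: tT => -> /ltW.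
have near_it : \forall t \near (tn i)^'+, 0 <= t <= T by exact: near_itv_right.
have XR : X0 t @[t --> (tn i)^'+] --> X0 (tn i).
  by apply: cvg_right_of_continuous; exact: (xbar_continuous P).
have h1 : f t (X0 t) (vn i) @[t --> (tn i)^'+] --> f (tn i) (X0 (tn i)) (vn i).
  apply: (f_cvg P (F := (tn i)^'+) (tau := id) (xi := X0) (zeta := fun=> vn i)).
  - by apply: filterS near_it => t tt; split=> //; exact: (xbar_Omega P).
  - exact: cvg_id_at_right.
  - exact: XR.
  - exact: cvg_cst.
  - by [].
  - exact: (xbar_Omega P).
  - exact: vn_U.
have h2 : f t (X0 t) (u0 t) @[t --> (tn i)^'+] --> f (tn i) (X0 (tn i)) (u0 (tn i)).
  apply: (f_cvg P (F := (tn i)^'+) (tau := id) (xi := X0) (zeta := u0)).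
  - by apply: filterS near_it => t tt; split=> //; [exact: (xbar_Omega P)|exact: (u0_U P)].
  - exact: cvg_id_at_right.
  - exact: XR.
  - exact: (u0_right P).
  - by [].
  - exact: (xbar_Omega P).
  - exact: (u0_U P).
have h3 : y i t @[t --> (tn i)^'+] --> y i (tn i) by apply: cvg_right_of_continuous; exact: yc.
have /at_right_dist[d d0 dP] : \forall t \near (tn i)^'+,
    [/\ `|f t (X0 t) (vn i) - f (tn i) (X0 (tn i)) (vn i)| <= eta,
        `|f t (X0 t) (u0 t) - f (tn i) (X0 (tn i)) (u0 (tn i))| <= eta &
        `|y i t - y i (tn i)| <= eta].
  near=> t; split; rewrite distrC; near: t.
  - by move/cvgrPdist_le : h1; apply.
  - by move/cvgrPdist_le : h2; apply.
  - by move/cvgrPdist_le : h3; apply.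
apply/at_right_dist; exists d => // d'; rewrite add0r => /andP[_ d'd] t /andP[h4 h5].
by apply: dP; rewrite h4 (lt_trans h5)// ltrD2l.
Unshelve. all: by end_near. Qed.

(** Gronwall is applied to the error of the linear prediction. Its defect is small inside needles by
    continuity from the right at their instants, small at good instants by Fréchet
    differentiability, and of order [eps] at bad instants, whose total measure is small. *)
Theorem needle_expansion (y : 'I_N -> R -> E) : (forall i, is_response (tn i) (vn i) (y i)) ->
  forall eta, 0 < eta -> exists2 e1, 0 < e1 & forall eps al Fs x, 0 < eps < e1 -> box c al ->
  @is_traj _ _ _ T f x0 a (needle_control (u0 := u0) tn vn c eps al) Fs x ->
  `|x T - x0 T - eps *: \sum_i al i *: y i T| <= eta * eps.
Proof.
move=> yP eta eta0.
have T0 := T_ge0 P; have K0 := K_ge0.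
have [F0 up] := u0_pcont P; have Ap := Alin_pcont P up.
have [As As0 AsP] := pcont_bounded P Ap.
have [FX XP] := xbar_traj P HM.
have /choice[Fy FyP] : forall i, exists Fs : seq R, forall t, 0 < t < T -> t \notin Fs ->
    is_derive t 1 (y i) (if t < tn i then 0 else A t (y i t)).
  by move=> i; have [_ _] := yP i.
(* The summands are the contributions of the good instants, the bad instants and the needles, in
   units of [eta1 * eps]; the [1] makes [Q] positive. *)
pose Q := expR (As * T) * (K * T + (L + As) * K + N%:R * c + 1).
have L0 := ltW (tube_L HM).
have Nc0 : 0 <= N%:R * c by rewrite mulr_ge0.
have LAK0 : 0 <= (L + As) * K by rewrite mulr_ge0// addr_ge0.
have KT0 : 0 <= K * T by rewrite mulr_ge0.
have Q0 : 0 < Q.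
  rewrite mulr_gt0 ?expR_gt0// ltr_wpDl// addr_ge0// addr_ge0//.
pose eta1 := eta / Q.
have eta10 : 0 < eta1 by rewrite divr_gt0.
have [d [m [d0 mc mm mT mP]]] := remainder_clock up (tube_in HM) (tube_a HM) eta10 eta10.
have eta5 : 0 < eta1 / 5 by rewrite divr_gt0.
have yc i : continuous (y i) by have [] := yP i.
have /at_right_dist[dv dv0 dvP] := needle_values eta5 yc.
have [e0 e00 e0P] := near_small_scale tn_itv c_ge0.
have pos1 (r : R) : 0 <= r -> 0 < r + 1 by move=> r0; rewrite ltr_wpDl.
(* In this order: needles are disjoint; the deviation [K * eps] is below the radius [d] of validity
   of the remainder and inside the tube; needles stay within [dv / 2] of their instants; the crude
   defect [(L + As) * K * eps] is at most a fifth of [eta1]. *)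
pose e1 := Num.min e0 (Num.min (Num.min d a / (K + 1)) (Num.min (dv / 2 / (N%:R * c + 1))
   (eta1 / 5 / ((L + As) * K + 1)))).
exists e1.
  rewrite !lt_min e00 !divr_gt0 ?pos1//= lt_min d0; exact: (tube_a HM).
move=> eps al Fs x /andP[eps0]; rewrite !lt_min => /and4P[epse0 epsd epsv epsA] bal xal.
have sc : small_scale (T := T) tn c eps by apply: e0P; rewrite eps0.
have Kd : K * eps < Num.min d a.
  move: epsd; rewrite ltr_pdivlMr ?pos1// mulrC; apply: le_lt_trans.
  by rewrite ler_wpM2r ?(ltW eps0)// lerDl.
have Ndv : N%:R * (eps * c) < dv / 2.
  have : N%:R * c * eps < dv / 2.
    move: epsv; rewrite ltr_pdivlMr ?pos1// mulrC; apply: le_lt_trans.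
    by rewrite ler_wpM2r ?(ltW eps0)// lerDl.
  by rewrite [eps * c]mulrC mulrA.
have LAe : (L + As) * K * eps <= eta1 / 5.
  apply: ltW; move: epsA; rewrite ltr_pdivlMr ?pos1// mulrC; apply: le_lt_trans.
  by rewrite ler_wpM2r ?(ltW eps0)// lerDl.
move: Kd; rewrite lt_min => /andP[Kd Ka].
have close := needle_closeness (ltW eps0) bal xal.
pose l i := eps * al i.
have l0 i : 0 <= l i by rewrite mulr_ge0 ?(ltW eps0)//; case/andP: (bal i).
pose s i := nstart tn c eps i.
pose phi i := ramp (l i) (s i).
(* Each response is weighed by the length of its needle already elapsed, so that at [T] the function
   [r] is the error to be estimated. The three terms of [G] pay for good instants, bad instants and
   needles. *)
pose r t := x t - X0 t - \sum_i phi i t *: y i t.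
pose G t := eta1 * (K * eps) * t + (L + As) * (K * eps) * m t + eta1 * \sum_i phi i t.
have k1 : 0 <= eta1 * (K * eps) by apply: mulr_ge0; [exact: ltW|apply: mulr_ge0 => //; exact: ltW].
have k2 : 0 <= (L + As) * (K * eps) by apply: mulr_ge0; [exact: addr_ge0|apply: mulr_ge0 => //; exact: ltW].
have phim i : {homo phi i : u v / u <= v} by exact: ramp_mono.
have Gc : continuous G.
  move=> t; apply: cvgD.
    apply: cvgD; first by apply: cvgM (cvg_cst _) _; exact: cvg_id.
    by apply: cvgM (cvg_cst _) _; exact: mc.
  apply: cvgM (cvg_cst _) _; apply: sum_continuous => i; exact: ramp_continuous.
have Gm : {homo G : u v / u <= v}.
  move=> u v uv; rewrite /G !lerD//.
  - by rewrite ler_wpM2l.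
  - by rewrite ler_wpM2l// mm.
  - by rewrite ler_wpM2l ?(ltW eta10)// ler_sum// => i _; exact: phim.
have [xc xi xd] := xal.
have rc : continuous r.
  move=> t; apply: cvgB; first by apply: cvgB; [exact: xc|exact: (xbar_continuous P)].
  apply: sum_continuous => i u; apply: cvgZ; [exact: ramp_continuous|exact: yc].
have si0 i : 0 <= s i by apply: le_trans (tn_nstart tn c_ge0 i eps0); case/andP: (tn_itv i).
have r0 : r 0 = 0.
  rewrite /r xi (xbarE (x0 := x0)) ?lexx// subrr big1 ?subr0// => i _.
  by rewrite /phi ramp0// scale0r.
have rT : r T = x T - x0 T - eps *: \sum_i al i *: y i T.
  rewrite /r (xbarE (x0 := x0)) ?lexx ?T0//; congr (_ - _); rewrite scaler_sumr.
  apply: eq_bigr => i _; rewrite scalerA /phi ramp_top//.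
  exact/ltW/(needle_lt_T c_ge0 i sc bal).
pose Fall := Fs ++ FX ++ F0 ++ flatten [seq Fy i | i <- enum 'I_N] ++ map s (enum 'I_N)
  ++ map (fun i => s i + l i) (enum 'I_N).
have := @gronwall _ _ r G Fall 0 T As T0 As0 rc Gc Gm.
rewrite r0 normr0 add0r subr0 rT => H; apply: le_trans (H _) _.
  move=> t tT; rewrite /Fall !mem_cat !negb_or => /and5P[tFs tFX tF0 tFy /andP[ts te]].
  have t01 : 0 <= t <= T by case/andP: tT => *; rewrite !ltW.
  have tFyi i : t \notin Fy i.
    by apply: contra tFy => tF; apply/flatten_mapP; exists i; rewrite ?mem_enum.
  have tsi i : t != s i by apply: contraNneq ts => ->; apply: map_f; rewrite mem_enum.
  have tei i : t != s i + l i.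
    by apply: contraNneq te => ->; apply: (map_f (fun i => s i + l i)); rewrite mem_enum.
  pose u := needle_control (u0 := u0) tn vn c eps al t.
  have uM : M u by apply: (@needle_control_M _ _ u0 _ tn vn c M eps al t); [exact: Mu0|exact: Mvn].
  pose z := x t - X0 t.
  have zK : `|z| <= K * eps by exact: close.
  have za : `|z| <= a by exact: le_trans zK (ltW Ka).
  have xz : x t = X0 t + z by rewrite /z subrKC.
  have dX : is_derive t 1 X0 (f t (X0 t) (u0 t)).
    have [_ _ X'd] := XP FX (fun _ h => h).
    by rewrite -(Fm_id HM) ?subrr ?normr0 ?(ltW (tube_a HM))//; exact: X'd.
  have dx : is_derive t 1 x (f t (x t) u) by rewrite -(Fm_id HM)//; exact: xd.
  pose S1 := \sum_i (in_needle tn c eps al i t)%:R *: y i t.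
  (* The defect is separated from [A t (r t)], which Gronwall absorbs. *)
  have dr : is_derive t 1 r (f t (x t) u - f t (X0 t) (u0 t) - S1 - A t z + A t (r t)).
    have -> : f t (x t) u - f t (X0 t) (u0 t) - S1 - A t z + A t (r t) =
      f t (x t) u - f t (X0 t) (u0 t) - \sum_i ((in_needle tn c eps al i t)%:R *: y i t +
       phi i t *: A t (y i t)).
      have -> : A t (r t) = A t z - \sum_i phi i t *: A t (y i t).
        rewrite /r -/z raddfB raddf_sum; congr (_ - _).
        by apply: eq_bigr => i _; rewrite /= linearZ.
      by rewrite big_split /= -/S1 opprD !addrA subrK.
    have d2 : is_derive t 1 (fun t => \sum_i phi i t *: y i t)
        (\sum_i ((in_needle tn c eps al i t)%:R *: y i t + phi i t *: A t (y i t))).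
      have -> : (fun t => \sum_i phi i t *: y i t) = \sum_(i < N) (fun t => phi i t *: y i t).
        by apply/funext => t'; rewrite fct_sumE.
      apply: is_derive_sum => i.
      exact: (needle_summand_derive eps0 bal (FyP i) tT (tFyi i) (tsi i) (tei i)).
    exact: (is_deriveB (is_deriveB dx dX) d2).
  have Ar : `|A t (r t)| <= As * `|r t|.
    by apply: le_trans (opnormP _ _) _; rewrite ler_wpM2r//; exact: AsP.
  have Az : `|A t z| <= As * (K * eps).
    by apply: le_trans (opnormP _ _) _; apply: ler_pM => //; [exact: opnorm_ge0|exact: AsP].
  have fz v : M v -> `|f t (x t) v - f t (X0 t) v| <= L * (K * eps).
    move=> vM; have := tube_lip HM t01 vM za (w' := 0).
    rewrite normr0 addr0 subr0 -xz => /(_ (ltW (tube_a HM)))/le_trans; apply.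
    by rewrite ler_wpM2l.
  have later : \forall s' \near t^'+, t < s' < t + 1 /\ s' \notin [::].
    by apply: near_right_notin; rewrite ltrDl.
  have GE s' : G s' - G t = eta1 * (K * eps) * (s' - t) +
      (L + As) * (K * eps) * (m s' - m t) + eta1 * (\sum_i (phi i s' - phi i t)).
    by rewrite /G sumrB; ring.
  have sum0 s' : t < s' -> 0 <= \sum_i (phi i s' - phi i t).
    by move=> ts'; apply: sumr_ge0 => i _; rewrite subr_ge0; apply/phim/ltW.
  have reduce g : `|f t (x t) u - f t (X0 t) (u0 t) - S1 - A t z| <= g ->
     (forall eta0, 0 < eta0 -> \forall s' \near t^'+,
        `|r s' - r t| <= (As * `|r t| + g + eta0) * (s' - t)).
    move=> le e e_gt0; apply: is_derive_right_growth dr _ _ e_gt0.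
    by rewrite addrC; apply: le_trans (ler_normD _ _) _; exact: lerD.
  have [/existsP[i ti]|] := boolP [exists i, in_needle tn c eps al i t].
    have S1E : S1 = y i t.
      rewrite /S1 (bigD1 i)//= ti scale1r big1 ?addr0// => j ji.
      case: (boolP (in_needle tn c eps al j t)) => tj; last by rewrite scale0r.
      by rewrite (needle_disjoint c_ge0 sc bal tj ti) eqxx in ji.
    have uE : u = vn i by exact: (needle_control_in vn c_ge0 sc bal ti).
    have /andP[sit tie] := ti.
    have tint : tn i < t < tn i + dv / 2.
      apply/andP; split.
        by apply: le_lt_trans (tn_nstart tn c_ge0 i eps0) _; rewrite lt_neqAle eq_sym tsi.
      apply: lt_le_trans tie _; apply: le_trans (needle_end tn i eps0 bal) _.
      rewrite lerD2l; apply: le_trans (ltW Ndv).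
      by rewrite ler_wpM2r ?mulr_ge0 ?(ltW eps0)// ler_nat ltn_ord.
    have dvh : 0 < dv / 2 < 0 + dv by lra.
    have [v1 v2 v3] := dvP _ dvh i t tint.
    have ytn : y i (tn i) = needle_jump (tn i) (vn i).
      have /andP[ti0 /ltW tiT] := tn_itv i.
      by apply: response_frozen; rewrite ?ti0 ?lexx.
    exists eta1; split.
      apply: reduce; rewrite S1E uE.
      rewrite (needle_defect (f t (X0 t) (vn i)) _ _ (f (tn i) (X0 (tn i)) (vn i))
        (f (tn i) (X0 (tn i)) (u0 (tn i)))) -/(needle_jump (tn i) (vn i)) -ytn.
      have f1 := fz _ (Mvn i).
      by apply: le_trans (ler_norm5 _ _ _ _ _) _; lra.
    apply: filterS2 later (ramp_growth ti) => s' [/andP[ts' _] _] ph.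
    rewrite GE -[X in X <= _]add0r lerD//.
      rewrite addr_ge0//; first by rewrite mulr_ge0// subr_ge0 ltW.
      by rewrite mulr_ge0// subr_ge0 mm// ltW.
    rewrite ler_wpM2l ?(ltW eta10)// (bigD1 i)//= -[X in X <= _]addr0 lerD//.
    by apply: sumr_ge0 => j _; rewrite subr_ge0; apply/phim/ltW.
  rewrite negb_exists => /forallP tout.
  have S1E : S1 = 0 by rewrite /S1 big1// => i _; rewrite (negbTE (tout i)) scale0r.
  have uE : u = u0 t by exact: needle_control_out.
  rewrite S1E subr0 uE in reduce.
  (* Outside the needles the defect is the Fréchet remainder at [z]. At a bad instant it is bounded
     only by Lipschitz estimates, and the clock [m], of total increase at most [eta1], pays. *)
  have [Pt|mt] := mP t tT tF0.
    exists (eta1 * (K * eps)); split.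
      apply: reduce; rewrite xz; apply: le_trans (Pt z (le_lt_trans zK Kd)) _.
      by rewrite ler_wpM2l// ltW.
    apply: filterS later => s' [/andP[ts' _] _]; rewrite GE -addrA lerDl addr_ge0//.
      by rewrite mulr_ge0// subr_ge0 mm// ltW.
    by rewrite mulr_ge0 ?(ltW eta10)// sum0.
  exists ((L + As) * (K * eps)); split.
    apply: reduce; apply: le_trans (ler_normB _ _) _; rewrite mulrDl lerD//.
    by rewrite -uE; exact: fz.
  apply: filterS2 later mt => s' [/andP[ts' _] _] ms'; rewrite GE.
  rewrite addrAC -[X in X <= _]add0r lerD//.
    rewrite addr_ge0//; first by rewrite mulr_ge0// subr_ge0 ltW.
    by rewrite mulr_ge0 ?(ltW eta10)// sum0.
  by rewrite ler_wpM2l.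
have q0 : 0 < K * T + (L + As) * K + N%:R * c + 1.
  by rewrite ltr_wpDl// addr_ge0// addr_ge0.
have -> : eta * eps = expR (As * T) * (eta1 * eps * (K * T + (L + As) * K + N%:R * c + 1)).
  by rewrite /eta1 /Q; field; rewrite !gt_eqF ?expR_gt0.
rewrite ler_wpM2l ?expR_ge0//.
have phiT : \sum_i (phi i T - phi i 0) <= N%:R * (eps * c).
  have -> : N%:R * (eps * c) = \sum_(i < N) eps * c by rewrite sumr_const card_ord mulr_natl.
  apply: ler_sum => i _; apply: le_trans (_ : phi i T <= _).
    by rewrite gerBl ramp_ge0.
  apply: le_trans (ramp_le _ _ (l0 i)) _; rewrite ler_wpM2l ?(ltW eps0)//.
  by case/andP: (bal i).
have -> : G T - G 0 = eta1 * (K * eps) * T +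
    (L + As) * (K * eps) * (m T - m 0) + eta1 * (\sum_i (phi i T - phi i 0)).
  by rewrite /G sumrB; ring.
have h1 := ler_wpM2l k2 mT.
have h2 := ler_wpM2l (ltW eta10) phiT.
have h3 : 0 <= eta1 * eps by rewrite mulr_ge0 ?ltW.
move: h1 h2 h3; lra.
Qed.

End InTube.
End NeedleExpansion.

End Expansion.

(** * Zeros on the simplex and separation of cones *)

Section SimplexZero.
Context {R : realType}.

(** With [G x] the perturbation extended by 0 at the last coordinate, the map [f] subtracts [G x]
    from the barycentre and restores the sum 1. At a fixed point all [x j + G x j] are equal. The
    bound [1 / (2 n)] on both corrections keeps the values of [f] nonnegative. *)
Lemma simplex_zero q (e : 'rV[R]_q.+1 -> 'I_q -> R) : (0 < q)%N ->
  (forall b, {within @simplex R q.+1, continuous (fun x => e x b)}) ->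
  (forall x b, @simplex R q.+1 x -> `|e x b| <= (2 * q.+1%:R)^-1) ->
  exists2 x, @simplex R q.+1 x & forall b, x ord0 (lift ord_max b) + e x b = x ord0 ord_max.
Proof.
move=> q0 ec eb; pose n : R := q.+1%:R.
have n0 : 0 < n by rewrite ltr0n.
pose G x (j : 'I_q.+1) := if unlift ord_max j is Some b then e x b else 0.
have Gb x j : @simplex R q.+1 x -> `|G x j| <= (2 * n)^-1.
  move=> xS; rewrite /G; case: unlift => [b|]; first exact: eb.
  by rewrite normr0 invr_ge0 mulr_ge0// ltW.
pose f (x : 'rV[R]_q.+1) : 'rV[R]_q.+1 := \row_j (n^-1 + n^-1 * (\sum_i G x i) - G x j).
have Gc j : {within @simplex R q.+1, continuous (fun x => G x j)}.
  rewrite /G; case: unlift => [b|]; first exact: ec.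
  by apply: continuous_subspaceT; exact: cst_continuous.
have [||x xS fx] := @brouwer_simplex R q.+1 f q0.
- apply/subspace_continuousP => x xS.
  have Gx j := (subspace_continuousP _ _).1 (Gc j) x xS.
  have Gs : \sum_i G y i @[y --> within (@simplex R q.+1) (nbhs x)] --> \sum_i G x i.
    by apply: (cvg_big (op := +%R)) => [|i _]; [exact: add_continuous|exact: Gx].
  have fj j : f y ord0 j @[y --> within (@simplex R q.+1) (nbhs x)] --> f x ord0 j.
    rewrite mxE; under eq_cvg do rewrite mxE.
    by apply: cvgB (Gx j); apply: cvgD (cvg_cst _) _; apply: cvgM (cvg_cst _) Gs.
  apply/cvgrPdist_le => eps eps0.
  have : \forall y \near within (@simplex R q.+1) (nbhs x), forall j, `|f x ord0 j - f y ord0 j| <= eps.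
    by apply: filter_forall => j; move/cvgrPdist_le : (fj j); apply.
  apply: filterS => y ye; apply: rV_norm_le; first exact: ltW.
  by move=> j; rewrite !mxE; have := ye j; rewrite !mxE.
- move=> x xS; split=> [j|].
    have sG : - (2 * n)^-1 <= n^-1 * \sum_i G x i.
      rewrite -ler_pdivrMl ?invr_gt0// invrK mulrN.
      have -> : n * (2 * n)^-1 = \sum_(i < q.+1) (2 * n)^-1.
        by rewrite sumr_const card_ord /n mulr_natl.
      rewrite -sumrN; apply: ler_sum => i _.
      by have := Gb x i xS; rewrite ler_norml => /andP[].
    have := Gb x j xS; rewrite ler_norml => /andP[_ Gj].
    have E : n^-1 = (2 * n)^-1 + (2 * n)^-1 by field; rewrite gt_eqF.
    rewrite mxE E -E; move: sG; set S1 := n^-1 * _ => sG.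
    rewrite subr_ge0; apply: le_trans Gj _.
    by rewrite [X in _ <= X + _]E -addrA lerDl -lerBlDl sub0r.
  under eq_bigr do rewrite mxE.
  rewrite sumrB big_split /= !sumr_const card_ord.
  rewrite -(mulr_natl (n^-1)) -(mulr_natl (n^-1 * _)) -/n mulVKf ?gt_eqF//.
  by rewrite mulfV ?gt_eqF// addrK.
exists x => // b.
have E j : x ord0 j + G x j = n^-1 + n^-1 * \sum_i G x i by rewrite -{1}fx mxE subrK.
have := E (lift ord_max b); rewrite -(E ord_max) /G liftK unlift_none addr0.
by [].
Qed.

End SimplexZero.

Section Separation.
Context {R : realType} {n : nat}.
Implicit Types (K : set 'rV[R]_n) (k v : 'rV[R]_n).

(** If [v] is at positive distance from [K], the normal [lam] is [v - p], where [p] is the Euclidean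
    projection of [v] on the closure of [K]. The sum of squares [g] is minimised, the norm of row
    vectors being the maximum norm. *)
Lemma cone_dichotomy K : K 0 -> (forall k k', K k -> K k' -> K (k + k')) ->
  (forall t k, 0 <= t -> K k -> K (t *: k)) ->
  (forall v d, 0 < d -> exists2 k, K k & `|v - k| < d) \/
  exists2 lam : 'rV[R]_n, lam != 0 & forall k, K k -> \sum_i lam ord0 i * k ord0 i <= 0.
Proof.
move=> K0 KD KZ; have [dense|nd] := pselect (forall v d, 0 < d -> exists2 k, K k & `|v - k| < d).
  by left.
right; have [v [d d0 vK]] : exists v, exists2 d, 0 < d & forall k, K k -> d <= `|v - k|.
  apply: contrapT => nex; apply: nd => v d d0; apply: contrapT => nk; apply: nex.
  exists v, d => // k Kk; rewrite leNgt; apply/negP => lt; apply: nk.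
  by exists k.
pose g k := \sum_i (v ord0 i - k ord0 i) ^+ 2.
have gc : continuous g.
  apply: continuous_big => [|i _ k]; first exact: add_continuous.
  apply: (@continuous_comp _ _ _ (fun k : 'rV[R]_n => k ord0 i) (fun z : R => (v ord0 i - z) ^+ 2)).
    exact: coord_continuous.
  by apply: cvgM; apply: cvgB (cvg_cst _) _; exact: cvg_id.
pose S := closure K `&` (g @^-1` [set z | z <= g 0]).
have Sc : compact S.
  apply: bounded_closed_compact.
    exists (`|v| + g 0 + 1); split; first exact: num_real.
    move=> M lM k [_ gk]; apply: le_trans (ltW lM); apply: rV_norm_le.
      by rewrite !addr_ge0// sumr_ge0// => i _; exact: sqr_ge0.
    move=> i; have gi : (v ord0 i - k ord0 i) ^+ 2 <= g 0.
      apply: le_trans gk; rewrite /g (bigD1 i)//= lerDl sumr_ge0// => j _; exact: sqr_ge0.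
    rewrite -[k ord0 i](subrKC (v ord0 i)) (le_trans (ler_normD _ _))// -addrA lerD//.
      exact: rV_coord_le.
    rewrite distrC; move: gi; rewrite -[X in X <= _]real_normK ?num_real//.
    have := sqr_ge0 (`|v ord0 i - k ord0 i| - 1).
    have := normr_ge0 (v ord0 i - k ord0 i).
    by move: `|_ - _| => z z0; rewrite sqrrB expr1n mulr1; nra.
  apply: closedI; first exact: closed_closure.
  by apply: preimage_closed; [move=> x _; exact: gc|exact: closed_le].
have S0 : S 0 by split; [exact: subset_closure|exact: lexx].
have [p + pmin] : exists2 p : 'rV[R]_n, p \in S & forall k, k \in S -> g p <= g k.
  by apply: compact_EVT_min => //; [exists 0|apply: continuous_subspaceT].
rewrite inE => -[pK /= pg].
have {}pmin k : closure K k -> g p <= g k.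
  move=> kK; have [gk|gk] := leP (g k) (g 0); first by apply: pmin; rewrite inE.
  exact: le_trans pg (ltW gk).
have pD t k : 0 <= t -> K k -> closure K (p + t *: k).
  move=> t0 Kk B /nbhs_ballP[e /= e0 eB].
  have : nbhs p (ball p e) by apply: nbhsx_ballx.
  move=> /pK[k' [Kk' pk']]; exists (k' + t *: k); split; first by apply: KD => //; exact: KZ.
  apply: eB; move: pk'; rewrite -ball_normE /=.
  by rewrite opprD addrACA subrr addr0.
exists (v - p).
  apply/eqP => vp; have : nbhs p (ball p d) by exact: nbhsx_ballx.
  move=> /pK[k [Kk]]; rewrite -ball_normE /=; have -> : p = v by apply/esym/subr0_eq.
  by rewrite ltNge vK.
move=> k Kk; pose a := \sum_i (v - p) ord0 i * k ord0 i; pose b := \sum_i k ord0 i ^+ 2.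
have b0 : 0 <= b by apply: sumr_ge0 => i _; exact: sqr_ge0.
have gE t : g (p + t *: k) = g p - 2 * t * a + t ^+ 2 * b.
  rewrite /g /a /b !mulr_sumr -sumrB -big_split /=; apply: eq_bigr => i _.
  by rewrite !mxE; ring.
(* Minimality of [p] along the ray [p + t k]; a positive [a] is then refuted by
   [t = a / (b + 1)]. *)
have key t : 0 < t -> 2 * a <= t * b.
  move=> t0; have := pmin _ (pD t k (ltW t0) Kk); rewrite gE.
  rewrite -addrA lerDl addrC subr_ge0 => H.
  have E : t * (2 * a) = 2 * t * a by ring.
  by rewrite -(ler_pM2l t0) E mulrA -expr2.
rewrite -/a leNgt; apply/negP => a0.
have b1 : 0 < b + 1 by rewrite ltr_wpDl.
have := key _ (divr_gt0 a0 b1); rewrite leNgt => /negP; apply.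
rewrite mulrAC ltr_pdivrMr//; move: a b a0 b0 {b1 gE key} => a b a0 b0.
by have := mulr_ge0 (ltW a0) b0; lra.
Qed.

End Separation.

(** * Multipliers *)

Section NeedleFamily.
Context {R : realType} {E : completeNormedModType R} {Y : normedModType R}.
Context {T : R} {Omega : set E} {U : set Y} {f : R -> E -> Y -> E} {x0 : R -> E} {u0 : R -> Y}.
Variable P : process T Omega U f x0 u0.

(** The tube and the retracted dynamics are hidden here: what follows deals only with trajectories
    of [f] itself, their dependence on the lengths and their expansion. *)
Lemma needle_family (N : nat) (tn : 'I_N -> R) (vn : 'I_N -> Y) (c : R) (y : 'I_N -> R -> E) :
  (forall i, 0 <= tn i < T) -> (forall i, U (vn i)) -> 0 <= c ->
  (forall i, @is_response _ _ _ T f x0 u0 (tn i) (vn i) (y i)) ->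
  exists (X : R -> ('I_N -> R) -> R -> E) (u : R -> ('I_N -> R) -> R -> Y) (C : R), 0 <= C /\
  ((\forall eps \near 0^'+, forall al, box c al ->
    [/\ PC1 T Omega (X eps al) /\ NPC0 T U (u eps al),
        forall t, t \in `[0, T] -> ext_deriv T (X eps al) t = f t (X eps al t) (u eps al t),
        X eps al 0 = x0 0 &
        forall be, box c be -> `|X eps al T - X eps be T| <= C * eps * \sum_i `|al i - be i|]) /\
   forall eta, 0 < eta -> \forall eps \near 0^'+, forall al, box c al ->
     `|X eps al T - x0 T - eps *: \sum_i al i *: y i T| <= eta * eps).
Proof.
move=> tn_itv vn_U c0 yP.
have [M [Mc M0 MU Mu0 Mvn]] := needle_hull P vn_U.
have [a [L [B HM]]] := exists_tube P Mc M0 MU.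
pose u eps al := needle_control (u0 := u0) tn vn c eps al.
have /choice[X XP] : forall p : R * ('I_N -> R), exists x : R -> E,
    small_scale (T := T) tn c p.1 -> box c p.2 ->
    exists2 Fs, pcont U Fs 0 T (u p.1 p.2) & @is_traj _ _ _ T f x0 a (u p.1 p.2) Fs x.
  move=> [eps al] /=; have [[sc bal]|n] := pselect (small_scale (T := T) tn c eps /\ box c al); last first.
    by exists (cst 0) => sc bal; case: n.
  have [_ [Fs up]] := needle_control_NPC0 P tn_itv vn_U c0 sc bal.
  have [t tT|x xP] := exists_traj P HM up.
    by apply: needle_control_M; [exact: Mu0|exact: Mvn].
  by exists x => _ _; exists Fs.
pose K := expR (2 * L * T) * (2 * B) * (N%:R * c).
have B0 := tube_B HM.
have K0 : 0 <= K by rewrite !mulr_ge0 ?expR_ge0.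
have [e0 e00 e0P] := near_small_scale tn_itv c0.
have near_sc : \forall eps \near (0 : R)^'+, 0 < eps /\ small_scale (T := T) tn c eps.
  apply/at_right_dist; exists e0 => // eps; rewrite add0r => /andP[h1 h2].
  by split=> //; apply: e0P; rewrite h1.
exists (fun eps al => X (eps, al)), u, (expR (2 * L * T) * (2 * B)).
split; first by rewrite !mulr_ge0 ?expR_ge0.
split=> [|eta eta0].
  have near_a : \forall eps \near (0 : R)^'+, K * eps <= a.
    apply/at_right_dist; exists (a / (K + 1)); first by rewrite divr_gt0 ?(tube_a HM)// ltr_wpDl.
    move=> eps; rewrite add0r ltr_pdivlMr ?ltr_wpDl// => /andP[h1 /ltW]; apply: le_trans.
    by rewrite mulrC ler_wpM2l ?(ltW h1)// lerDl.
  apply: filterS2 near_sc near_a => eps [eps0 sc] Ka al bal.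
  have [Fs up xal] := XP (eps, al) sc bal.
  have [uN _] := needle_control_NPC0 P tn_itv vn_U c0 sc bal.
  have close := needle_closeness P HM Mu0 Mvn (ltW eps0) bal xal.
  have [h1 h2] := traj_admissible P HM uN up xal (fun t tT => le_trans (close t tT) Ka).
  split=> //; first by case: xal.
  move=> be bbe; have [Fs' up' xbe] := XP (eps, be) sc bbe.
  have s1 : {subset Fs <= Fs ++ Fs'} by move=> r rF; rewrite mem_cat rF.
  have s2 : {subset Fs' <= Fs ++ Fs'} by move=> r rF; rewrite mem_cat rF orbT.
  apply: (needle_lipschitz P HM Mu0 Mvn (ltW eps0) (is_traj_sub s1 xal) (is_traj_sub s2 xbe)).
  by rewrite (T_ge0 P) lexx.
have [e1 e10 e1P] := needle_expansion P tn_itv vn_U c0 HM Mu0 Mvn yP eta0.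
have near_e1 : \forall eps \near (0 : R)^'+, 0 < eps < e1.
  by apply/at_right_dist; exists e1 => // eps; rewrite add0r.
apply: filterS2 near_sc near_e1 => eps [eps0 sc] e al bal.
by have [Fs _ xal] := XP (eps, al) sc bal; exact: e1P xal.
Qed.

End NeedleFamily.

(** The number of needles is a field so that families can be concatenated, which makes the cone of
    variations closed under addition. *)
Record needles {R : realType} {E : completeNormedModType R} {Y : normedModType R} := Needles {
  nd_size : nat;
  nd_time : 'I_nd_size -> R;
  nd_value : 'I_nd_size -> Y;
  nd_response : 'I_nd_size -> R -> E;
  nd_weight : 'I_nd_size -> R }.

Section Multipliers.
Context {R : realType} {E : completeNormedModType R} {Y : normedModType R}.
Context {T : R} {Omega : set E} {U : set Y} {f : R -> E -> Y -> E} {x0 : R -> E} {u0 : R -> Y}.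
Variable P : process T Omega U f x0 u0.
Context {l m q : nat} {g0 : 'I_l -> E -> R^o} {g : 'I_m -> E -> R^o} {h : 'I_q -> E -> R^o}.
Local Notation xT := (x0 T).
Local Notation J := ('I_l + 'I_m + 'I_q)%type.
Local Notation response := (@is_response _ _ _ T f x0 u0).
Local Notation needles := (@needles R E Y).

Definition cost (j : J) : E -> R^o :=
  match j with inl (inl i) => g0 i | inl (inr a) => g a | inr b => h b end.

Definition dcost j : blin E R^o := Dhadamard (cost j) xT.

Definition is_needles (n : needles) := forall i : 'I_(nd_size n),
  [/\ 0 <= nd_time i < T, U (nd_value i), response (nd_time i) (nd_value i) (nd_response i) &
      0 <= nd_weight i].

Definition dresponse (n : needles) : E := \sum_i nd_weight i *: nd_response (n := n) i T.

(* Variations of inequality data may be lowered at will, and those of the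
   constraints inactive at [x0 T] are irrelevant. *)
Definition slack_rel (j : J) (k s : R) : Prop :=
  match j with
  | inl (inl _) => k <= s
  | inl (inr a) => g a xT = 0 -> k <= s
  | inr _ => k = s
  end.

Definition variation_cone : set 'rV[R]_#|{: J}| := [set k | exists2 n, is_needles n &
  forall j, slack_rel j (k ord0 (enum_rank j)) (dcost j (dresponse n))].

Definition needles0 : needles :=
  @Needles R E Y 0 (fun=> 0) (fun=> 0) (fun _ _ => 0) (fun=> 0).

Lemma is_needles0 : is_needles needles0. Proof. by case. Qed.

Lemma dresponse0 : dresponse needles0 = 0. Proof. by rewrite /dresponse big_ord0. Qed.

Definition needlesD (n1 n2 : needles) : needles :=
  @Needles R E Y (nd_size n1 + nd_size n2)
    (fun i => match fintype.split i with inl i => nd_time i | inr i => nd_time i end)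
    (fun i => match fintype.split i with inl i => nd_value i | inr i => nd_value i end)
    (fun i => match fintype.split i with inl i => nd_response i | inr i => nd_response i end)
    (fun i => match fintype.split i with inl i => nd_weight i | inr i => nd_weight i end).

Lemma is_needlesD n1 n2 : is_needles n1 -> is_needles n2 -> is_needles (needlesD n1 n2).
Proof. by move=> h1 h2 i /=; case: fintype.split => j; [exact: h1|exact: h2]. Qed.

Lemma dresponseD n1 n2 : dresponse (needlesD n1 n2) = dresponse n1 + dresponse n2.
Proof.
rewrite /dresponse big_split_ord /=; congr (_ + _); apply: eq_bigr => i _.
  by have -> : fintype.split (lshift (nd_size n2) i) = inl i := unsplitK (inl i).
by have -> : fintype.split (rshift (nd_size n1) i) = inr i := unsplitK (inr i).
Qed.

Definition needlesZ t (n : needles) : needles :=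
  @Needles R E Y (nd_size n) (@nd_time _ _ _ n) (@nd_value _ _ _ n) (@nd_response _ _ _ n)
    (fun i => t * nd_weight i).

Lemma is_needlesZ t n : 0 <= t -> is_needles n -> is_needles (needlesZ t n).
Proof. by move=> t0 hn i; have [? ? ? ?] := hn i; split=> //=; rewrite mulr_ge0. Qed.

Lemma dresponseZ t n : dresponse (needlesZ t n) = t *: dresponse n.
Proof. by rewrite /dresponse scaler_sumr; apply: eq_bigr => i _; rewrite scalerA. Qed.

Lemma variation_coneD (k k' : 'rV[R]_#|{: J}|) : variation_cone k -> variation_cone k' -> variation_cone (k + k').
Proof.
move=> [n nn kn] [n' nn' kn']; exists (needlesD n n'); first exact: is_needlesD.
move=> j; have := kn j; have := kn' j; rewrite dresponseD raddfD /= mxE /slack_rel.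
case: j => [[i|i]|i] //.
- by move=> *; rewrite lerD.
- by move=> h1 h2 /[dup] /h1 ? /h2 ?; rewrite lerD.
- by move=> -> ->.
Qed.

Lemma variation_coneZ t (k : 'rV[R]_#|{: J}|) : 0 <= t -> variation_cone k -> variation_cone (t *: k).
Proof.
move=> t0 [n nn kn]; exists (needlesZ t n); first exact: is_needlesZ.
move=> j; have := kn j; rewrite dresponseZ linearZ /= mxE /slack_rel.
case: j => [[i|i]|i] //.
- by move=> *; rewrite ler_wpM2l.
- by move=> h1 /h1 ?; rewrite ler_wpM2l.
- by move=> ->.
Qed.

Lemma variation_cone_slack (k : 'rV[R]_#|{: J}|) : (forall j, slack_rel j (k ord0 (enum_rank j)) 0) ->
  variation_cone k.
Proof.
move=> kP; exists needles0; first exact: is_needles0.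
by move=> j; rewrite dresponse0 raddf0; exact: kP.
Qed.

(** The slack makes the cone contain the negative half-axes of objectives and inequality
    constraints, and the whole axis of an inactive constraint: hence the signs and the complementary
    slackness. A single needle of weight 1 gives the last inequality. *)
Lemma separated_multipliers (lam : 'rV[R]_#|{: J}|) : lam != 0 ->
  (forall a, 0 <= g a xT) ->
  (forall k, variation_cone k -> \sum_i lam ord0 i * k ord0 i <= 0) ->
  exists mult : J -> R, [/\ exists j, mult j != 0,
    forall i, 0 <= mult (inl (inl i)),
    forall a, 0 <= mult (inl (inr a)) /\ mult (inl (inr a)) * g a xT = 0 &
    forall t v y, 0 <= t < T -> U v -> response t v y ->
      \sum_j mult j * dcost j (y T) <= 0].
Proof.
move=> lam0 ga lamK; pose mult j := lam ord0 (enum_rank j).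
have sumE (k : 'rV[R]_#|{: J}|) : \sum_i lam ord0 i * k ord0 i =
    \sum_j mult j * k ord0 (enum_rank j).
  rewrite (reindex enum_rank) //=; exact/onW_bij/enum_rank_bij.
have delta j0 s : (forall j, slack_rel j (s * (j == j0)%:R) 0) -> mult j0 * s <= 0.
  move=> sl; have := lamK (\row_i (s * (enum_val i == j0)%:R)); rewrite sumE => H.
  have -> : mult j0 * s = \sum_j mult j * (\row_i (s * (enum_val i == j0)%:R)) ord0 (enum_rank j).
    rewrite (bigD1 j0)//= mxE enum_rankK eqxx mulr1 big1 ?addr0// => j jj0.
    by rewrite mxE enum_rankK (negbTE jj0) !mulr0.
  apply: H; apply: variation_cone_slack => j; rewrite mxE enum_rankK; exact: sl.
have neg1 j0 : (if j0 is inr _ then false else true) -> 0 <= mult j0.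
  move=> nb; have := delta j0 (-1); rewrite mulrN1 oppr_le0; apply => j.
  rewrite mulN1r /slack_rel; case: j => [[i|a]|b]; rewrite ?oppr_le0 ?ler0n//.
  by case: eqP => [E0|_]; [rewrite -E0 in nb|rewrite oppr0].
exists mult; split.
- have /rV0Pn[i li] := lam0; exists (enum_val i); rewrite /mult enum_valK.
  exact: li.
- by move=> i; exact: neg1.
- move=> a; split; first exact: neg1.
  have [->|ga0] := eqVneq (g a xT) 0; first by rewrite mulr0.
  suff -> : mult (inl (inr a)) = 0 by rewrite mul0r.
  apply/le_anti; rewrite neg1// andbT -[mult _]mulr1; apply: delta => j.
  rewrite mul1r /slack_rel; case: j => [[i|a']|b]; rewrite ?lexx//.
  by case: eqP => [[->] ga0'|_]; [rewrite ga0' eqxx in ga0|].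
move=> t v y tT vU yP; pose n : needles := @Needles R E Y 1 (fun=> t) (fun=> v) (fun=> y) (fun=> 1).
have nE : dresponse n = y T by rewrite /dresponse big_ord1 scale1r.
have <- : \sum_i lam ord0 i * (\row_i dcost (enum_val i) (y T)) ord0 i =
    \sum_j mult j * dcost j (y T).
  by rewrite sumE; apply: eq_bigr => j _; rewrite mxE enum_rankK.
apply: lamK; exists n => [i|j]; first by split.
by rewrite mxE enum_rankK nE /slack_rel; case: j => [[i|a]|b].
Qed.

End Multipliers.

Lemma near_right_small {R : realType} (c r : R) : 0 < r ->
  \forall eps \near 0^'+, eps * c < r.
Proof.
move=> r0; apply/at_right_dist; exists (r / (`|c| + 1)); first by rewrite divr_gt0// ltr_wpDl.
move=> eps; rewrite add0r ltr_pdivlMr ?ltr_wpDl// => /andP[e0]; apply: le_lt_trans.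
by rewrite ler_wpM2l ?(ltW e0)// (le_trans (ler_norm _))// lerDl.
Qed.

(** * A dense cone of variations contradicts optimality *)

Section Pareto.
Context {R : realType} {E : completeNormedModType R} {Y : normedModType R}.
Context {T : R} {Omega : set E} {U : set Y} {f : R -> E -> Y -> E} {x0 : R -> E} {u0 : R -> Y}.
Variable P : process T Omega U f x0 u0.
Local Notation xT := (x0 T).
Local Notation needles := (@needles R E Y).
Local Notation dresponse := (@dresponse R E Y T).
Local Notation is_needles := (@is_needles R E Y T U f x0 u0).

(** All needles of all families are merged into one family indexed by a dependent sum, those of
    [n j] having their lengths multiplied by the [j]-th coordinate of [x]. The total weight [c]
    bounds all lengths, coordinates being at most 1. *)
Lemma needle_combination p (n : 'I_p -> needles) : (forall j, is_needles (n j)) ->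
  exists (X : R -> 'rV[R]_p -> R -> E) (u : R -> 'rV[R]_p -> R -> Y),
  (\forall eps \near 0^'+, forall x, @simplex R p x ->
    [/\ PC1 T Omega (X eps x) /\ NPC0 T U (u eps x),
        forall t, t \in `[0, T] -> ext_deriv T (X eps x) t = f t (X eps x t) (u eps x t),
        X eps x 0 = x0 0 &
        exists L, forall x', @simplex R p x' -> `|X eps x T - X eps x' T| <= L * `|x - x'|]) /\
  forall eta, 0 < eta -> \forall eps \near 0^'+, forall x, @simplex R p x ->
     `|X eps x T - xT - eps *: \sum_j x ord0 j *: dresponse (n j)| <= eta * eps.
Proof.
move=> nP; pose I := {j : 'I_p & 'I_(nd_size (n j))}.
pose nu (i : 'I_#|{: I}|) : I := enum_val i.
pose w i := nd_weight (tagged (nu i)).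
have w0 i : 0 <= w i by have [] := nP _ (tagged (nu i)).
pose al (x : 'rV[R]_p) i := x ord0 (tag (nu i)) * w i.
pose c := \sum_i w i.
have c0 : 0 <= c by apply: sumr_ge0.
have alP x : simplex x -> box c (al x).
  move=> [x_0 x_1] i; rewrite mulr_ge0//=.
  apply: (@le_trans _ _ (w i)); last by rewrite /c (bigD1 i)//= lerDl sumr_ge0.
  by rewrite ler_piMl// -x_1 (bigD1 (tag (nu i)))//= lerDl sumr_ge0.
have [||||X [u [C [C0 [XP Xe]]]]] := @needle_family _ _ _ _ _ _ _ _ _ P _
  (fun i => nd_time (tagged (nu i))) (fun i => nd_value (tagged (nu i))) c
  (fun i => nd_response (tagged (nu i))).
- by move=> i; have [] := nP _ (tagged (nu i)).
- by move=> i; have [] := nP _ (tagged (nu i)).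
- exact: c0.
- by move=> i; have [] := nP _ (tagged (nu i)).
exists (fun eps x => X eps (al x)), (fun eps x => u eps (al x)); split.
  have gt0 : \forall eps \near (0 : R)^'+, 0 < eps by exact: nbhs_right_gt.
  apply: filterS2 gt0 XP => eps eps0 XP x xS; have [h1 h2 h3 h4] := XP _ (alP _ xS).
  split=> //; exists (C * eps * c) => x' x'S.
  apply: le_trans (h4 _ (alP _ x'S)) _; rewrite -[leRHS]mulrA; apply: ler_wpM2l.
    by rewrite mulr_ge0 ?(ltW eps0).
  rewrite /c mulr_suml; apply: ler_sum => i _.
  rewrite /al -mulrBl normrM (ger0_norm (w0 i)) mulrC ler_wpM2l//.
  by have := rV_coord_le (x - x') (tag (nu i)); rewrite !mxE.
move=> eta /Xe; apply: filterS => eps XeP x xS; have := XeP _ (alP _ xS).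
suff -> : \sum_i al x i *: nd_response (tagged (nu i)) T = \sum_j x ord0 j *: dresponse (n j) by [].
pose F (i : I) := x ord0 (tag i) *: (nd_weight (tagged i) *: nd_response (tagged i) T).
transitivity (\sum_(i : I) F i).
  rewrite (reindex (enum_val : 'I_#|{: I}| -> I)) /=; last exact/onW_bij/enum_val_bij.
  by apply: eq_bigr => i _; rewrite /F /al scalerA.
rewrite [RHS](_ : _ = \sum_j \sum_(k < nd_size (n j)) F (Tagged (fun j => 'I_(nd_size (n j))) k)).
  rewrite sig_big_dep /=; apply: eq_bigr => -[j k] _ //.
by apply: eq_bigr => j _; rewrite /dresponse scaler_sumr.
Qed.


Context {l m q : nat} {g0 : 'I_l -> E -> R^o} {g : 'I_m -> E -> R^o} {h : 'I_q -> E -> R^o}.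
Local Notation J := ('I_l + 'I_m + 'I_q)%type.
Local Notation cost := (@cost R E l m q g0 g h).
Local Notation dcost := (@dcost R E T x0 l m q g0 g h).
Local Notation variation_cone := (@variation_cone R E Y T U f x0 u0 l m q g0 g h).

(* These directions raise the objectives and inequality constraints, and in the
   equality coordinates they are the vertices of a simplex around 0. *)
Definition improving (j : 'I_q.+1) (i : J) : R :=
  if i is inr b then (j == lift ord_max b)%:R - (j == ord_max)%:R else 1.

(** At scale [eps], the rescaled equality constraints differ from the differences [x b - x max] of
    barycentric coordinates by a small continuous error, so [simplex_zero] cancels them all at once.
    Objectives and active constraints rise at every point of the simplex, so the choice of [x] does
    not matter for them. *)
Lemma dense_cone_improves : (0 < q)%N ->
  (forall a, 0 <= g a xT) -> (forall b, h b xT = 0) ->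
  (forall b, \forall xi \near xT, {for xi, continuous (h b)}) ->
  (forall i, is_hadamard (cost i) xT (dcost i)) ->
  (forall v d, 0 < d -> exists2 k, variation_cone k & `|v - k| < d) ->
  exists x u, [/\ PC1 T Omega x /\ NPC0 T U u,
    forall t, t \in `[0, T] -> ext_deriv T x t = f t (x t) (u t),
    x 0 = x0 0, forall i, g0 i xT < g0 i (x T) &
    (forall a, 0 <= g a (x T)) /\ forall b, h b (x T) = 0].
Proof.
move=> q0 g_ge0 h0 h_cont hadC dense.
pose kap : R := (2 * q.+1%:R)^-1; pose de := kap / 4.
have kap0 : 0 < kap by rewrite invr_gt0 mulr_gt0.
have kap2 : kap <= 2^-1.
  by rewrite lef_pV2 ?posrE ?mulr_gt0// -[leLHS]mulr1 ler_wpM2l// ler1n.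
have [de0 de8] : 0 < de /\ de <= 8^-1 by rewrite /de; split; lra.
have /choice[n nP] : forall j : 'I_q.+1, exists n, is_needles n /\
    forall i, match i return Prop with
      | inl (inl _) => 1 - de <= dcost i (dresponse n)
      | inl (inr a) => g a xT = 0 -> 1 - de <= dcost i (dresponse n)
      | inr _ => `|dcost i (dresponse n) - improving j i| <= de
      end.
  move=> j; have [k [n nn kn] kd] := dense (\row_i improving j (enum_val i)) _ de0.
  exists n; split=> // i; have := kn i; have := rV_coord_le (\row_i improving j (enum_val i) - k) (enum_rank i).
  rewrite !mxE enum_rankK => /le_lt_trans/(_ kd) /ltW; rewrite /slack_rel.
  case: i => [[i|a]|b] /=.
  - by rewrite ler_distl => /andP[_ ?]; lra.
  - by rewrite ler_distl => /andP[_ ?] H /H ?; lra.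
  - by rewrite distrC => ? <-.
pose D j := dresponse (n j).
pose comb (x : 'rV[R]_q.+1) := \sum_j x ord0 j *: D j.
have combE i x : dcost i (comb x) = \sum_j x ord0 j * dcost i (D j).
  by rewrite /comb raddf_sum; apply: eq_bigr => j _; rewrite /= linearZ.
have comb_ge i x : simplex x -> (forall j, 1 - de <= dcost i (D j)) -> 1 - de <= dcost i (comb x).
  move=> [x_0 x_1] H; rewrite combE -[leLHS]mul1r -{1}x_1 mulr_suml; apply: ler_sum => j _.
  by rewrite ler_wpM2l.
have comb_h b x : simplex x ->
    `|dcost (inr b) (comb x) - (x ord0 (lift ord_max b) - x ord0 ord_max)| <= de.
  move=> [x_0 x_1].
  have -> : x ord0 (lift ord_max b) - x ord0 ord_max = \sum_j x ord0 j * improving j (inr b).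
    rewrite /improving; under eq_bigr do rewrite mulrBr.
    rewrite sumrB; congr (_ - _).
      by rewrite (bigD1 (lift ord_max b))//= eqxx mulr1 big1 ?addr0// => j /negbTE ->; rewrite mulr0.
    by rewrite (bigD1 ord_max)//= eqxx mulr1 big1 ?addr0// => j /negbTE ->; rewrite mulr0.
  rewrite combE -sumrB -[leRHS]mul1r -x_1 mulr_suml; apply: le_trans (ler_norm_sum _ _ _) _.
  apply: ler_sum => j _; rewrite -mulrBr normrM ger0_norm// ler_wpM2l//.
  by have [_ /(_ (inr b))] := nP j.
pose B := \sum_j `|D j|.
have B0 : 0 <= B by exact: sumr_ge0.
have combB x : simplex x -> `|comb x| <= B.
  move=> [x_0 x_1]; apply: le_trans (ler_norm_sum _ _ _) _; apply: ler_sum => j _.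
  by rewrite normrZ ger0_norm// ler_piMl// -x_1 (bigD1 j)//= lerDl sumr_ge0.
(* The first-order directions form a compact set, which is what Hadamard differentiability requires
   for uniform quotients. *)
have Kc : compact (comb @` @simplex R q.+1).
  apply: continuous_compact (compact_simplex (R := R) (N := q.+1)).
  apply: continuous_subspaceT; apply: continuous_big => [|j _ x]; first exact: add_continuous.
  apply: (@continuous_comp _ _ _ (fun x : 'rV[R]_q.+1 => x ord0 j) (fun z : R => z *: D j)).
    exact: coord_continuous.
  exact: scalel_continuous.
have K0 : (comb @` @simplex R q.+1) !=set0.
  exists (comb (\row_j (j == ord0)%:R)), (\row_j (j == ord0)%:R) => //; split=> [j|].
    by rewrite mxE ler0n.
  by rewrite (bigD1 ord0)//= mxE eqxx big1 ?addr0// => j /negbTE j0; rewrite mxE j0.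
have near_had : \forall d \near (0 : R)^'+, forall i, forall t k k', 0 < t < d ->
    (comb @` @simplex R q.+1) k -> `|k' - k| < d ->
    `|t^-1 *: (cost i (xT + t *: k') - cost i xT) - dcost i k| <= de.
  apply: filter_forall => i; have [d d0 dP] := hadamard_unif (hadC i) Kc K0 de0.
  apply/at_right_dist; exists d => // d'; rewrite add0r => /andP[_ dd'] t k k' /andP[t0 td] Kk kk'.
  by apply: dP => //; rewrite ?t0 ?(lt_trans _ dd').
have [d [d0 dP]] : exists d, 0 < d /\ forall i, forall t k k', 0 < t < d ->
    (comb @` @simplex R q.+1) k -> `|k' - k| < d ->
    `|t^-1 *: (cost i (xT + t *: k') - cost i xT) - dcost i k| <= de.
  by apply: (@filter_ex _ ((0 : R)^'+)); apply: filterS2 near_had (nbhs_right_gt _) => d' ? ?.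
have [rho rho0 rhoP] : exists2 rho, 0 < rho &
    forall xi, `|xi - xT| < rho -> forall b, {for xi, continuous (h b)}.
  have : \forall xi \near xT, forall b, {for xi, continuous (h b)} by exact: filter_forall.
  by move=> /normed_nbhs[rho rho0 H]; exists rho.
have [X [u [XP Xe]]] := needle_combination (fun j => (nP j).1).
(* The scale must lie in the range of the Hadamard estimate, keep end points where the [h b] are
   continuous, and keep inactive constraints positive. *)
have [eps [eps0 epsd epsr epsg [XP' Xe']]] : exists eps, [/\ 0 < eps, eps < d, eps * (B + d) < rho,
    forall a, 0 < g a xT -> eps * (`|dcost (inl (inr a))| * B + de) < g a xT &
    (forall x, @simplex R q.+1 x ->
    [/\ PC1 T Omega (X eps x) /\ NPC0 T U (u eps x),
        forall t, t \in `[0, T] -> ext_deriv T (X eps x) t = f t (X eps x t) (u eps x t),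
        X eps x 0 = x0 0 &
        exists L, forall x', @simplex R q.+1 x' -> `|X eps x T - X eps x' T| <= L * `|x - x'|]) /\
    forall x, @simplex R q.+1 x -> `|X eps x T - xT - eps *: comb x| <= d / 2 * eps].
  have d20 : 0 < d / 2 by rewrite divr_gt0.
  have near_g : \forall eps \near (0 : R)^'+, forall a, 0 < g a xT ->
      eps * (`|dcost (inl (inr a))| * B + de) < g a xT.
    apply: filter_forall => a; have [ga|ga] := ltP 0 (g a xT); last first.
      by apply: nearW.
    by have := near_right_small (`|dcost (inl (inr a))| * B + de) ga; apply: filterS.
  have near1 : \forall eps \near (0 : R)^'+, [/\ 0 < eps, eps < d & eps * (B + d) < rho].
    apply: filter_app (near_right_small (B + d) rho0).
    by apply: filterS2 (nbhs_right_gt (0 : R)) (nbhs_right_lt d0) => eps h1 h2 h3; split.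
  apply: (@filter_ex _ ((0 : R)^'+)).
  apply: filter_app (Xe _ d20); apply: filterS3 near1 near_g XP => eps [? ? ?] ? ? ?.
  by split.
pose A x := X eps x T; pose k' x := eps^-1 *: (A x - xT).
have AE x : A x = xT + eps *: k' x by rewrite /k' scalerA mulfV ?gt_eqF// scale1r subrKC.
have k'P x : simplex x -> `|k' x - comb x| <= d / 2.
  move=> xS; have -> : k' x - comb x = eps^-1 *: (A x - xT - eps *: comb x).
    by rewrite /k' [in RHS]scalerBr scalerA mulVf ?gt_eqF// scale1r.
  rewrite normrZ ger0_norm ?invr_ge0 ?(ltW eps0)// mulrC ler_pdivrMr//; exact: Xe'.
have k'd x : simplex x -> `|k' x - comb x| < d.
  by move=> /k'P/le_lt_trans; apply; lra.
have had i x : simplex x -> `|eps^-1 * (cost i (A x) - cost i xT) - dcost i (comb x)| <= de.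
  move=> xS; rewrite AE; apply: dP; [by rewrite eps0 epsd|by exists x|exact: k'd].
have Arho x : simplex x -> `|A x - xT| < rho.
  move=> xS; apply: le_lt_trans epsr; rewrite AE addrC addKr normrZ gtr0_norm// ler_wpM2l ?(ltW eps0)//.
  by rewrite -(subrK (comb x) (k' x)) addrC (le_trans (ler_normD _ _))// lerD ?combB// ltW// k'd.
(* With this error, the equation solved by [simplex_zero] reads [eps^-1 * h b (A x) = 0]. *)
pose e x b : R := eps^-1 * h b (A x) - (x ord0 (lift ord_max b) - x ord0 ord_max).
have [||x xS ex] := @simplex_zero R q e q0.
- move=> b; apply/subspace_continuousP => x xS.
  have Ac : A y @[y --> within (@simplex R q.+1) (nbhs x)] --> A x.
    have [_ _ _ [L LP]] := XP' x xS.
    apply/cvgrPdist_lt => r r0; have L1 : 0 < `|L| + 1 by rewrite ltr_wpDl.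
    rewrite near_withinE; apply/nbhs_ballP; exists (r / (`|L| + 1)) => /=; first by rewrite divr_gt0.
    move=> y + yS; rewrite -ball_normE /= ltr_pdivlMr// mulrC; apply: le_lt_trans.
    apply: le_trans (LP y yS) _; rewrite ler_wpM2r// (le_trans (ler_norm L))// lerDl//.
  have hc : h b (A y) @[y --> within (@simplex R q.+1) (nbhs x)] --> h b (A x).
    exact: (@cvg_comp _ _ _ A (h b) _ (nbhs (A x)) _ Ac (rhoP _ (Arho _ xS) b)).
  have cc j : (y : 'rV[R]_q.+1) ord0 j @[y --> within (@simplex R q.+1) (nbhs x)] --> x ord0 j.
    by apply: cvg_within_filter; exact: coord_continuous.
  by apply: cvgB; [apply: cvgM (cvg_cst _) hc|exact: cvgB].
- move=> x b xS; have := had (inr b) x xS; have := comb_h b x xS.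
  rewrite /= h0 subr0 /e -/kap; move: (dcost _ _) => /= z h1 h2.
  rewrite -(subrKA z) (le_trans (ler_normD _ _))// (le_trans (lerD h2 h1))// /de; lra.
have [[XPC XNPC] Xode X0 _] := XP' x xS.
have costD i : eps^-1 * (cost i (A x) - cost i xT) >= dcost i (comb x) - de.
  by have := had i x xS; rewrite ler_distl => /andP[].
have improve i : 1 - de <= dcost i (comb x) -> cost i xT < cost i (A x).
  move=> ci; rewrite -subr_gt0 -(pmulr_rgt0 _ (x := eps^-1)) ?invr_gt0//.
  by apply: lt_le_trans (costD i); lra.
exists (X eps x), (u eps x); split=> //.
  by move=> i; apply: (improve (inl (inl i))); apply: comb_ge => // j; have [_ /(_ (inl (inl i)))] := nP j.
split=> [a|b].
  have [ga|ga] := eqVneq (g a xT) 0.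
    rewrite -ga ltW//; apply: (improve (inl (inr a))); apply: comb_ge => // j.
    by have [_ /(_ (inl (inr a)))/(_ ga)] := nP j.
  have {}ga : 0 < g a xT by rewrite lt_neqAle eq_sym ga g_ge0.
  have dB : - (`|dcost (inl (inr a))| * B) <= dcost (inl (inr a)) (comb x).
    suff : `|dcost (inl (inr a)) (comb x)| <= `|dcost (inl (inr a))| * B.
      by rewrite ler_norml => /andP[].
    by apply: le_trans (opnormP _ _) _; rewrite ler_wpM2l ?opnorm_ge0 ?combB.
  have : - (`|dcost (inl (inr a))| * B + de) <= eps^-1 * (g a (A x) - g a xT).
    by apply: le_trans (costD (inl (inr a))); rewrite opprD lerD2r.
  rewrite -(ler_pM2l eps0) mulrA mulfV ?gt_eqF// mul1r mulrN => H.
  have := epsg a ga; move: H; rewrite -/(A x); move: (eps * _) (g a _) (g a _) => z1 z2 z3; lra.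
have : eps^-1 * h b (A x) = 0.
  have := ex b; rewrite /e; move: (eps^-1 * _) => z; lra.
by move/eqP; rewrite mulf_eq0 invr_eq0 gt_eqF//= => /eqP.
Qed.

End Pareto.

(** * The adjoint equation and the maximum principle *)

Section Pairing.
Context {R : realType}.

Lemma is_derive_pairing {X Z : normedModType R} (p : R -> blin X Z) (y : R -> X) t p' y' :
  {for t, continuous y} -> is_derive t 1 p p' -> is_derive t 1 y y' ->
  is_derive t 1 (fun s => p s (y s)) (p' (y t) + p t y').
Proof.
move=> yc [pd pE] [yd yE].
have cp : h^-1 *: ((p \o shift t) (h *: 1) - p t) @[h --> 0^'] --> p' by rewrite -pE; exact: pd.
have cy : h^-1 *: ((y \o shift t) (h *: 1) - y t) @[h --> 0^'] --> y' by rewrite -yE; exact: yd.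
have ys : (y \o shift t) (h *: 1) @[h --> 0^'] --> y t.
  have shift_cvg : (h *: (1 : R^o) + t) @[h --> (0 : R)] --> 0 *: (1 : R^o) + t.
    by apply: cvgD (cvg_cst _); exact: scalel_continuous.
  rewrite scale0r add0r in shift_cvg.
  apply: (@cvg_comp _ _ _ (fun h : R => h *: (1 : R^o) + t) y _ (nbhs t)) => //.
  exact: cvg_within_filter.
suff cv : h^-1 *: (((fun s => p s (y s)) \o shift t) (h *: 1) - p t (y t)) @[h --> 0^'] -->
    p' (y t) + p t y'.
  apply: DeriveDef; first by apply/cvg_ex; eexists; exact: cv.
  exact/cvg_lim.
apply: cvg_trans (cvgD (cvg_blin cp ys) (cvg_blin (cvg_cst (p t)) cy)).
apply: near_eq_cvg; apply: nearW => h.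
have <- : (h^-1 *: (p (h *: 1 + t) - p t)) (y (h *: 1 + t)) +
    p t (h^-1 *: (y (h *: 1 + t) - y t)) =
  h^-1 *: (p (h *: 1 + t) (y (h *: 1 + t)) - p t (y t)); last by [].
move: (h *: 1 + t) => s.
have -> : (h^-1 *: (p s - p t)) (y s) = h^-1 *: (p s (y s) - p t (y s)) by [].
have -> : p t (h^-1 *: (y s - y t)) = h^-1 *: (p t (y s) - p t (y t)).
  by rewrite linearZ /= linearB.
by rewrite -scalerDr addrA subrK.
Qed.

Lemma is_derive_reverse {Z : normedModType R} (r : R -> Z) (c t : R) (d : Z) :
  is_derive (c - t) 1 r d -> is_derive t 1 (fun s => r (c - s)) (- d).
Proof.
move=> /is_derive_epsP rd; apply/is_derive_epsP => eta eta0.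
have /nbhs_dist[e e0 eP] := rd _ eta0; apply/nbhs_dist; exists e => // s st.
have E : c - s - (c - t) = - (s - t) by ring.
have := eP (c - s); rewrite E normrN => /(_ st).
by rewrite scaleNr scalerN.
Qed.

Lemma reverse_right (c t : R) : (fun s => c - s) @ t^'+ --> (c - t)^'-.
Proof.
move=> Q /at_left_dist[e e0 eP]; apply/at_right_dist; exists e => // s /andP[s1 s2].
by apply: eP; rewrite ltrD2l ltrN2 s1 andbT; lra.
Qed.

Lemma reverse_left (c t : R) : (fun s => c - s) @ t^'- --> (c - t)^'+.
Proof.
move=> Q /at_right_dist[e e0 eP]; apply/at_left_dist; exists e => // s /andP[s1 s2].
by apply: eP; rewrite ltrD2l ltrN2 s2 /=; lra.
Qed.

Lemma pcont_reverse {Z : topologicalType} (A : set Z) (Fs : seq R) T (v : R -> Z) :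
  pcont A Fs 0 T v -> pcont A [seq T - r | r <- Fs] 0 T (fun t => v (T - t)).
Proof.
move=> [vc vr vl]; split=> t /andP[t0 tT].
- move=> tF; have tF' : T - t \notin Fs.
    by apply: contra tF => h; apply/mapP; exists (T - t) => //; rewrite subKr.
  apply: (@continuous_comp _ _ _ (fun t => T - t) v).
    by apply: cvgB; [exact: cvg_cst|exact: cvg_id].
  by apply: vc => //; rewrite subr_gt0 tT gtrBl.
- have [|y Ay vy] := vl (T - t); first by rewrite subr_gt0 tT gerBl.
  by exists y => //; apply: cvg_comp vy; exact: reverse_right.
- have [|y Ay vy] := vr (T - t); first by rewrite subr_ge0 tT gtrBl.
  by exists y => //; apply: cvg_comp vy; exact: reverse_left.
Qed.

End Pairing.

Section Adjoint.
Context {R : realType} {E : completeNormedModType R} {Y : normedModType R}.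
Context {T : R} {Omega : set E} {U : set Y} {f : R -> E -> Y -> E} {x0 : R -> E} {u0 : R -> Y}.
Variable P : process T Omega U f x0 u0.
Local Notation A := (@Alin _ _ _ f x0 u0).

(** Reversing time turns the final condition into an initial one and removes the sign, so
    [linear_ode_comp] applies to the reversed coefficients. *)
Lemma exists_adjoint (pT : blin E R^o) : exists p : R -> blin E R^o,
  [/\ continuous p, p T = pT, exists Fs : seq R, forall t, 0 < t < T -> t \notin Fs ->
      is_derive t 1 p (- blin_comp (p t) (A t)),
    PC1 T setT p & forall t, t \in `[0, T] -> ext_deriv T p t = - blin_comp (p t) (A t)].
Proof.
have [Fs up] := u0_pcont P; have Ap := Alin_pcont P up.
have [r [rc r0 rd]] := linear_ode_comp pT (T_ge0 P) (pcont_reverse Ap).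
pose p t := r (T - t).
have pc : continuous p.
  move=> t; apply: (@continuous_comp _ _ _ (fun t => T - t) r); last exact: rc.
  by apply: cvgB; [exact: cvg_cst|exact: cvg_id].
have pd t : 0 < t < T -> t \notin Fs -> is_derive t 1 p (- blin_comp (p t) (A t)).
  move=> /andP[t0 tT] tF; apply: is_derive_reverse; have := rd (T - t); rewrite subKr.
  apply; first by rewrite subr_gt0 tT gtrBl.
  by apply: contra tF => /mapP[s sF] /(congr1 (fun z => T - z)); rewrite !subKr => ->.
exists p; have pcv (F : set_system R) (FF : Filter F) t B : (fun s : R => s) @ F --> t ->
    A @ F --> B -> - blin_comp (p s) (A s) @[s --> F] --> - blin_comp (p t) B.
  by move=> Ft AB; apply: cvgN; apply: cvg_blin_comp AB; exact: (@cvg_comp _ _ _ id p _ (nbhs t) _ Ft (pc t)).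
have [Ac Ar Al] := Ap.
have [|||||h1 h2] := @PC1_intro _ _ T setT Fs p (fun t => - blin_comp (p t) (A t)) (pr_T P).
- exact: continuous_subspaceT.
- split=> t tT.
  + by move=> tF; apply: pcv; [exact: cvg_id|exact: Ac].
  + have [B _ AB] := Ar t tT; exists (- blin_comp (p t) B) => //; apply: pcv; [exact: cvg_id_at_right|exact: AB].
  + have [B _ AB] := Al t tT; exists (- blin_comp (p t) B) => //; apply: pcv; [exact: cvg_id_at_left|exact: AB].
- by move=> t tT; apply: pcv; [exact: cvg_id_at_right|exact: Alin_right P _ tT].
- by apply: pcv; [exact: cvg_id_at_left|exact: Alin_left P].
- by [].
by split=> //; [rewrite /p subrr|exists Fs].
Qed.

(** The pairing [p t (y t)] is constant on [[t0, T]]: the derivatives given by the adjoint and the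
    linearised equations cancel. *)
Lemma adjoint_duality (p : R -> blin E R^o) t0 v y : continuous p ->
  (exists Fs : seq R, forall t, 0 < t < T -> t \notin Fs ->
      is_derive t 1 p (- blin_comp (p t) (A t))) ->
  0 <= t0 <= T -> @is_response _ _ _ T f x0 u0 t0 v y ->
  p t0 (f t0 (x0 t0) v - f t0 (x0 t0) (u0 t0)) = p T (y T).
Proof.
move=> pc [Fs pd] /[dup] t0T /andP[t00 t01] yP; have [yc y0 [Gs yd]] := yP.
have -> : f t0 (x0 t0) v - f t0 (x0 t0) (u0 t0) = y t0.
  by rewrite (response_frozen yP t01) ?t00 ?lexx// /needle_jump xbarE.
have rc : continuous (fun t => p t (y t)) by move=> t; apply: cvg_blin; [exact: pc|exact: yc].
have := @mean_value _ _ (fun t => p t (y t)) (Fs ++ Gs) t0 T 0 t01 (lexx _) rc.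
rewrite mul0r normr_le0 subr_eq0 => H; apply/esym/eqP/H => t /andP[t0t tT].
rewrite mem_cat negb_or => /andP[tF tG]; exists 0; last by rewrite normr0.
have t0' : 0 < t < T by rewrite tT (le_lt_trans t00).
have := is_derive_pairing (yc t) (pd t t0' tF) (yd t t0' tG).
by rewrite ltNge (ltW t0t)/= addNr.
Qed.

End Adjoint.

Section MaximumPrinciple.
Context {R : realType} {E : completeNormedModType R} {Y : normedModType R}.
Context {T : R} {Omega : set E} {U : set Y} {f : R -> E -> Y -> E} {x0 : R -> E} {u0 : R -> Y}.
Variable P : process T Omega U f x0 u0.
Local Notation A := (@Alin _ _ _ f x0 u0).
Local Notation X0 := (xbar T x0).
Variable p : R -> blin E R^o.
Hypothesis pc : continuous p.
Hypothesis pd : exists Fs : seq R, forall t, 0 < t < T -> t \notin Fs ->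
  is_derive t 1 p (- blin_comp (p t) (A t)).
Hypothesis pT : forall t v y, 0 <= t < T -> U v -> @is_response _ _ _ T f x0 u0 t v y ->
  p T (y T) <= 0.

Lemma hamiltonian_cvg (F : set_system R) {FF : Filter F} (zeta : R -> Y) (t : R) z :
  (\forall s \near F, 0 <= s <= T) -> (\forall s \near F, U (zeta s)) ->
  (fun s : R => s) @ F --> t -> zeta @ F --> z -> 0 <= t <= T -> U z ->
  (fun s => p s (f s (X0 s) (zeta s))) @ F --> p t (f t (X0 t) z).
Proof.
move=> FT FU Ft Fz tT zU; apply: cvg_blin.
  by apply: (@cvg_comp _ _ _ id p F (nbhs t) (nbhs (p t)) Ft); exact: pc.
apply: (f_cvg P (F := F) (tau := id) (xi := X0) (zeta := zeta)) => //; last exact: xbar_Omega P t.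
  by apply: filterS2 FT FU => s sT sU; split=> //; exact: xbar_Omega P s.
by apply: (@cvg_comp _ _ _ id X0 F (nbhs t) (nbhs (X0 t)) Ft); exact: xbar_continuous P t.
Qed.

(** For [t < T], duality carries the inequality at the end point back to the base of a needle. No
    needle can be based at [T]; there the inequality is a limit from the left. *)
Lemma maximum_principle t zeta : 0 <= t <= T -> U zeta ->
  p t (f t (x0 t) zeta) <= p t (f t (x0 t) (u0 t)).
Proof.
move=> tT zU; have below s : 0 <= s < T ->
    p s (f s (x0 s) zeta) <= p s (f s (x0 s) (u0 s)).
  move=> sT; have [y yP] := exists_response P s zeta.
  have := pT sT zU yP; rewrite -(adjoint_duality pc pd _ yP).
    by rewrite raddfB subr_le0.
  by case/andP: sT => -> /ltW.
have /andP[t0] := tT; rewrite le_eqVlt => /orP[/eqP tE|t1]; last by apply: below; rewrite t0.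
have T0 : 0 < T <= T by rewrite lexx (pr_T P).
have TT : 0 <= T <= T by rewrite lexx (T_ge0 P).
have nT := near_itv_left T0.
have cu : (fun s => p s (f s (X0 s) (u0 s))) @ T^'- --> p T (f T (X0 T) (u0 T)).
  apply: hamiltonian_cvg; [exact: nT| |exact: cvg_id_at_left|exact: u0_left P|exact: TT|].
    by apply: filterS nT => s; exact: u0_U P s.
  exact: (u0_U P).
have cz : (fun s => p s (f s (X0 s) zeta)) @ T^'- --> p T (f T (X0 T) zeta).
  apply: (hamiltonian_cvg (zeta := fun=> zeta)); [exact: nT| |exact: cvg_id_at_left|exact: cvg_cst|exact: TT|by []].
  exact: nearW.
rewrite tE -(@xbarE _ _ T x0)// -subr_ge0.
apply: (cvgr_to_ge (cvgB cu cz)).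
have := near_left_notin [::] (pr_T P); apply: filterS => s [/andP[s0 sT] _].
have s01 : 0 <= s <= T by rewrite !ltW.
by rewrite /= subr_ge0 !xbarE//; apply: below; rewrite sT ltW.
Qed.

(** Only the left limit at a jump of [u0] is in question. The left limit [y] of the control belongs
    to [U], so the maximum principle at [t] bounds its value by that of [u0 t]; the principle before
    [t], with the constant competitor [u0 t], gives the converse in the limit. *)
Lemma hamiltonian_continuous :
  {within `[0, T], continuous (fun t => p t (f t (x0 t) (u0 t)) : R^o)}.
Proof.
apply: (@subspace_eq_continuous _ _ _ (fun t => p t (f t (X0 t) (u0 t)) : R^o)).
  by move=> t; rewrite inE /= in_itv /= => tT; rewrite xbarE.
apply: within_itv_continuous => t tT.
  have t01 : 0 <= t <= T by case/andP: tT => -> /ltW.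
  have nt := near_itv_right tT.
  apply: hamiltonian_cvg; [exact: nt| |exact: cvg_id_at_right|exact: u0_right P t tT|by []|exact: u0_U P t t01].
  by apply: filterS nt => s; exact: u0_U P s.
have t01 : 0 <= t <= T by case/andP: tT => /ltW ->.
have nt := near_itv_left tT.
have nu : \forall s \near t^'-, U (u0 s) by apply: filterS nt => s; exact: u0_U P s.
have [Fs [_ _ ul]] := u0_pcont P; have [y yU uy] := ul t tT.
have cy : (fun s => p s (f s (X0 s) (u0 s))) @ t^'- --> p t (f t (X0 t) y).
  by apply: hamiltonian_cvg => //; exact: cvg_id_at_left.
have cu : (fun s => p s (f s (X0 s) (u0 t))) @ t^'- --> p t (f t (X0 t) (u0 t)).
  apply: (hamiltonian_cvg (zeta := fun=> u0 t)); [exact: nt| |exact: cvg_id_at_left|exact: cvg_cst|by []|exact: u0_U P t t01].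
  by apply: nearW => s; exact: u0_U P t t01.
suff -> : p t (f t (X0 t) (u0 t)) = p t (f t (X0 t) y) by [].
apply/le_anti/andP; split; last by rewrite xbarE//; exact: maximum_principle.
rewrite -subr_ge0; apply: (cvgr_to_ge (cvgB cy cu)); apply: filterS nt => s sT /=.
by rewrite subr_ge0 xbarE//; apply: maximum_principle => //; exact: u0_U P t t01.
Qed.

Lemma hamiltonian_frechet t : 0 <= t <= T ->
  differentiable (fun xi => p t (f t xi (u0 t)) : R^o) (x0 t) /\
  Dfrechet (fun xi => p t (f t xi (u0 t)) : R^o) (x0 t) = blin_comp (p t) (A t).
Proof.
move=> tT; have df : differentiable (fun xi => f t xi (u0 t)) (x0 t).
  by apply: (pr_frechet P); [rewrite in_itv_le|exact: u0_U P t tT].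
have dp z : differentiable (p t) z by apply: linear_differentiable; exact: blin_continuous.
have dH : differentiable (p t \o (fun xi => f t xi (u0 t))) (x0 t) by exact: differentiable_comp.
split=> //; apply/val_inj => /=; rewrite -(DfrechetP dH) diff_comp//.
rewrite (DfrechetP df) diff_lin//; exact: blin_continuous.
Qed.

End MaximumPrinciple.

Section BlinSums.
Context {R : realType}.

Lemma blin_sumE {X Y : normedModType R} {I : finType} (F : I -> blin X Y) x :
  (\sum_i F i) x = \sum_i F i x.
Proof. by apply: (big_morph (fun F : blin X Y => F x)). Qed.

Lemma blin_comp_suml {X Y Z : normedModType R} {I : finType} (c : I -> R) (F : I -> blin Y Z)
    (D : blin X Y) :
  blin_comp (\sum_i c i *: F i) D = \sum_i c i *: blin_comp (F i) D.
Proof.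
apply/val_inj/funext => x; transitivity (\sum_i (c i *: F i) (D x)); first exact: blin_sumE.
exact/esym/(blin_sumE (fun i => c i *: blin_comp (F i) D) x).
Qed.

End BlinSums.

Theorem corollary4p6
  (R : realType) (E : completeNormedModType R) (Y : normedModType R)
  (T : R) (Omega : set E) (U : set Y) (xi0 : E) (l m q : nat)
  (f : R -> E -> Y -> E)
  (g0 : 'I_l -> E -> R^o) (g : 'I_m -> E -> R^o) (h : 'I_q -> E -> R^o)
  (x0 : R -> E) (u0 : R -> Y)
  (T_gt0 : 0 < T)
  (Omega_open : open Omega) (xi0_Omega : Omega xi0)
  (l_gt0 : (0 < l)%N) (m_gt0 : (0 < m)%N) (q_gt0 : (0 < q)%N)
  (x0u0_opt : pareto_optimal T Omega U xi0 f g0 g h x0 u0)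
  (* (a) *)
  (f_cont : {within [set z : R * E * Y |
      [/\ z.1.1 \in `[0, T], Omega z.1.2 & U z.2]],
    continuous (fun z : R * E * Y => f z.1.1 z.1.2 z.2)})
  (f_gateaux : forall t xi zeta, t \in `[0, T] -> Omega xi -> U zeta ->
    gateaux_differentiable (fun xi' => f t xi' zeta) xi)
  (f_frechet : forall t zeta, t \in `[0, T] -> U zeta ->
    differentiable (fun xi => f t xi zeta) (x0 t))
  (f_frechet_cont : {within [set z : R * Y | z.1 \in `[0, T] /\ U z.2],
    continuous (fun z : R * Y => Dfrechet (fun xi => f z.1 xi z.2) (x0 z.1))})
  (* (b) *)
  (f_gateaux_bounded : forall (K : set E) (M : set Y),
    compact K -> K !=set0 -> K `<=` Omega ->
    compact M -> M !=set0 -> M `<=` U ->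
    (ereal_sup [set (`|Dgateaux (fun xi => f z.1.1 xi z.2) z.1.2|)%:E
      | z in [set z : R * E * Y | [/\ z.1.1 \in `[0%R, T], K z.1.2 & M z.2]]]
     < +oo)%E)
  (* (c) *)
  (g0_hadamard : forall i, hadamard_differentiable (g0 i) (x0 T))
  (g_hadamard : forall a, hadamard_differentiable (g a) (x0 T))
  (* (d) *)
  (h_cont : forall b, \forall xi \near x0 T, {for xi, continuous (h b)})
  (h_hadamard : forall b, hadamard_differentiable (h b) (x0 T))
  (* (e) *)
  (U_nbhs : nbhs (u0 T) U)
  (f3_gateaux : gateaux_differentiable (fun zeta => f T (x0 T) zeta) (u0 T))
  (indep : linearly_independent (fun c : 'I_m + 'I_q =>
    let D3 := Dgateaux (fun zeta => f T (x0 T) zeta) (u0 T) in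
    match c with
    | inl a => blin_comp (Dhadamard (g a) (x0 T)) D3
    | inr b => blin_comp (Dhadamard (h b) (x0 T)) D3
    end)) :
  (exists (theta : 'rV[R]_l) (lambda : 'rV[R]_m) (mu : 'rV[R]_q)
      (p : R -> blin E R^o),
    PC1 T setT p /\ pontryagin T U f g0 g h x0 u0 theta lambda mu p) /\
  (forall (theta : 'rV[R]_l) (lambda : 'rV[R]_m) (mu : 'rV[R]_q)
      (p : R -> blin E R^o),
    PC1 T setT p -> pontryagin T U f g0 g h x0 u0 theta lambda mu p ->
    theta <> 0).
Proof.
have [[[x0P u0P] ode xT0 g_ge0 h_eq0] x0_max] := x0u0_opt.
have P : process T Omega U f x0 u0 by split.
split; last first.
  move=> theta lambda mu p pP [NN Si Sl [TC AE MP CH]] theta0.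
  have TT : T \in `[0, T] by rewrite in_itv /= lexx ltW.
  (* The maximum at [T] is interior since [U] is a neighbourhood of [u0 T]. With [theta = 0], the
     transversality condition turns the vanishing derivative into a relation between the independent
     functionals. *)
  have pD : blin_comp (p T) (Dgateaux (fun zeta => f T (x0 T) zeta) (u0 T)) = 0.
    by apply: (gateaux_max_eq0 U_nbhs f3_gateaux) => zeta; exact: MP.
  pose c (i : 'I_m + 'I_q) := match i with inl a => lambda 0 a | inr b => mu 0 b end.
  pose F (i : 'I_m + 'I_q) : blin E R^o :=
    match i with inl a => Dhadamard (g a) (x0 T) | inr b => Dhadamard (h b) (x0 T) end.
  have pE : p T = \sum_i c i *: F i.
    rewrite -TC theta0 big_sumType /= big1 ?add0r// => i _.
    by rewrite mxE scale0r.
  have c0 : forall i, c i = 0.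
    apply: indep; move: pD; rewrite pE blin_comp_suml => D0; rewrite -[RHS]D0.
    by apply: eq_bigr => -[a|b] _.
  apply: NN; rewrite theta0; congr (_, _, _); apply/rowP => i; rewrite mxE.
    exact: c0 (inl i).
  exact: c0 (inr i).
pose J : finType := ('I_l + 'I_m + 'I_q)%type.
pose cst_ := @cost R E l m q g0 g h.
pose dcst := @dcost R E T x0 l m q g0 g h.
have hadC i : is_hadamard (cst_ i) (x0 T) (dcst i).
  by apply: (xgetPex 0); case: i => [[i|a]|b]; [exact: g0_hadamard|exact: g_hadamard|exact: h_hadamard].
have [mult [[j0 j0P] mg0 mg mK]] : exists mult : J -> R, [/\ exists j, mult j != 0,
    forall i, 0 <= mult (inl (inl i)),
    forall a, 0 <= mult (inl (inr a)) /\ mult (inl (inr a)) * g a (x0 T) = 0 &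
    forall t v y, 0 <= t < T -> U v -> @is_response _ _ _ T f x0 u0 t v y ->
      \sum_j mult j * dcst j (y T) <= 0].
  pose K := @variation_cone R E Y T U f x0 u0 l m q g0 g h.
  have K0 : K 0 by apply: variation_cone_slack => j; rewrite mxE; case: j => [[i|a]|b] /=.
  have [dense|[lam lam0 lamK]] :=
    cone_dichotomy K0 (@variation_coneD _ _ _ _ _ _ _ _ _ _ _ _ _ _)
      (@variation_coneZ _ _ _ _ _ _ _ _ _ _ _ _ _ _).
  - exfalso; apply: x0_max.
    have [x [u [xuP xode x_0 better [gx hx]]]] :=
      dense_cone_improves P q_gt0 g_ge0 h_eq0 h_cont hadC dense.
    exists x, u; split.
    + by split=> //; rewrite x_0.
    + by move=> i; exact: ltW.
    + by exists (Ordinal l_gt0).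
  - exact: separated_multipliers lam0 g_ge0 lamK.
(* The transversality condition is imposed as the final value of the adjoint equation. *)
pose pT : blin E R^o := \sum_j mult j *: dcst j.
have [p [pc pTE pd pP pode]] := exists_adjoint P pT.
have pneg t v y : 0 <= t < T -> U v -> @is_response _ _ _ T f x0 u0 t v y -> p T (y T) <= 0.
  by move=> tT vU yP; rewrite pTE /pT blin_sumE; exact: mK yP.
exists (\row_i mult (inl (inl i))), (\row_a mult (inl (inr a))), (\row_b mult (inr b)), p.
split=> //; split.
- move=> [/rowP t0 /rowP l0 /rowP m0]; move/eqP: j0P; apply.
  by case: j0 => [[i|a]|b]; [have := t0 i|have := l0 a|have := m0 b]; rewrite !mxE.
- by split=> i; rewrite mxE; [exact: mg0|exact: (mg i).1].
- by move=> a; rewrite mxE; exact: (mg a).2.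
split.
- rewrite pTE /pT !big_sumType /=; congr (_ + _ + _); apply: eq_bigr => i _; by rewrite mxE.
- move=> t /[dup] tT; rewrite in_itv /= => tT'.
  have [h1 h2] := hamiltonian_frechet P p tT'.
  by split=> //; rewrite pode// -h2.
- move=> t zeta; rewrite in_itv /= => tT zU; have := maximum_principle P pc pd pneg tT zU; rewrite /hamiltonian; apply.
- have := hamiltonian_continuous P pc pd pneg; rewrite /hamiltonian; apply.
Qed.
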